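(* Let $f\colon \mathbb R/\mathbb Z\to\mathbb R/\mathbb Z$ be a multicritical circle map with irrational rotation number, and let $s<0$ be a real number. Then $f$ has a unique $s$-measure; that is, there exists exactly one Borel probability measure $\mu$ on $\mathbb R/\mathbb Z$ such that for every continuous function $\phi\colon\mathbb R/\mathbb Z\to\mathbb R$, $$\int_{\mathbb R/\mathbb Z}\phi\, d\mu=\int_{\mathbb R/\mathbb Z}\bigl(f'(f^{-1}(x))\bigr)^{-s}\,\phi(f^{-1}(x))\,d\mu(x).$$
   Context: An orientation-preserving $C^3$-smooth circle homeomorphism $f$ is called multicritical if $f'>0$ everywhere except at finitely many points (the critical points), and on a neighborhood of each of these points $c_n$ one has $f(x)=f(c_n)+\psi_n(x)|\psi_n(x)|^{d_n-1}$, where $\psi_n$ is a $C^3$-smooth diffeomorphism (onto its image) and $d_n$ is a real number, called the order of $c_n$. The rotation number of an orientation-preserving circle homeomorphism $f$ is $\rho(f)=\lim_{n\to\infty}F^n(x)/n \bmod 1$, where $F\colon\mathbb R\to\mathbb R$ is a lift of $f$. *)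

(* Defs.v *)
(* MathComp-Analysis, over an arbitrary R : realType. *)
From mathcomp Require Import all_boot all_order all_algebra.
From mathcomp Require Import all_classical all_reals all_analysis.

Set Implicit Arguments.
Unset Strict Implicit.
Unset Printing Implicit Defensive.

Import Order.TTheory GRing.Theory Num.Theory.
Import numFieldNormedType.Exports.

Local Open Scope classical_set_scope.
Local Open Scope ring_scope.
Local Open Scope quotient_scope.

(* R/Z, with the quotient topology; Num.int_num_subdef is the predicate
   underlying Num.int, i.e. the additive subgroup Z of R. *)
Definition circle (R : realType) : Type :=
  quotient_topology
    {ideal_quot [the zmodClosed R of (@Num.int_num_subdef R : {pred R})]}.

Definition circle_pi (R : realType) (x : R) : circle R := \pi_(circle R) x.

Definition borel_circle (R : realType) : measurableType _ :=
  g_sigma_algebraType (@open (circle R)).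

Definition circle_homeo (R : realType) (f : circle R -> circle R) : Prop :=
  exists g : circle R -> circle R,
    [/\ cancel f g, cancel g f, continuous f & continuous g].

Definition is_lift (R : realType) (f : circle R -> circle R) (F : R -> R) :
    Prop :=
  continuous F /\ forall x, circle_pi (F x) = f (circle_pi x).

(* Two lifts of f differ by an integer constant, so none of the notions below
   depends on which one is picked. *)
Definition circle_lift (R : realType) (f : circle R -> circle R) : R -> R :=
  get (is_lift f).

Definition orientation_preserving (R : realType) (f : circle R -> circle R) :
    Prop :=
  exists2 F, is_lift f F & {homo F : x y / x < y}.

(* The rotation number is an element of R/Z; the limit along the orbit of 0
   is the limit along every orbit. *)
Definition rotation_number (R : realType) (f : circle R -> circle R) :
    circle R :=
  circle_pi (lim ((iter n (circle_lift f) 0 / n%:R) @[n --> \oo])).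

Definition irrational_rotation_number (R : realType)
    (f : circle R -> circle R) : Prop :=
  (@circle_pi R @` @irrational R) (rotation_number f).

(* f' as a real function on R/Z: the derivative of a lift is 1-periodic when
   f is an orientation-preserving homeomorphism, so the representative of x
   does not matter. *)
Definition circle_derive (R : realType) (f : circle R -> circle R)
    (x : circle R) : R :=
  (circle_lift f)^`()%classic (repr x).

(* Meant for open U, where the iterated derivatives of g at the points of U
   only depend on the restriction of g to U. *)
Definition Ck_on (R : realType) (k : nat) (U : set R) (g : R -> R) : Prop :=
  (forall i x, (i < k)%N -> U x -> derivable (g^`(i)%classic) x 1) /\
  (forall x, U x -> {for x, continuous (g^`(k)%classic)}).

Definition C3_diffeo_onto_image (R : realType) (U : set R) (g : R -> R) :
    Prop :=
  [/\ Ck_on 3 U g, open (g @` U) &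
      exists h : R -> R,
        Ck_on 3 (g @` U) h /\ forall x, U x -> h (g x) = x].

Definition critical_points (R : realType) (f : circle R -> circle R) :
    set (circle R) :=
  [set x | circle_derive f x = 0].

(* The local form at a critical point is written in the coordinate of the
   universal cover; at x = c it forces psi c = 0, and d > 1 follows when
   F is differentiable at c with F' c = 0. *)
Definition power_law_at (R : realType) (F : R -> R) (c d : R) : Prop :=
  exists (U : set R) (psi : R -> R),
    [/\ open U, U c, C3_diffeo_onto_image U psi &
        forall x, U x -> F x = F c + psi x * `|psi x| `^ (d - 1)].

Definition multicritical (R : realType) (f : circle R -> circle R) : Prop :=
  [/\ circle_homeo f /\ orientation_preserving f,
      Ck_on 3 setT (circle_lift f),
      finite_set (critical_points f),
      forall x, ~ critical_points f x -> 0 < circle_derive f x &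
      forall c : R, critical_points f (circle_pi c) ->
        exists d : R, power_law_at (circle_lift f) c d].

(* When f is bijective, pinv setT f is its inverse.  For s < 0, powR satisfies
   0 `^ (- s) = 0, so the density vanishes at the critical values. *)
Definition s_measure (R : realType) (f : circle R -> circle R) (s : R)
    (mu : probability (borel_circle R) R) : Prop :=
  forall phi : circle R -> R, continuous phi ->
    (\int[mu]_x (phi x)%:E =
     \int[mu]_x ((circle_derive f (pinv setT f x)) `^ (- s) *
                 phi (pinv setT f x))%:E)%E.

(* Main.v *)
(* Lift [f] to [F : R -> R], put [t = - s], and let [A] and [B] be consecutive
   closest returns of [F], one to the right and one to the left; write
   [m x = A x - x].  Power maps contract four-point cross-ratios and C^2
   diffeomorphisms distort them by a factor [expR (C * length)]; as the intervals
   [(F^j x, F^j (A x)]] overlap boundedly up to the next return, iterates of [F]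
   have bounded cross-ratio distortion at every such scale.  Hence
   [m (A x)] and [m x] are comparable, and [(F^j)' x * m x <= C * m (F^j x)].

   An [s]-measure is the differential of a distribution function [H] with
   [dH = F' ^ t d(H \o F)].  The derivative bound makes [H (A x) - H x] comparable
   to [m x ^ (- t)] divided by the sum of the [m (F^j x) ^ (- t)], with constants
   depending neither on [H] nor on the scale, so two normalised such functions
   are comparable on all intervals; subtracting from one the largest multiple of
   the other that leaves it nondecreasing shows that they are equal.  For
   existence, put on a backward orbit the atoms dictated by the transformation
   rule: their sum is unbounded while the weights of infinitely many atoms are
   bounded, so that the normalised truncations have a limit of the required
   kind. *)

Require Import Defs.
From HB Require Import structures.
From mathcomp Require Import all_boot all_order all_algebra.
From mathcomp Require Import all_classical all_reals all_analysis.
From mathcomp Require Import measurable_realfun.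
From mathcomp Require Import zify ring lra.
Import Order.TTheory GRing.Theory Num.Theory.
Import numFieldNormedType.Exports.
Local Open Scope classical_set_scope.
Local Open Scope ring_scope.

Set Implicit Arguments.
Unset Strict Implicit.
Unset Printing Implicit Defensive.

(** * Closest returns and real bounds *)

(** The obstacle is that [F'] vanishes at critical points: derivatives of iterates have no pointwise
    lower bound, and cross-ratios are controlled in one direction only. Every comparison therefore
    rests on upper bounds for [(F^n)']. The mass of a gap at [x] is bounded above along the orbit
    that starts at [x], and below by the same estimate along an orbit that ends at [x]. The
    distortion is stored in a nondecreasing function [Xi] with [Xi (x + 1) = Xi x + hX], a multiple
    of length plus jumps at the critical points. Distortion summed along an orbit is then the
    [Xi]-mass of a tower of intervals, and a single covering statement (multiplicity at least one
    and at most two) serves for distortion, for masses and, applied to floor functions, for counting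
    visits. Measures enter only at the end. Before that everything concerns nondecreasing functions
    on the line, and the transformation rule is stated so as to be linear, because the uniqueness
    argument applies it to a difference of two distribution functions. *)

Section Increments.
Variables (R : realType).
Implicit Types (F H : R -> R) (x y z : R).

Definition degree_one (h : R) H := forall x, H (x + 1) = H x + h.

Lemma degree_oneD h H : degree_one h H ->
  forall (k : int) x, H (x + k%:~R) = H x + k%:~R * h.
Proof.
move=> H1; have Hn (n : nat) x : H (x + n%:R) = H x + n%:R * h.
  elim: n x => [|n IH] x; first by rewrite addr0 mul0r addr0.
  by rewrite -!natr1 addrA H1 IH; ring.
case=> n x; first exact: Hn.
rewrite NegzE mulrNz -pmulrn; apply/esym.
have := Hn n.+1 (x - n.+1%:R); rewrite subrK => ->; ring.
Qed.

Section Iterates.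
Variable F : R -> R.
Hypothesis F1 : degree_one 1 F.
Hypothesis F_inc : {homo F : x y / x < y}.

Lemma iter_degree_one n : degree_one 1 (iter n F).
Proof. by elim: n => [|n IH] x //=; rewrite IH F1. Qed.

Lemma iter_shift n (k : int) x : iter n F (x + k%:~R) = iter n F x + k%:~R.
Proof. by rewrite (degree_oneD (iter_degree_one n)) mulr1. Qed.

Lemma iter_inc n : {homo iter n F : x y / x < y}.
Proof. by elim: n => [|n IH] x y xy //=; apply/F_inc/IH. Qed.

Lemma iter_leq n x y : (iter n F x <= iter n F y) = (x <= y).
Proof. exact: (le_mono (iter_inc n)). Qed.

Lemma iter_ltn n x y : (iter n F x < iter n F y) = (x < y).
Proof. by rewrite !ltNge iter_leq. Qed.

(* The lift [x |-> F^a(x) - p] of the [a]-th iterate of the circle map. *)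
Definition ret (a : nat) (p : int) x := iter a F x - p%:~R.

Lemma ret_shift a p (k : int) x : ret a p (x + k%:~R) = ret a p x + k%:~R.
Proof. by rewrite /ret iter_shift; ring. Qed.

Lemma ret_iter a p n x : ret a p (iter n F x) = iter n F (ret a p x).
Proof. by rewrite /ret -iterD addnC iterD -mulrNz iter_shift. Qed.

Lemma ret_le a p x y : (ret a p x <= ret a p y) = (x <= y).
Proof. by rewrite /ret lerD2r iter_leq. Qed.

Lemma ret_lt a p x y : (ret a p x < ret a p y) = (x < y).
Proof. by rewrite /ret ltrD2r iter_ltn. Qed.

Lemma ret_ret a p b q x : ret a p (ret b q x) = ret (a + b) (p + q) x.
Proof. by rewrite /ret -mulrNz iter_shift -iterD mulrNz intrD; ring. Qed.

(* [A = ret a p] moves points to the right and [B = ret b q] to the left; they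
   are two consecutive closest returns, [B] being the later and closer one. *)
Record good_pair (a : nat) (p : int) (b : nat) (q : int) : Prop := GoodPair {
  gp_det : a%:Z * q - b%:Z * p = 1;
  gp_pos : (0 < a)%N;
  gp_le : (a <= b)%N;
  gp_right : forall x, x < ret a p x;
  gp_left : forall x, ret b q x < x;
  gp_closer : forall x, x < ret (a + b) (p + q) x }.

(** The mass that [dH] gives to the first [n] images of the gap between [x] and [ret a p x], with
    multiplicity. *)
Definition return_tower (a : nat) (p : int) (n : nat) H x :=
  \sum_(i < n) (H (iter i F (ret a p x)) - H (iter i F x)).

Lemma telescope_swap (u : nat -> R) a b :
  \sum_(i < b) (u (i + a)%N - u i) = \sum_(i < a) (u (i + b)%N - u i).
Proof.
have E m n : \sum_(i < m + n) u i =
    \sum_(i < m) u i + \sum_(i < n) u (i + m)%N.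
  rewrite big_split_ord /=; congr (_ + _).
  by apply: eq_bigr => i _; rewrite addnC.
have := E b a; rewrite addnC E !sumrB => e; lra.
Qed.

(** The dynamical partition: for a good pair, the first [b] images of the right gap at [x] and the
    first [a] images of the left gap tile the circle. Up to integer translations the two towers are
    the two sides of [telescope_swap]; the translations contribute [(a q - b p) h = h]. *)
Lemma return_tower_swap a p b q h H x : degree_one h H ->
  a%:Z * q - b%:Z * p = 1 ->
  return_tower a p b H x - return_tower b q a H x = h.
Proof.
move=> H1 det.
have E n c r : return_tower c r n H x =
    \sum_(i < n) (H (iter (i + c) F x) - H (iter i F x)) - (n%:Z * r)%:~R * h.
  rewrite /return_tower.
  under eq_bigr => i _ do
    rewrite /ret -mulrNz iter_shift (degree_oneD H1) -iterD.
  rewrite -[X in _ = _ - X](mulrC h).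
  under eq_bigr => i _ do rewrite addrAC.
  rewrite big_split /= sumr_const card_ord; congr (_ + _).
  by rewrite mulrNz mulNr mulNrn -mulr_natl intrM; ring.
have -> : h = (a%:Z * q - b%:Z * p)%:~R * h by rewrite det mul1r.
by rewrite !E (telescope_swap (fun i => H (iter i F x))) intrB; ring.
Qed.

Section Tower.
Variables (a : nat) (p : int) (b : nat) (q : int).
Hypothesis gp : good_pair a p b q.
Variables (h : R) (H : R -> R).
Hypothesis H1 : degree_one h H.
Hypothesis H_nd : {homo H : x y / x <= y}.

Lemma return_tower_le1 x : return_tower a p b H x <= h.
Proof.
rewrite -(return_tower_swap x H1 (gp_det gp)) lerBrDr.
rewrite gerDl; apply: sumr_le0 => i _; rewrite subr_le0 H_nd// iter_leq ltW//.
exact: (gp_left gp).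
Qed.

Lemma return_tower_mono n m x : (n <= m)%N ->
  return_tower a p n H x <= return_tower a p m H x.
Proof.
move=> /subnK <-; rewrite addnC /return_tower big_split_ord /= lerDl.
apply: sumr_ge0 => i _; rewrite subr_ge0 H_nd// iter_leq ltW//.
exact: (gp_right gp).
Qed.

Lemma return_towerD n m x : return_tower a p (n + m) H x =
  return_tower a p n H x + return_tower a p m H (iter n F x).
Proof.
rewrite /return_tower big_split_ord /=; congr (_ + _); apply: eq_bigr => i _.
by rewrite ret_iter -!iterD addnC.
Qed.

(** Since [n <= a + b <= b + b], two consecutive blocks of [b] images suffice, and each block is
    part of a partition. *)
Lemma return_tower_le2 n x : (n <= a + b)%N -> return_tower a p n H x <= h *+ 2.
Proof.
move=> nab; apply: (@le_trans _ _ (return_tower a p (b + b) H x)).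
  by apply: return_tower_mono; apply: (leq_trans nab); rewrite leq_add2r (gp_le gp).
by rewrite return_towerD mulr2n lerD ?return_tower_le1.
Qed.

(** The left gaps of the partition are covered by later images of the right gap: modulo integers,
    image number [b + i] begins at the [i]-th image of [ret b q x] and ends beyond [iter i F x],
    because by [gp_closer] the composite return still moves to the right. *)
Lemma return_tower_ge1 x : h <= return_tower a p (a + b) H x.
Proof.
rewrite addnC return_towerD.
rewrite -{1}(return_tower_swap x H1 (gp_det gp)) lerD2l.
rewrite -sumrN; apply: ler_sum => i _.
have E y : H (iter i F (iter b F y)) = H (iter i F (ret b q y)) + q%:~R * h.
  rewrite -(degree_oneD H1) -iter_shift; congr (H (iter i F _)).
  by rewrite /ret subrK.
rewrite opprB ret_iter !E.
have : H (iter i F x) <= H (iter i F (ret b q (ret a p x))).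
  rewrite H_nd// iter_leq ret_ret addnC (addrC q) ltW//.
  exact: (gp_closer gp).
lra.
Qed.

End Tower.

End Iterates.
End Increments.

Section CrossRatio.
Variable R : realType.
Implicit Types (F : R -> R) (p q r s : R).

(** This cross-ratio is small exactly when the middle interval is long compared with one of its
    neighbours. Iterates raise it by at most a controlled factor, so a lower bound at a later time
    is inherited by earlier times; the real bounds are obtained in this direction. *)
Definition cross_ratio p q r s := ((q - p) * (s - r)) / ((r - p) * (s - q)).

Lemma cross_ratio_shift k p q r s :
  cross_ratio (p + k) (q + k) (r + k) (s + k) = cross_ratio p q r s.
Proof.
have e u v : (u + k) - (v + k) = u - v by ring.
by rewrite /cross_ratio !e.
Qed.

Lemma cross_ratio_gt0 p q r s : p < q -> q < r -> r < s ->
  0 < cross_ratio p q r s.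
Proof.
by move=> pq qr rs; rewrite /cross_ratio divr_gt0 ?mulr_gt0 ?subr_gt0//;
  lra.
Qed.

Lemma cross_ratio_le_left p q r s K : p < q -> q < r -> r < s -> 0 < K ->
  K^-1 <= cross_ratio p q r s -> r - q <= K * (q - p).
Proof.
move=> pq qr rs K0; rewrite /cross_ratio ler_pdivlMr; last by apply: mulr_gt0; lra.
rewrite mulrC ler_pdivrMr// => cr.
have h : (r - p) * (s - r) <= (q - p) * K * (s - r).
  apply: le_trans (_ : _ <= (r - p) * (s - q)) _; last by apply: (le_trans cr); lra.
  by rewrite ler_wpM2l//; lra.
have : r - p <= (q - p) * K by rewrite -(ler_pM2r (_ : 0 < s - r))//; lra.
lra.
Qed.

Lemma cross_ratio_le_right p q r s K : p < q -> q < r -> r < s -> 0 < K ->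
  K^-1 <= cross_ratio p q r s -> r - q <= K * (s - r).
Proof.
move=> pq qr rs K0; rewrite /cross_ratio ler_pdivlMr; last by apply: mulr_gt0; lra.
rewrite mulrC ler_pdivrMr// => cr.
have h : (q - p) * (s - q) <= (q - p) * ((s - r) * K).
  apply: le_trans (_ : _ <= (r - p) * (s - q)) _; last by apply: (le_trans cr); lra.
  by rewrite ler_wpM2r//; lra.
have : s - q <= (s - r) * K by rewrite -(ler_pM2l (_ : 0 < q - p))//; lra.
lra.
Qed.

Lemma cross_ratio_ge p q r s K : p < q -> q < r -> r < s -> 0 < K ->
  r - q <= K * (q - p) -> r - q <= K * (s - r) ->
  ((1 + K) ^+ 2)^-1 <= cross_ratio p q r s.
Proof.
move=> pq qr rs K0 h1 h2.
rewrite /cross_ratio ler_pdivlMr; last by apply: mulr_gt0; lra.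
rewrite mulrC ler_pdivrMr; last by apply: exprn_gt0; lra.
have -> : (q - p) * (s - r) * (1 + K) ^+ 2 =
  ((1 + K) * (q - p)) * ((1 + K) * (s - r)) by ring.
by apply: ler_pM; lra.
Qed.

End CrossRatio.

(** * Real bounds: neighbouring gaps are comparable at every scale *)

Section RealBounds.
Variable R : realType.
Variables (F Xi : R -> R) (hX : R).
Hypothesis F1 : degree_one 1 F.
Hypothesis F_inc : {homo F : x y / x < y}.
Hypothesis F_cont : continuous F.
Hypothesis Xi1 : degree_one hX Xi.
Hypothesis Xi_nd : {homo Xi : x y / x <= y}.
Hypothesis F_cr : forall p0 p q r s, p0 < p -> p < q -> q < r -> r < s ->
  cross_ratio (F p) (F q) (F r) (F s) <=
  expR (Xi s - Xi p0) * cross_ratio p q r s.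

Lemma lift_surj y : exists x, F x = y.
Proof.
have F0 (k : int) : F k%:~R = F 0 + k%:~R.
  by rewrite -(mulr1 k%:~R) -(degree_oneD F1) add0r mulr1.
set k := Num.floor (y - F 0).
have := floor_itv (y - F 0); rewrite -/k => /andP[k1 k2].
have [] := @IVT R F k%:~R (k + 1)%:~R y.
- by rewrite ler_int; lia.
- exact: continuous_subspaceT.
- by rewrite !F0 minElt maxElt ltrD2l ltr_int ltrDl ltr01 ; lra.
by move=> x _ <-; exists x.
Qed.

Lemma iter_surj n y : exists x, iter n F x = y.
Proof.
elim: n y => [|n IH] y; first by exists y.
have [z <-] := lift_surj y; have [x <-] := IH z; by exists x.
Qed.

Lemma ret_surj a p y : exists x, ret F a p x = y.
Proof.
by have [x xy] := iter_surj a (y + p%:~R); exists x; rewrite /ret xy addrK.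
Qed.

Lemma iter_cont n : continuous (iter n F).
Proof.
elim: n => [|n IH] x; first exact: cvg_id.
by apply: continuous_comp; [exact: IH | exact: F_cont].
Qed.

Lemma ret_cont a p : continuous (ret F a p).
Proof. by move=> x; apply: cvgB; [exact: iter_cont | exact: cvg_cst]. Qed.

(** The exponents add up to the [Xi]-mass of a tower of images, which the covering estimate bounds
    independently of the scale. *)
Lemma iter_cross_ratio n p0 p q r s : p0 < p -> p < q -> q < r -> r < s ->
  cross_ratio (iter n F p) (iter n F q) (iter n F r) (iter n F s) <=
  expR (\sum_(i < n) (Xi (iter i F s) - Xi (iter i F p0))) *
    cross_ratio p q r s.
Proof.
move=> p0p pq qr rs; elim: n => [|n IH].
  by rewrite big_ord0 expR0 mul1r.
rewrite big_ord_recr /= addrC expRD -mulrA.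
apply: le_trans (F_cr (iter_inc F_inc n p0p) (iter_inc F_inc n pq)
  (iter_inc F_inc n qr) (iter_inc F_inc n rs)) _.
by rewrite ler_wpM2l ?expR_ge0.
Qed.

Lemma periodic_min (f : R -> R) : continuous f -> degree_one 0 f ->
  exists x0, forall x, f x0 <= f x.
Proof.
move=> fc f1; have [|c _ cm] := @EVT_min R f 0 1 ler01.
  exact: continuous_subspaceT.
exists c => x; have := floor_itv x; set k := Num.floor x => kx.
rewrite -(subrK k%:~R x) (degree_oneD f1) mulr0 addr0; apply: cm.
by rewrite in_itv /=; move: kx; rewrite intrD; lra.
Qed.

Section Scale.
Variables (a : nat) (p : int) (b : nat) (q : int).
Hypothesis gp : good_pair F a p b q.
Notation A := (ret F a p).
Notation m x := (A x - x).

Let A_right : forall x, x < A x := gp_right gp.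

Lemma gap_shift (k : int) x : m (x + k%:~R) = m x.
Proof. by rewrite ret_shift//; ring. Qed.

Lemma return_hits x z : exists (j : nat) (k : int),
  (j < a + b)%N /\ iter j F x < z + k%:~R <= iter j F (A x).
Proof.
(* The increments of [H] count the points of [z + Z]; tower mass at least one means that some image
   contains such a point. *)
pose H y : R := (Num.floor (y - z))%:~R.
have H1 : degree_one 1 H.
  by move=> y; rewrite /H addrAC floorDrz ?int_num1// intrD floor1.
have H_nd : {homo H : x y / x <= y}.
  by move=> u v uv; rewrite /H ler_int le_floor// lerD2r.
apply: contrapT => hN.
have := return_tower_ge1 F1 F_inc gp H1 H_nd x.
suff -> : return_tower F a p (a + b) H x = 0 by rewrite ler10.
apply: big1 => i _; apply/eqP; rewrite subr_eq0; apply/eqP.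
apply/eqP; rewrite eq_le [X in _ && X]H_nd ?andbT; last first.
  by rewrite iter_leq// ltW.
rewrite leNgt; apply/negP; rewrite /H ltr_int => lt.
apply: hN; exists i, (Num.floor (iter i F (A x) - z)); split => //.
have := floor_le (iter i F (A x) - z).
have : iter i F x - z < (Num.floor (iter i F (A x) - z))%:~R.
  by rewrite -floor_lt_int.
lra.
Qed.

(** The four points will lie within five consecutive gaps, and the tower of each gap has [Xi]-mass
    at most [2 hX]. *)
Definition distortion := expR (hX *+ 10).

Lemma tower_iter k n x : (n <= a + b)%N ->
  \sum_(i < n) (Xi (iter i F (iter k A x)) - Xi (iter i F x)) <= hX *+ (k * 2).
Proof.
move=> nab; elim: k => [|k IH] /=.
  by rewrite mul0n mulr0n sumr_le0// => i _; rewrite subrr.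
rewrite mulSn mulrnDr.
apply: le_trans (_ : _ <= return_tower F a p n Xi (iter k A x) +
  \sum_(i < n) (Xi (iter i F (iter k A x)) - Xi (iter i F x))) _.
  by rewrite -big_split /= ler_sum// => i _; rewrite subrKA.
by apply: lerD IH; exact: (return_tower_le2 F1 F_inc gp Xi1 Xi_nd).
Qed.

Lemma scale_cross_ratio x n p1 q1 r1 s1 : (n <= a + b)%N ->
  x < p1 -> p1 < q1 -> q1 < r1 -> r1 < s1 -> s1 <= iter 5 A x ->
  cross_ratio (iter n F p1) (iter n F q1) (iter n F r1) (iter n F s1) <=
    distortion * cross_ratio p1 q1 r1 s1.
Proof.
move=> nab xp pq qr rs sx.
apply: le_trans (iter_cross_ratio n xp pq qr rs) _.
rewrite ler_wpM2r ?(ltW (cross_ratio_gt0 _ _ _))//.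
rewrite ler_expR; apply: le_trans (tower_iter 5 x nab).
by apply: ler_sum => i _; rewrite lerB// Xi_nd// iter_leq.
Qed.

Let E := distortion.
Let E_gt0 : 0 < E. Proof. exact: expR_gt0. Qed.

(** In units of the smallest gap, its left neighbour has length at most [2 ^+ 2 * E], hence both
    together at most [1 + 2 ^+ 2 * E]. Then [cross_ratio_ge] adds one and squares, and pulling back
    costs a last factor [E]. *)
Definition bounds_const := E * (2 + (2 ^+ 2 * E)) ^+ 2.

Lemma bounds_const_gt0 : 0 < bounds_const.
Proof. by rewrite mulr_gt0// exprn_gt0// addr_gt0// mulr_gt0// exprn_gt0. Qed.

(** The argument starts at the smallest gap, which is trivially bounded by its neighbours. Images of
    any gap meet it before time [a + b], and the lower cross-ratio bound found there is carried back
    to [x]. *)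
Lemma gap_bounds x : m (A x) <= bounds_const * m x /\
  m (A x) <= bounds_const * m (A (A x)).
Proof.
have [x0 x0m] : exists x0, forall x, m x0 <= m x.
  apply: periodic_min => [y|y]; first by apply: cvgB; [exact: ret_cont|exact: cvg_id].
  by rewrite addr0 (gap_shift 1).
have mlt u v : u < v -> A u < A v by rewrite ret_lt.
have [y1 y1E] := ret_surj a p x0; have [y0 y0E] := ret_surj a p y1.
have [z0 z0E] := ret_surj a p y0.
(* The three gaps centred at the smallest one have cross-ratio at least 1/4. Pulled back by [A], the
   smallest gap becomes the right-hand one and controls the gap before it. *)
have s1 : m y1 <= 2 ^+ 2 * E * m x0.
  rewrite y1E; have := A_right z0; have := A_right y0; have := A_right y1.
  have := A_right x0; rewrite z0E y0E y1E => l3 l2 l1 l0.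
  apply: cross_ratio_le_right (_ : y0 < _) _ _ _ _ => //.
    by rewrite mulr_gt0// exprn_gt0.
  rewrite invfM ler_pdivrMr// mulrC -[2]/(1 + 1).
  have n_le : (a <= a + b)%N by rewrite leq_addr.
  have := scale_cross_ratio n_le l0 l1 l2 l3.
  rewrite /= z0E y0E y1E => /(_ _)/(le_trans _); apply; last first.
    by rewrite ltW.
  rewrite -(cross_ratio_shift (- p%:~R)).
  rewrite -!/(ret F a p _) y0E y1E.
  apply: cross_ratio_ge => //; rewrite mul1r; last exact: x0m.
  by have := x0m y1; rewrite y1E.
(* [return_hits] is applied at [A x], so that it is the image of the middle gap that meets a
   translate of [x0]; this image then lies between [y1] and [A x0], up to an integer. *)
have step : (bounds_const)^-1 <= cross_ratio x (A x) (A (A x)) (A (A (A x))).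
  have [z zE] := ret_surj a p x.
  have [j [k [jab /andP[j1 j2]]]] := return_hits (A x) x0.
  set y := iter j F x.
  have yA : iter j F (A x) = A y by rewrite ret_iter.
  have yAA : iter j F (A (A x)) = A (A y) by rewrite !ret_iter.
  have yAAA : iter j F (A (A (A x))) = A (A (A y)) by rewrite !ret_iter.
  have xz : z < x by rewrite -zE.
  rewrite /bounds_const invfM mulrC ler_pdivrMr// [leRHS]mulrC.
  have := scale_cross_ratio (ltnW jab) xz (A_right x) (A_right (A x)) (A_right (A (A x))).
  rewrite yA yAA yAAA -/y /= zE => /(_ _)/(le_trans _); apply; last first.
    by rewrite ltW.
  rewrite -[2]/(1 + 1) -addrA.
  rewrite yA yAA in j1 j2.
  have M : A (A y) - A y <= (1 + 2 ^+ 2 * E) * m x0.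
    have h1 : A (A y) < A (x0 + k%:~R) by rewrite ret_lt.
    have h2 : y1 + k%:~R <= A y.
      by rewrite -(ret_le F_inc a p) ret_shift// y1E.
    rewrite ret_shift// in h1.
    by move: s1; rewrite y1E; lra.
  have e0 : 0 < 1 + 2 ^+ 2 * E by rewrite addr_gt0// mulr_gt0// exprn_gt0.
  apply: cross_ratio_ge => //; apply: (le_trans M); rewrite ler_pM2l//.
have C0 := bounds_const_gt0; split.
  exact: cross_ratio_le_left step.
exact: cross_ratio_le_right step.
Qed.

End Scale.
End RealBounds.

Section Slopes.
Variable R : realType.
Implicit Types f : R -> R.

Lemma slope_right f (x df : R) : is_derive x 1 f df ->
  (f (x + e) - f x) / e @[e --> 0^'+] --> df.
Proof.
move=> fx; have /derivable1P/cvg_ex[/= l fl] := @ex_derive _ _ _ _ _ _ _ fx.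
apply: cvg_dnbhs_at_right; have -> : df = 'D_1 f x by rewrite derive_val.
have /= := (@ex_derive _ _ _ _ _ _ _ fx); rewrite /derivable => cf.
apply: cvg_trans cf; apply: near_eq_cvg; near=> e.
by rewrite /= /GRing.scale /= mulr1 mulrC [e + x]addrC.
Unshelve. all: end_near. Qed.

Lemma slope_left f (x df : R) : is_derive x 1 f df ->
  (f x - f (x - e)) / e @[e --> 0^'+] --> df.
Proof.
move=> fx; have gx : is_derive (- x) 1 (f \o -%R) (df * -1).
  by apply: is_derive1_comp; rewrite opprK.
have /cvgN := slope_right gx; rewrite mulrN1 opprK.
apply: cvg_trans; apply: near_eq_cvg; near=> e.
by rewrite !fctE /= opprK [X in f X](_ : _ = x - e); ring.
Unshelve. all: end_near. Qed.

End Slopes.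

(** * Upper bounds for derivatives of iterates *)

Section DerivativeBounds.
Variable R : realType.
Variables (F dF Xi : R -> R) (hX : R).
Hypothesis F1 : degree_one 1 F.
Hypothesis F_inc : {homo F : x y / x < y}.
Hypothesis F_der : forall x : R, is_derive x 1 F (dF x).
Hypothesis dF_cont : continuous dF.
Hypothesis Xi1 : degree_one hX Xi.
Hypothesis Xi_nd : {homo Xi : x y / x <= y}.
Hypothesis F_cr : forall p0 p q r s, p0 < p -> p < q -> q < r -> r < s ->
  cross_ratio (F p) (F q) (F r) (F s) <=
  expR (Xi s - Xi p0) * cross_ratio p q r s.

Lemma lift_cont : continuous F.
Proof.
by move=> x; apply/differentiable_continuous/derivable1_diffP; exact: ex_derive.
Qed.

Definition iter_der n (x : R) := \prod_(i < n) dF (iter i F x).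

Lemma iter_is_derive n (x : R) : is_derive x 1 (iter n F) (iter_der n x).
Proof.
elim: n => [|n IH]; first by rewrite /iter_der big_ord0; exact: is_derive_id.
rewrite /iter_der big_ord_recr /= mulrC; exact: is_derive1_comp.
Qed.

Lemma dF_ge0 x : 0 <= dF x.
Proof.
have := slope_right (F_der x) => /cvgr_to_ge; apply; near=> e.
have e0 : 0 < e by near: e; exact: nbhs_right_gt.
by rewrite divr_ge0 ?(ltW e0)// subr_ge0 ltW// F_inc// ltrDl.
Unshelve. all: end_near. Qed.

Lemma iter_der_ge0 n x : 0 <= iter_der n x.
Proof. by apply: prodr_ge0 => i _; exact: dF_ge0. Qed.

Lemma iter_der_cont n : continuous (iter_der n).
Proof.
elim: n => [|n IH] x.
  by rewrite /iter_der; under eq_fun do rewrite big_ord0; exact: cvg_cst.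
rewrite /iter_der; under eq_fun do rewrite big_ord_recr /=.
apply: cvgM; first exact: IH.
by apply: continuous_comp; [exact: iter_cont lift_cont _ _ | exact: dF_cont].
Qed.

Lemma iter_derD n k x : iter_der (n + k) x = iter_der n x * iter_der k (iter n F x).
Proof.
rewrite /iter_der big_split_ord /=; congr (_ * _); apply: eq_bigr => i _.
by rewrite addnC iterD.
Qed.

Lemma iter_mvt n x y : x < y -> exists2 z, x < z < y &
  iter n F y - iter n F x = iter_der n z * (y - x).
Proof.
move=> xy; have [|z] := MVT xy (fun z _ => iter_is_derive n z).
  exact/continuous_subspaceT/iter_cont/lift_cont.
by rewrite in_itv /= => zxy e; exists z.
Qed.

Section Scale.
Variables (a : nat) (p : int) (b : nat) (q : int).
Hypothesis gp : good_pair F a p b q.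
Notation A := (ret F a p).
Notation m x := (A x - x).

Let A_right : forall x, x < A x := gp_right gp.
Let K := bounds_const hX.
Let E := distortion hX.
Let K_gt0 : 0 < K. Proof. exact: bounds_const_gt0. Qed.
Let E_gt0 : 0 < E. Proof. exact: expR_gt0. Qed.

Lemma gap_next x : m (A x) <= K * m x.
Proof. by have [] := gap_bounds F1 F_inc lift_cont Xi1 Xi_nd F_cr gp x. Qed.

Lemma gap_prev x : m x <= K * m (A x).
Proof.
have [y <-] := ret_surj F1 lift_cont a p x.
by have [] := gap_bounds F1 F_inc lift_cont Xi1 Xi_nd F_cr gp y.
Qed.

Lemma gap_near x z : x <= z <= A x ->
  m z <= (1 + K) * m x /\ m x <= (1 + K) * m z.
Proof.
move=> /andP[xz zx].
have [y yz] := ret_surj F1 lift_cont a p z.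
have yx : y <= x by rewrite -(ret_le F_inc a p) yz.
have Az : A z <= A (A x) by rewrite ret_le.
have Ax : A x <= A z by rewrite ret_le.
have := gap_next x; have := gap_prev y; rewrite yz; lra.
Qed.

(* The infinitesimal case of the cross-ratio inequality. *)
Lemma iter_der_mul n x z : (n <= a + b)%N -> x < z -> z < A (A x) ->
  iter_der n x * iter_der n z * (z - x) ^+ 2 <=
  E * (iter n F z - iter n F x) ^+ 2.
Proof.
move=> nab xz zx; set f := iter n F.
have f_inc : {homo f : u v / u < v} := iter_inc F_inc n.
have [y0 y0E] := ret_surj F1 lift_cont a p x.
have [y1 y1E] := ret_surj F1 lift_cont a p y0.
have y0x : y0 < x by rewrite -y0E.
have y10 : y1 < y0 by rewrite -y1E.
have shiftl (g : R -> R) u : {for u, continuous g} -> g (u - e) @[e --> 0^'+] --> g u.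
  move=> gu; apply: cvg_at_right_filter; rewrite -{2}(subr0 u).
  apply: (@continuous_comp _ _ _ (fun e => u - e) g) => /=.
    by apply: cvgB; [exact: cvg_cst | exact: cvg_id].
  by rewrite subr0.
have shiftr (g : R -> R) u : {for u, continuous g} -> g (u + e) @[e --> 0^'+] --> g u.
  move=> gu; apply: cvg_at_right_filter; rewrite -{2}(addr0 u).
  apply: (@continuous_comp _ _ _ (fun e => u + e) g) => /=.
    by apply: cvgD; [exact: cvg_cst | exact: cvg_id].
  by rewrite addr0.
have fc : continuous f by exact/iter_cont/lift_cont.
have idc (u : R) : {for u, continuous (@id R)} by exact: cvg_id.
have L : ((f x - f (x - e)) / e) * ((f (z + e) - f z) / e) *
    ((z - (x - e)) * ((z + e) - x)) @[e --> 0^'+] -->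
    iter_der n x * iter_der n z * ((z - x) * (z - x)).
  apply: cvgM.
    apply: cvgM; first exact: slope_left (iter_is_derive n x).
    exact: slope_right (iter_is_derive n z).
  apply: cvgM.
    by apply: cvgB; [exact: cvg_cst | exact: (shiftl id)].
  by apply: cvgB; [exact: (shiftr id) | exact: cvg_cst].
have Rr : E * ((f z - f (x - e)) * (f (z + e) - f x)) @[e --> 0^'+] -->
    E * ((f z - f x) * (f z - f x)).
  apply: cvgMr; apply: cvgM.
    by apply: cvgB; [exact: cvg_cst | apply: shiftl; exact: fc].
  by apply: cvgB; [apply: shiftr; exact: fc | exact: cvg_cst].
rewrite !expr2; apply: ler_cvg_to L Rr _; near=> e.
have e0 : 0 < e by near: e; exact: nbhs_right_gt.
have e1 : e < x - y0 by near: e; apply: nbhs_right_lt; rewrite subr_gt0.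
have e2 : e < A (A x) - z by near: e; apply: nbhs_right_lt; rewrite subr_gt0.
have l0 : y1 < x - e by lra.
have l1 : x - e < x by lra.
have l3 : z < z + e by lra.
have l4 : z + e <= iter 5 A y1.
  rewrite /= y1E y0E; apply: (@le_trans _ _ (A (A x))); first by lra.
  exact/ltW/A_right.
have := scale_cross_ratio F1 F_inc Xi1 Xi_nd F_cr gp nab l0 l1 xz l3 l4.
rewrite -/E /cross_ratio -/f mulrA.
have f1 := f_inc _ _ l1; have f2 := f_inc _ _ xz; have f3 := f_inc _ _ l3.
have g1 : 0 < (f z - f (x - e)) * (f (z + e) - f x) by apply: mulr_gt0; lra.
have g2 : 0 < (z - (x - e)) * (z + e - x) by apply: mulr_gt0; lra.
rewrite ler_pdivrMr// mulrAC ler_pdivlMr// => H.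
rewrite -(ler_pM2r (mulr_gt0 e0 e0)).
apply: le_trans (_ : _ <= E * ((x - (x - e)) * (z + e - z)) *
  ((f z - f (x - e)) * (f (z + e) - f x))) _; last first.
  by rewrite le_eqVlt; apply/orP; left; apply/eqP; ring.
apply: le_trans H; rewrite le_eqVlt; apply/orP; left; apply/eqP; field.
by rewrite gt_eqF.
Unshelve. all: end_near. Qed.

(** [iter_der_mul] bounds only a product of two derivatives. The second point is taken as a
    mean-value point [z] of the next gap, where the derivative is the ratio of that gap's image to
    the gap itself; [gap_next] and [gap_prev] bound this ratio below in terms of the gaps at [x].
    Since [z] lies beyond [A x], also [z - x >= m x]. *)
Lemma iter_der_gap n x : (n <= a + b)%N ->
  iter_der n x * m x <= E * (1 + K) ^+ 2 * K ^+ 2 * m (iter n F x).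
Proof.
move=> nab; have [z /andP[xz zx] zE] := iter_mvt n (A_right (A x)).
have x1 := A_right x; have xz' := lt_trans x1 xz.
have := iter_der_mul nab xz' zx.
rewrite -!ret_iter// in zE; set y := iter n F x in zE *.
have fz : iter n F z <= A (A y).
  by rewrite /y !ret_iter// iter_leq// ltW.
have fxz : y < iter n F z by rewrite /y iter_ltn.
have K1 := gap_next y; have K2 := gap_prev y.
have K3 := gap_next x.
have my := A_right y; have may := A_right (A y); have max := A_right (A x).
move: (iter_der n x) (iter_der n z) (iter_der_ge0 n x) (iter_der_ge0 n z) zE
  => u v u0 v0 zE H.
rewrite -(ler_pM2r (_ : 0 < m y)); last by lra.
have h1 : m y * m x <= K ^+ 2 * (v * (m x * m x)).
  apply: le_trans (_ : _ <= K * (v * (K * m x)) * m x) _; last first.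
    by rewrite le_eqVlt; apply/orP; left; apply/eqP; ring.
  rewrite ler_wpM2r//; first by lra.
  apply: (le_trans K2); rewrite ler_wpM2l ?(ltW K_gt0)// zE.
  by rewrite ler_wpM2l.
apply: le_trans (_ : _ <= u * (K ^+ 2 * (v * (m x * m x)))) _.
  by rewrite -mulrA ler_wpM2l// mulrC.
apply: le_trans (_ : _ <= K ^+ 2 * (u * v * (z - x) ^+ 2)) _.
  rewrite [leLHS](_ : _ = K ^+ 2 * (u * v * (m x) ^+ 2)); last by ring.
  rewrite ler_wpM2l ?exprn_ge0 ?(ltW K_gt0)//.
  rewrite ler_wpM2l ?mulr_ge0//.
  by rewrite ler_pXn2r ?nnegrE//; lra.
apply: le_trans (_ : _ <= K ^+ 2 * (E * ((1 + K) * m y) ^+ 2)) _; last first.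
  by rewrite le_eqVlt; apply/orP; left; apply/eqP; ring.
rewrite ler_wpM2l ?exprn_ge0 ?(ltW K_gt0)//.
apply: (le_trans H); rewrite ler_wpM2l ?(ltW E_gt0)//.
have Kmy : 0 < K * m y by apply: mulr_gt0 => //; lra.
by rewrite ler_pXn2r ?nnegrE//; lra.
Qed.

Definition upper_const := E * (1 + K) ^+ 2 * K ^+ 2 * (1 + K) ^+ 2.

Lemma upper_const_gt0 : 0 < upper_const.
Proof.
have h : 0 < 1 + K by exact: addr_gt0.
by rewrite /upper_const 3?pmulr_lgt0 ?exprn_gt0.
Qed.

Lemma iter_der_le n x z : (n <= a + b)%N -> x <= z <= A x ->
  iter_der n z * m x <= upper_const * m (iter n F x).
Proof.
move=> nab xz; have [_ h1] := gap_near xz.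
have /gap_near[h2 _] : iter n F x <= iter n F z <= A (iter n F x).
  by rewrite ret_iter// !iter_leq.
have h3 := iter_der_gap z nab; have d0 := iter_der_ge0 n z.
apply: le_trans (_ : _ <= iter_der n z * ((1 + K) * m z)) _.
  by rewrite ler_wpM2l.
rewrite mulrCA.
apply: le_trans (_ : _ <= (1 + K) * (E * (1 + K) ^+ 2 * K ^+ 2 * m (iter n F z))) _.
  by rewrite ler_wpM2l// addr_ge0// ltW.
apply: le_trans (_ : _ <= (1 + K) * (E * (1 + K) ^+ 2 * K ^+ 2 * ((1 + K) * m (iter n F x)))) _; last first.
  by rewrite /upper_const le_eqVlt; apply/orP; left; apply/eqP; ring.
have k0 : 0 <= 1 + K by rewrite addr_ge0// ltW.
have c0 : 0 <= E * (1 + K) ^+ 2 * K ^+ 2.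
  by apply: mulr_ge0; [apply: mulr_ge0; [exact: ltW|exact: exprn_ge0]|exact/exprn_ge0/ltW].
by rewrite (ler_wpM2l k0)// (ler_wpM2l c0).
Qed.

Lemma return_der_le x : iter_der a x <= upper_const * K.
Proof.
have := iter_der_le (leq_addr b a) (_ : x <= x <= A x).
rewrite lexx ltW// => /(_ isT) h.
have e : m (iter a F x) = m (A x).
  by rewrite /ret -mulrNz iter_shift//; ring.
rewrite e in h; have := gap_next x; have := A_right x => x1 g.
rewrite -(ler_pM2r (_ : 0 < m x)) ?subr_gt0//.
by rewrite -mulrA (le_trans h)// ler_wpM2l// ltW// upper_const_gt0.
Qed.

(** Only one point per gap has to satisfy the lower bound: this is what later makes the total weight
    of the atoms diverge. *)
Lemma return_der_ge x : exists2 z, x < z < A x & K^-1 <= iter_der a z.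
Proof.
have [z xz e] := iter_mvt a (A_right x); exists z => //.
have e' : iter a F (A x) - iter a F x = m (A x) by rewrite /ret; ring.
rewrite e' in e; have := gap_prev x; rewrite e => h.
rewrite -(ler_pM2r (_ : 0 < m x)) ?subr_gt0//.
by rewrite mulrC ler_pdivrMr// mulrC.
Qed.

End Scale.
End DerivativeBounds.

(** * Conformal distribution functions and their uniqueness *)

Section Density.
Variable R : realType.
Implicit Types (H G D W w : R -> R).

(** A Cousin-type argument by suprema: the inequality on all short intervals around each point
    propagates to the whole segment. *)
Lemma straddle_le W (u v : R) : u <= v ->
  (forall z, u <= z <= v -> exists2 d : R, 0 < d &
    forall p q, u <= p <= z -> z <= q <= v -> z - d < p -> q < z + d ->
      W p <= W q) ->
  W u <= W v.
Proof.
move=> uv loc; pose S := [set x | u <= x <= v /\ W u <= W x].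
have Su : S u by split => //; rewrite lexx.
have ubS : ubound S v by move=> x [/andP[]].
have hS : has_sup S by split; [exists u | exists v].
have s1 : u <= sup S by exact: (ub_le_sup hS.2).
have s2 : sup S <= v by exact: (ge_sup hS.1 ubS).
have [|d d0 dW] := loc (sup S); first by rewrite s1 s2.
have [x Sx xs] := sup_adherent d0 hS.
have xle : x <= sup S by exact: (ub_le_sup hS.2).
have Ws : W u <= W (sup S).
  case: (Sx) => /andP[ux xv] /le_trans; apply; apply: dW => //.
  - by rewrite ux.
  - by rewrite lexx.
  - by rewrite ltrDl.
have [<-//|sv] := eqVneq (sup S) v; have {}sv : sup S < v by rewrite lt_neqAle sv.
pose y := Num.min v (sup S + d / 2).
have sy : sup S < y by rewrite lt_min sv ltrDl divr_gt0.
have yv : y <= v by rewrite ge_min lexx.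
have : S y.
  split; first by rewrite yv (le_trans s1 (ltW sy)).
  apply: (le_trans Ws); apply: dW; rewrite ?lexx ?s1 ?yv ?(ltW sy)//.
    by rewrite ltrBlDr ltrDl.
  by rewrite gt_min; apply/orP; right; lra.
by move=> /(ub_le_sup hS.2); rewrite leNgt sy.
Qed.

(* [dH = w dG] as measures, the error being controlled by a measure [dD]; this
   formulation, unlike two-sided bounds by values of [w], is linear in
   [(H, G)]. *)
Definition has_density w H G := exists2 D : R -> R, {homo D : x y / x <= y} &
  forall (z e : R), 0 < e -> exists2 d : R, 0 < d &
    forall p q, p <= z <= q -> z - d < p -> q < z + d ->
      `|H q - H p - w z * (G q - G p)| <= e * (D q - D p).

Lemma has_density_le w H G (u v M : R) : has_density w H G ->
  {homo G : x y / x <= y} -> u <= v -> (forall z, u <= z <= v -> w z <= M) ->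
  H v - H u <= M * (G v - G u).
Proof.
move=> [D D_nd dens] G_nd uv wM; apply/ler_addgt0Pl => e e0.
have D0 : 0 <= D v - D u by rewrite subr_ge0 D_nd.
pose e' := e / (D v - D u + 1).
have e'0 : 0 < e' by rewrite divr_gt0// ltr_wpDl.
have e'e : e' * (D v - D u) <= e.
  by rewrite /e' -mulrA ler_piMr ?(ltW e0)// mulrC ler_pdivrMr ?ltr_wpDl// mul1r lerDl.
suff : M * G u + e' * D u - H u <= M * G v + e' * D v - H v by lra.
apply: (straddle_le (W := fun x => M * G x + e' * D x - H x)) uv _ => z zuv.
have [d d0 dz] := dens z e' e'0; exists d => // p q /andP[up pz] /andP[zq qv] dp dq.
have := dz p q; rewrite pz zq => /(_ isT dp dq); rewrite ler_norml => /andP[_ h].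
have : w z * (G q - G p) <= M * (G q - G p).
  by rewrite ler_wpM2r ?wM// subr_ge0 G_nd// (le_trans pz).
lra.
Qed.

Lemma has_densityB w H1 H2 G1 G2 (k : R) : 0 <= k ->
  has_density w H1 G1 -> has_density w H2 G2 ->
  has_density w (fun x => H1 x - k * H2 x) (fun x => G1 x - k * G2 x).
Proof.
move=> k0 [D1 D1_nd d1] [D2 D2_nd d2]; exists (fun x => D1 x + k * D2 x).
  by move=> x y xy; rewrite lerD ?D1_nd// ler_wpM2l ?D2_nd.
move=> z e e0; have [r1 r10 h1] := d1 z e e0; have [r2 r20 h2] := d2 z e e0.
exists (Num.min r1 r2); first by rewrite lt_min r10.
move=> p q pzq zp qz.
have := h1 p q pzq; have := h2 p q pzq.
have m1 : Num.min r1 r2 <= r1 by rewrite ge_min lexx.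
have m2 : Num.min r1 r2 <= r2 by rewrite ge_min lexx orbT.
move=> /(_ ltac:(lra) ltac:(lra)) i2 /(_ ltac:(lra) ltac:(lra)) i1.
rewrite (_ : _ - _ = (H1 q - H1 p - w z * (G1 q - G1 p)) -
  k * (H2 q - H2 p - w z * (G2 q - G2 p))); last by ring.
apply: (le_trans (ler_normB _ _)); rewrite normrM (ger0_norm k0).
have := ler_wpM2l k0 i2; lra.
Qed.

End Density.

Section Conformal.
Variable R : realType.
Variables (F dF : R -> R) (t : R).
Hypothesis F1 : degree_one 1 F.
Hypothesis F_inc : {homo F : x y / x < y}.
Hypothesis F_der : forall x : R, is_derive x 1 F (dF x).
Hypothesis t0 : 0 <= t.

Definition right_cont (H : R -> R) :=
  forall x e : R, 0 < e -> exists2 d : R, 0 < d & H (x + d) < H x + e.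

(* Distribution functions of the [s]-measures (of mass [h]) of the circle map
   lifted by [F], with [t = - s]. *)
Record conformal (h : R) (H : R -> R) : Prop := Conformal {
  cf_nd : {homo H : x y / x <= y};
  cf_per : degree_one h H;
  cf_rc : right_cont H;
  cf_dens : has_density (fun x => dF x `^ t) H (H \o F) }.

Lemma conformalB h1 h2 H1 H2 k : 0 <= k -> conformal h1 H1 -> conformal h2 H2 ->
  {homo (fun x => H1 x - k * H2 x) : x y / x <= y} ->
  conformal (h1 - k * h2) (fun x => H1 x - k * H2 x).
Proof.
move=> k0 c1 c2 nd; split => //.
- by move=> x; rewrite (cf_per c1) (cf_per c2); ring.
- move=> x e e0; have [d d0 h] := cf_rc c1 x e0; exists d => //.
  have : k * H2 x <= k * H2 (x + d) by rewrite ler_wpM2l// (cf_nd c2)// lerDl ltW.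
  lra.
- exact: has_densityB (cf_dens c1) (cf_dens c2).
Qed.

Section Iterate.
Variables (h : R) (H : R -> R).
Hypothesis cf : conformal h H.

(** A chain rule for densities. The error of the last factor is governed by [D] transported by
    [iter n F] and gets multiplied by [wn], whence the tolerance [e / (wn + 1)]. *)
Lemma conformal_iter n :
  has_density (fun x => iter_der F dF n x `^ t) H (H \o iter n F).
Proof.
elim: n => [|n [Dn Dn_nd IH]].
  exists (fun _ => 0) => // z e e0; exists 1 => // p q _ _ _.
  by rewrite /iter_der big_ord0 powR1 mul1r/= subrr normr0 subrr mulr0.
have [D D_nd dens] := cf_dens cf.
have Fn_nd := ltW_homo (iter_inc F_inc n).
exists (fun x => Dn x + D (iter n F x)).
  by move=> x y xy; rewrite lerD ?Dn_nd// D_nd// Fn_nd.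
move=> z e e0; set wn := iter_der F dF n z `^ t.
have wn0 : 0 <= wn by exact: powR_ge0.
have e20 : 0 < e / (wn + 1) by rewrite divr_gt0// ltr_wpDl.
have [d1 d10 h1] := IH z e e0; have [d2 d20 h2] := dens (iter n F z) _ e20.
have := @iter_cont _ _ (lift_cont F_der) n z.
move=> /cvgrPdist_lt/(_ _ d20)/nbhs_ballP[d3 /= d30 h3].
exists (Num.min d1 d3); first by rewrite lt_min d10.
have m1 : Num.min d1 d3 <= d1 by rewrite ge_min lexx.
have m3 : Num.min d1 d3 <= d3 by rewrite ge_min lexx orbT.
move=> p q /andP[pz zq] zp qz.
have := h1 p q; rewrite pz zq => /(_ isT ltac:(lra) ltac:(lra)) i1.
have near_z x : `|z - x| < d3 -> `|iter n F z - iter n F x| < d2 by exact: h3.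
have ip : `|iter n F z - iter n F p| < d2.
  by apply: near_z; rewrite ger0_norm; lra.
have iq : `|iter n F z - iter n F q| < d2.
  by apply: near_z; rewrite ler0_norm; lra.
move: ip iq; rewrite !ltr_norml => /andP[ip1 ip2] /andP[iq1 iq2].
have := h2 (iter n F p) (iter n F q).
rewrite !Fn_nd// => /(_ isT ltac:(lra) ltac:(lra)) i2.
rewrite /iter_der big_ord_recr /= powRM ?iter_der_ge0//; last first.
  exact: dF_ge0 F_inc F_der _.
rewrite -/(iter_der F dF n z) -/wn.
set w1 := dF _ `^ t in i2 *.
rewrite (_ : _ - _ = (H q - H p - wn * (H (iter n F q) - H (iter n F p))) +
  wn * (H (iter n F q) - H (iter n F p) -
   w1 * (H (F (iter n F q)) - H (F (iter n F p))))); last by ring.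
apply: (le_trans (ler_normD _ _)); rewrite normrM (ger0_norm wn0).
have i3 := ler_wpM2l wn0 i2.
have D0 : 0 <= D (iter n F q) - D (iter n F p).
  by rewrite subr_ge0 D_nd// Fn_nd// (le_trans pz).
have i4 : wn * (e / (wn + 1)) * (D (iter n F q) - D (iter n F p)) <=
    e * (D (iter n F q) - D (iter n F p)).
  rewrite ler_wpM2r// mulrCA ler_piMr ?(ltW e0)//.
  by rewrite ler_pdivrMr ?ltr_wpDl// mul1r lerDl.
move: i1 i3; rewrite /=; lra.
Qed.

Lemma conformal_iter_le n u v M : u <= v ->
  (forall z, u <= z <= v -> iter_der F dF n z <= M) ->
  H v - H u <= M `^ t * (H (iter n F v) - H (iter n F u)).
Proof.
move=> uv zM; apply: has_density_le (conformal_iter n) _ uv _.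
  by move=> x y xy /=; apply/(cf_nd cf)/(ltW_homo (iter_inc F_inc n)).
move=> z zuv; apply: ge0_ler_powR => //; rewrite ?nnegrE ?zM//.
  exact: iter_der_ge0.
by apply: le_trans (zM z zuv); exact: iter_der_ge0.
Qed.

End Iterate.
End Conformal.

(** * Comparison and uniqueness of conformal distribution functions *)

Section Uniqueness.
Variable R : realType.
Variables (F dF Xi : R -> R) (hX t : R).
Hypothesis F1 : degree_one 1 F.
Hypothesis F_inc : {homo F : x y / x < y}.
Hypothesis F_der : forall x : R, is_derive x 1 F (dF x).
Hypothesis Xi1 : degree_one hX Xi.
Hypothesis Xi_nd : {homo Xi : x y / x <= y}.
Hypothesis F_cr : forall p0 p q r s, p0 < p -> p < q -> q < r -> r < s ->
  cross_ratio (F p) (F q) (F r) (F s) <=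
  expR (Xi s - Xi p0) * cross_ratio p q r s.
Hypothesis t0 : 0 <= t.

Let K := bounds_const hX.
Let K_gt0 : 0 < K. Proof. exact: bounds_const_gt0. Qed.
Let C := upper_const hX.
Let C_gt0 : 0 < C. Proof. exact: upper_const_gt0. Qed.

Section Scale.
Variables (a : nat) (p : int) (b : nat) (q : int).
Hypothesis gp : good_pair F a p b q.
Notation A := (ret F a p).
Notation m x := (A x - x).
Notation T := (a + b)%N.

Let A_right : forall x, x < A x := gp_right gp.
Let m_gt0 x : 0 < m x. Proof. by rewrite subr_gt0. Qed.

Notation e x := (m x `^ t).

Let e_gt0 x : 0 < e x. Proof. exact: powR_gt0. Qed.

(* Up to constants, the integral of [m^(-t-1)] over the circle; hence it hardly
   depends on [x], nor on whether the orbit is followed forwards or backwards. *)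
Definition orbit_sum x := \sum_(j < T) (e (iter j F x))^-1.

(** The number of integer translates of [z] in the gap from [u] (excluded) to [A u] (included). *)
Let cnt u z : R := (Num.floor (A u - z) - Num.floor (u - z))%:~R.

Let cnt_ge0 u z : 0 <= cnt u z.
Proof. by rewrite ler0z subr_ge0 le_floor// lerD2r ltW. Qed.

Let floor_degree_one z : degree_one 1 (fun u => (Num.floor (u - z))%:~R : R).
Proof. by move=> u; rewrite addrAC floorDrz ?int_num1// intrD floor1. Qed.

Let cnt_fwd y z : 1 <= \sum_(i < T) cnt (iter i F y) z.
Proof.
have H_nd : {homo (fun u => (Num.floor (u - z))%:~R : R) : u v / u <= v}.
  by move=> u v uv; rewrite ler_int le_floor// lerD2r.
apply: le_trans (return_tower_ge1 F1 F_inc gp (floor_degree_one z) H_nd y) _.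
by apply: ler_sum => i _; rewrite /cnt intrB ret_iter.
Qed.

(** Duality: [z] lies in the gap starting at [u] when [u] lies in the gap ending at [z]. So the
    visits of the orbit of [x] are counted by the tower of gaps over [x'], the preimage of [x] under
    [A], whose multiplicity is at most two. *)
Let cnt_bwd u x : \sum_(j < T) cnt u (iter j F x) <= 2.
Proof.
pose H z : R := - (Num.floor (u - z))%:~R.
have H_nd : {homo H : v w / v <= w}.
  by move=> v w vw; rewrite lerN2 ler_int le_floor// lerD2l lerN2.
have H1 : degree_one 1 H.
  move=> z; rewrite /H opprD addrA -[X in Num.floor (_ + X)]/(-1).
  by rewrite floorDrz ?rpredN ?int_num1// floorN ?int_num1// floor1 intrD; ring.
have [x' <-] := ret_surj F1 (lift_cont F_der) a p x.
have := return_tower_le2 F1 F_inc gp H1 H_nd x' (leqnn T).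
rewrite -[1 *+ 2]/2; apply: le_trans; apply: ler_sum => j _.
rewrite /cnt intrB /H -!ret_iter//.
suff -> : Num.floor (A u - A (iter j F x')) = Num.floor (u - iter j F x') by lra.
set z := iter j F x'.
have E n : (n <= Num.floor (A u - A z)) = (n <= Num.floor (u - z)).
  rewrite !floor_ge_int [_ <= A u - _]lerBrDr [_ <= u - _]lerBrDr ![n%:~R + _]addrC -ret_shift//.
  by rewrite ret_le.
by apply/eqP; rewrite eq_le -E lexx E lexx.
Qed.

(** Double counting of the pairs [(i, j)] for which the gap at [iter i F y] contains a translate of
    [iter j F x]. Each [j] occurs at least once, each [i] at most twice, and in such a pair the gaps
    at the two points are comparable with factor [1 + K]. *)
Lemma orbit_sum_le x y : orbit_sum x <= 2 * (1 + K) `^ t * orbit_sum y.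
Proof.
have K1 : 0 < (1 + K) `^ t by rewrite powR_gt0// addr_gt0.
apply: le_trans (_ : _ <= \sum_(j < T) \sum_(i < T)
  cnt (iter i F y) (iter j F x) * ((1 + K) `^ t * (e (iter i F y))^-1)) _.
  apply: ler_sum => j _; set z := iter j F x.
  apply: le_trans (_ : _ <= \sum_(i < T) cnt (iter i F y) z * (e z)^-1) _.
    by rewrite -mulr_suml ler_peMl ?invr_ge0 ?powR_ge0// cnt_fwd.
  apply: ler_sum => i _; set u := iter i F y.
  have [->|c0] := eqVneq (cnt u z) 0; first by rewrite !mul0r.
  rewrite ler_wpM2l// ler_pdivlMr// mulrC ler_pdivrMr//.
  have K0 : 0 <= 1 + K by rewrite addr_ge0// ltW.
  rewrite -(powRM _ K0 (ltW (m_gt0 z))).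
  have uz : Num.floor (u - z) < Num.floor (A u - z).
    rewrite lt_neqAle le_floor ?lerD2r ?(ltW (A_right _))// andbT.
    by apply: contra c0 => /eqP cE; rewrite /cnt cE subrr.
  set k := Num.floor (A u - z) in uz *.
  have /(gap_near F1 F_inc F_der Xi1 Xi_nd F_cr gp)[_ h2] : u <= z + k%:~R <= A u.
    have := floor_le (A u - z); rewrite -/k floor_lt_int in uz *.
    by lra.
  rewrite gap_shift// in h2.
  by apply: ge0_ler_powR => //; rewrite nnegrE ?mulr_ge0// ltW.
rewrite exchange_big /= /orbit_sum mulr_sumr; apply: ler_sum => i _.
rewrite -mulr_suml -mulrA ler_wpM2r ?cnt_bwd//.
by rewrite mulr_ge0 ?(ltW K1)// invr_ge0 powR_ge0.
Qed.

Section OneMeasure.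
Variables (h : R) (H : R -> R).
Hypothesis cf : conformal F dF t h H.

Let dH x := H (A x) - H x.
(** The upper derivative bound on the gap at [x], raised to the power [t] and inserted into the
    transformation rule for [iter n F]. *)
Let dH_iter n x : (n <= T)%N ->
  dH x * e x / e (iter n F x) <= C `^ t * dH (iter n F x).
Proof.
move=> nT; set y := iter n F x.
have := conformal_iter_le F_inc F_der t0 cf (n := n) (ltW (A_right x))
  (M := C * m y / m x).
move=> /(_ _)/(le_trans _) => Hle.
have : H (A x) - H x <= (C * m y / m x) `^ t * (H (iter n F (A x)) - H (iter n F x)).
  apply: Hle => // z xz; rewrite ler_pdivlMr//.
  exact: (iter_der_le F1 F_inc F_der Xi1 Xi_nd F_cr gp nT xz).
rewrite -ret_iter// -/y -/(dH x) -/(dH y).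
have y0 := ltW (m_gt0 y); have x0 := ltW (m_gt0 x); have C0 := ltW C_gt0.
rewrite (powRM _ (mulr_ge0 C0 y0)) ?invr_ge0// (powRM _ C0 y0).
rewrite -powR_inv1// -powRrM mulN1r powRN => h1.
rewrite ler_pdivrMr// -ler_pdivlMr//; apply: (le_trans h1).
by rewrite le_eqVlt; apply/orP; left; apply/eqP; ring.
Qed.

Lemma return_mass_le x : dH x * e x * orbit_sum x <= 2 * C `^ t * h.
Proof.
rewrite /orbit_sum mulr_sumr.
apply: le_trans (_ : _ <= \sum_(j < T) C `^ t * dH (iter j F x)) _.
  by apply: ler_sum => j _; apply: dH_iter; exact: ltnW.
rewrite -mulr_sumr -mulrA mulrCA ler_wpM2l ?powR_ge0//.
have := return_tower_le2 F1 F_inc gp (cf_per cf) (cf_nd cf) x (leqnn T).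
rewrite mulr_natl; apply: le_trans.
by apply: ler_sum => i _; rewrite /dH ret_iter.
Qed.

(** The estimate [dH_iter] is now used along the [T] points that end at [x]: each of their gaps has
    mass bounded by that of the gap at [x], while together they have mass at least [h]. *)
Lemma return_mass_ge x : exists y, h <= C `^ t * e x * dH x * orbit_sum y.
Proof.
have [y yE] := iter_surj F1 (lift_cont F_der) T.-1 x; exists y.
apply: (le_trans (return_tower_ge1 F1 F_inc gp (cf_per cf) (cf_nd cf) y)).
rewrite /orbit_sum mulr_sumr; apply: ler_sum => i _; rewrite -ret_iter//.
have iT : (T.-1 - i <= T)%N by lia.
have := dH_iter (iter i F y) iT.
rewrite -iterD subnK; last by have := ltn_ord i; lia.
rewrite yE ler_pdivrMr// => h1.
rewrite ler_pdivlMr// -/(dH _); apply: (le_trans h1).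
by rewrite le_eqVlt; apply/orP; left; apply/eqP; ring.
Qed.

End OneMeasure.

(** One factor 2 comes from [orbit_sum_le], the other from the multiplicity in [return_mass_le];
    each of the two mass bounds contributes a [t]-th power of [C]. *)
Definition compare_const := 4 * (1 + K) `^ t * (C `^ t) ^+ 2.

Lemma compare_const_gt0 : 0 < compare_const.
Proof.
by rewrite !mulr_gt0 ?exprn_gt0 ?powR_gt0// addr_gt0.
Qed.

Lemma compare_return h1 H1 h2 H2 x :
  conformal F dF t h1 H1 -> conformal F dF t h2 H2 ->
  h2 * (H1 (A x) - H1 x) <= compare_const * h1 * (H2 (A x) - H2 x).
Proof.
move=> c1 c2; have := return_mass_le c1 x; have [y] := return_mass_ge c2 x.
have d1 : 0 <= H1 (A x) - H1 x by rewrite subr_ge0 (cf_nd c1)// ltW.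
have d2 : 0 <= H2 (A x) - H2 x by rewrite subr_ge0 (cf_nd c2)// ltW.
move: (H1 (A x) - H1 x) (H2 (A x) - H2 x) d1 d2 => d1 d2 d10 d20 lo up.
have Ct : 0 < C `^ t by exact: powR_gt0.
apply: le_trans (_ : _ <= (C `^ t * e x * d2 * orbit_sum y) * d1) _.
  by rewrite ler_wpM2r.
apply: le_trans (_ : _ <= (C `^ t * e x * d2 *
    (2 * (1 + K) `^ t * orbit_sum x)) * d1) _.
  rewrite ler_wpM2r// ler_wpM2l ?orbit_sum_le//.
  by rewrite !mulr_ge0 ?(ltW Ct) ?(ltW (e_gt0 _)).
apply: le_trans (_ : _ <= (C `^ t * d2 * 2 * (1 + K) `^ t) * (2 * C `^ t * h1)) _.
  apply: le_trans (_ : _ <= (C `^ t * d2 * 2 * (1 + K) `^ t) * (d1 * e x * orbit_sum x)) _.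
    by rewrite le_eqVlt; apply/orP; left; apply/eqP; ring.
  by rewrite ler_wpM2l// !mulr_ge0 ?(ltW Ct) ?powR_ge0.
by rewrite /compare_const le_eqVlt; apply/orP; left; apply/eqP; ring.
Qed.

End Scale.

Hypothesis scales : forall (d : R) (n : nat), 0 < d -> exists a p b q,
  [/\ good_pair F a p b q, (n < a)%N & forall x, ret F a p x - x < d].

(** The interval is filled with gaps of one small scale from its right end. The remainder has length
    at most [d] and begins at [u], where right continuity makes its mass negligible; a remainder
    ending at [v] could carry an atom. *)
Lemma compare_mass h1 H1 h2 H2 u v : u <= v ->
  conformal F dF t h1 H1 -> conformal F dF t h2 H2 ->
  h2 * (H1 v - H1 u) <= compare_const * h1 * (H2 v - H2 u).
Proof.
move=> uv c1 c2.
have mass_ge0 h H : conformal F dF t h H -> 0 <= h.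
  move=> c; have := cf_per c 0; have : H 0 <= H (0 + 1) by rewrite (cf_nd c)// add0r.
  lra.
have h10 := mass_ge0 _ _ c1; have h20 := mass_ge0 _ _ c2.
have [->|h2n0] := eqVneq h2 0.
  rewrite mul0r; apply: mulr_ge0; last by rewrite subr_ge0 (cf_nd c2).
  by apply: mulr_ge0 => //; exact: ltW compare_const_gt0.
have {h20 h2n0} h20 : 0 < h2 by rewrite lt_neqAle eq_sym h2n0.
apply/ler_addgt0Pl => e e0.
have [d d0 dH] := cf_rc c1 u (divr_gt0 e0 h20).
have [a [p [b [q [gp _ md]]]]] := scales 0%N d0.
have F_cont := lift_cont F_der.
(* The smallest gap is positive, so finitely many gaps exhaust the interval. *)
have [x0 x0m] : exists x0, forall x, ret F a p x0 - x0 <= ret F a p x - x.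
  apply: periodic_min => [y|y].
    by apply: cvgB; [exact: ret_cont|exact: cvg_id].
  by rewrite addr0 (gap_shift F1 a p 1).
have m0 : 0 < ret F a p x0 - x0 by rewrite subr_gt0 (gp_right gp).
suff [u' uu' ineq] : exists2 u', u <= u' <= u + d /\ u' <= v &
    h2 * (H1 v - H1 u') <= compare_const * h1 * (H2 v - H2 u').
  case: uu' => /andP[uu' u'd] u'v.
  have : H1 u' <= H1 (u + d) by rewrite (cf_nd c1).
  have : compare_const * h1 * (H2 v - H2 u') <= compare_const * h1 * (H2 v - H2 u).
    rewrite ler_wpM2l ?(mulr_ge0 (ltW compare_const_gt0))//.
    by rewrite lerD2l lerN2 (cf_nd c2).
  move=> i1 i2; have : h2 * (H1 u' - H1 u) <= e.
    by rewrite mulrC -ler_pdivlMr//; lra.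
  lra.
have [N] : exists N : nat, v - u <= N%:R * (ret F a p x0 - x0).
  exists (Num.truncn ((v - u) / (ret F a p x0 - x0))).+1.
  by rewrite -ler_pdivrMr// ltW// truncnS_gt.
elim: N v uv => [|N IH] v uv vN.
  exists v; last by rewrite !subrr !mulr0.
  by rewrite uv lexx; split => //; rewrite mul0r in vN; lra.
have [vd|vd] := leP v (u + d).
  by exists v; [rewrite uv vd lexx|rewrite !subrr !mulr0].
have [w wv] := ret_surj F1 F_cont a p v.
have wd := md w; have wm := x0m w; rewrite wv in wd wm.
have [||u' [uu' u'w] ineq] := IH w.
- lra.
- by move: vN; rewrite -natr1 mulrDl mul1r; lra.
exists u'; first by split => //; lra.
have := compare_return gp w c1 c2; rewrite wv; lra.
Qed.

Lemma conformal_unique H1 H2 : conformal F dF t 1 H1 -> conformal F dF t 1 H2 ->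
  forall u v, u <= v -> H1 v - H1 u = H2 v - H2 u.
Proof.
suff le : forall H1 H2, conformal F dF t 1 H1 -> conformal F dF t 1 H2 ->
    forall u v, u <= v -> H2 v - H2 u <= H1 v - H1 u.
  by move=> c1 c2 u v uv; apply/eqP; rewrite eq_le !le.
move=> {}H1 {}H2 c1 c2.
pose S := [set k : R | 0 <= k <= 1 /\
  forall u v, u <= v -> k * (H2 v - H2 u) <= H1 v - H1 u].
have S0 : S 0.
  by split=> [|u v uv]; rewrite ?lexx ?ler01// mul0r subr_ge0 (cf_nd c1).
have ubS : ubound S 1 by move=> k [/andP[]].
have hS : has_sup S by split; [exists 0 | exists 1].
have Ssup : S (sup S).
  split; first by rewrite (ub_le_sup hS.2 S0) (ge_sup hS.1 ubS).
  move=> u v uv; have d2 : 0 <= H2 v - H2 u by rewrite subr_ge0 (cf_nd c2).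
  have [d20|d2n0] := eqVneq (H2 v - H2 u) 0.
    by rewrite d20 mulr0 subr_ge0 (cf_nd c1).
  have {}d2 : 0 < H2 v - H2 u by rewrite lt_neqAle eq_sym d2n0.
  rewrite -ler_pdivlMr//; apply: ge_sup hS.1 _ => k [_ kS].
  by rewrite ler_pdivlMr// kS.
set k := sup S in Ssup *; have [/andP[k0 k1] kS] := Ssup.
have [k_lt1|] := ltP k 1; last first.
  move=> k_ge1 u v uv; have := kS u v uv.
  by have -> : k = 1 by [apply/eqP; rewrite eq_le k1]; rewrite mul1r.
exfalso.
have nd : {homo (fun x => H1 x - k * H2 x) : x y / x <= y}.
  by move=> x y xy; have := kS x y xy; lra.
have := conformalB k0 c1 c2 nd; rewrite mulr1 => c.
(* The difference has mass [1 - k > 0], hence dominates [(1 - k) / M] times [H2], contrary to the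
   choice of [k]. The maximum with 1 keeps the enlarged multiple at most 1. *)
pose M := Num.max compare_const 1.
have M1 : 1 <= M by rewrite le_max lexx orbT.
have Mc : compare_const <= M by rewrite le_max lexx.
have kM : (1 - k) / M <= 1 - k by rewrite ler_pdivrMr ?ler_peMr//; lra.
have kM0 : 0 < (1 - k) / M by rewrite divr_gt0//; lra.
suff /(ub_le_sup hS.2) : S (k + (1 - k) / M) by rewrite -/k; lra.
split=> [|u v uv]; first by apply/andP; split; lra.
have := compare_mass uv c2 c; rewrite mulr1 => cm.
have d : 0 <= (H1 v - k * H2 v) - (H1 u - k * H2 u) by rewrite subr_ge0 nd.
suff : (1 - k) / M * (H2 v - H2 u) <= (H1 v - k * H2 v) - (H1 u - k * H2 u) by lra.
rewrite mulrAC ler_pdivrMr; last by lra.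
apply: (le_trans cm); rewrite mulrC.
by rewrite ler_wpM2l.
Qed.

End Uniqueness.

(** * Small scales for an irrational rotation number *)

Section Rotation.
Variable R : realType.
Variables (F : R -> R) (rho : R).
Hypothesis F1 : degree_one 1 F.
Hypothesis F_inc : {homo F : x y / x < y}.
Hypothesis F_rho : iter n F 0 / n%:R @[n --> \oo] --> rho.

Let sub_cvg (q : nat) : (0 < q)%N ->
  iter (n.+1 * q) F 0 / n.+1%:R @[n --> \oo] --> q%:R * rho.
Proof.
move=> q0; have q_neq0 : q%:R != 0 :> R by rewrite pnatr_eq0 -lt0n.
have -> : (fun n : nat => iter (n.+1 * q) F 0 / n.+1%:R) =
    (fun n : nat => q%:R * (iter (n.+1 * q) F 0 / (n.+1 * q)%:R)).
  by apply/funext => n; rewrite natrM [RHS]mulrC invfM -!mulrA mulVf// mulr1.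
apply: cvgMr.
apply: (@cvg_comp _ _ _ (fun n : nat => (n.+1 * q)%N) (fun n => iter n F 0 / n%:R) _ \oo) F_rho.
move=> A [N _ NA]; exists N => // n /= Nn; apply: NA => /=.
by apply: (leq_trans Nn); rewrite (leq_trans (leqnSn n))// leq_pmulr.
Qed.

Let harmonic_cvg (c p : R) : c / n.+1%:R + p @[n --> \oo] --> p.
Proof.
rewrite -[X in _ --> X]add0r; apply: cvgD; last exact: cvg_cst.
by rewrite -[X in _ --> X](mulr0 c); apply: cvgMr; exact: cvg_harmonic.
Qed.

Lemma rotation_le (q : nat) (p : int) x : iter q F x <= x + p%:~R ->
  q%:R * rho <= p%:~R.
Proof.
case: q => [|q]; first by rewrite mul0r -[leLHS]addr0 lerD2l.
move=> h; have hn n : iter (n * q.+1) F x <= x + n%:R * p%:~R.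
  elim: n => [|n IH]; first by rewrite mul0r addr0.
  rewrite mulSn iterD; apply: le_trans (_ : _ <= iter q.+1 F (x + n%:R * p%:~R)) _.
    by rewrite iter_leq.
  have -> : x + n%:R * p%:~R = x + (n%:Z * p)%:~R by rewrite intrM.
  by rewrite iter_shift// intrM -natr1; move: h => /=; lra.
(* An integer translate of [x] that is nonnegative, so that its orbit dominates that of 0, along
   which [rho] is computed. *)
set c := x - (Num.floor x)%:~R.
have c0 : 0 <= c by rewrite subr_ge0 floor_le.
have L := sub_cvg (ltn0Sn q); have L' := @harmonic_cvg c p%:~R.
apply: ler_cvg_to L L' _; near=> n.
rewrite ler_pdivrMr ?ltr0n// mulrDl divfK ?pnatr_eq0//.
apply: le_trans (_ : _ <= iter (n.+1 * q.+1) F c) _; first by rewrite iter_leq.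
have := hn n.+1; rewrite /c -mulrNz iter_shift// mulrNz; lra.
Unshelve. all: end_near. Qed.

Lemma rotation_ge (q : nat) (p : int) x : x + p%:~R <= iter q F x ->
  p%:~R <= q%:R * rho.
Proof.
case: q => [|q]; first by rewrite mul0r -[leRHS]addr0 lerD2l.
move=> h; have hn n : x + n%:R * p%:~R <= iter (n * q.+1) F x.
  elim: n => [|n IH]; first by rewrite mul0r addr0.
  rewrite mulSn iterD; apply: le_trans (_ : iter q.+1 F (x + n%:R * p%:~R) <= _).
    have -> : x + n%:R * p%:~R = x + (n%:Z * p)%:~R by rewrite intrM.
    by rewrite iter_shift// intrM -natr1; move: h => /=; lra.
  by rewrite iter_leq.
set c := x - (Num.floor x + 1)%:~R.
have c0 : c <= 0 by rewrite subr_le0 ltW// floorD1_gt.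
have L := sub_cvg (ltn0Sn q); have L' := @harmonic_cvg c p%:~R.
apply: ler_cvg_to L' L _; near=> n.
rewrite ler_pdivlMr ?ltr0n// mulrDl divfK ?pnatr_eq0//.
apply: le_trans (_ : _ <= iter (n.+1 * q.+1) F c) _; last by rewrite iter_leq.
have := hn n.+1; rewrite /c -mulrNz iter_shift// mulrNz; lra.
Unshelve. all: end_near. Qed.

Lemma lt_iter (q : nat) (p : int) x : p%:~R < q%:R * rho ->
  x + p%:~R < iter q F x.
Proof. by rewrite !ltNge; apply: contra => /rotation_le. Qed.

Lemma iter_lt (q : nat) (p : int) x : q%:R * rho < p%:~R ->
  iter q F x < x + p%:~R.
Proof. by rewrite !ltNge; apply: contra => /rotation_ge. Qed.

Hypothesis rho_irr : forall (q : nat) (p : int), (0 < q)%N ->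
  q%:R * rho != p%:~R.

(** Rational neighbours [p / a < rho < q / b]; [a rho - p] and [q - b rho] are the displacements of
    the two returns for the rigid rotation by [rho]. *)
Record convergents (a : nat) (p : int) (b : nat) (q : int) : Prop := Convergents {
  cv_det : a%:Z * q - b%:Z * p = 1;
  cv_pos : (0 < a)%N;
  cv_le : (a <= b)%N;
  cv_left : 0 < q%:~R - b%:R * rho;
  cv_lt : q%:~R - b%:R * rho < a%:R * rho - p%:~R }.

Lemma convergents_good a p b q : convergents a p b q -> good_pair F a p b q.
Proof.
move=> [det a0 ab b_gt0 ba]; split => // x; rewrite /ret.
- by rewrite ltrBrDr; apply: lt_iter; lra.
- by rewrite ltrBlDr; apply: iter_lt; lra.
- by rewrite ltrBrDr; apply: lt_iter; rewrite natrD intrD; lra.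
Qed.

Let euclid (u v : R) : 0 < v -> v < u ->
  exists2 k : nat, (0 < k)%N & 0 <= u - k%:R * v < v.
Proof.
move=> v0 vu; have uv : 0 <= u / v by rewrite divr_ge0; lra.
exists (Num.truncn (u / v)).
  by rewrite truncn_gt0 ler_pdivlMr// mul1r ltW.
have /andP[h1 h2] := truncn_itv uv.
rewrite subr_ge0 -ler_pdivlMr// h1/= ltrBlDl.
by move: h2; rewrite ltr_pdivrMr// -natr1 mulrDl mul1r.
Qed.

Lemma convergents_first : exists a p b q, convergents a p b q /\
  forall x, ret F a p x - x < 1.
Proof.
pose p := Num.floor rho; have rp := floor_itv rho; rewrite -/p intrD in rp.
have rp0 : rho != p%:~R by have := @rho_irr 1%N p isT; rewrite mul1r.
have r0 : 0 < rho - p%:~R by rewrite subr_gt0 lt_neqAle eq_sym rp0; case/andP: rp.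
have [|l l0 /andP[le lt]] := @euclid 1 (rho - p%:~R) r0; first by case/andP: rp => _; lra.
exists 1%N, p, l, (1 + l%:Z * p); split; last first.
  move=> x; rewrite /ret; have : iter 1 F x < x + (p + 1)%:~R.
    by apply: iter_lt; rewrite mul1r intrD; case/andP: rp.
  by rewrite intrD; lra.
have irr := @rho_irr l (1 + l%:Z * p) l0.
have E : (1 + l%:Z * p)%:~R - l%:R * rho = 1 - l%:R * (rho - p%:~R).
  by rewrite intrD intrM; ring.
split => //; first by lia.
- by rewrite lt_neqAle E le andbT eq_sym -E subr_eq0 eq_sym.
- by rewrite E mul1r.
Qed.

(** Two steps of Euclid's algorithm on the displacements, so that the first return again moves to
    the right; irrationality keeps both remainders nonzero. If the displacement [A] is replaced by
    [A' = A - k B < B] with [k >= 1], then [2 A' < A' + k B = A], so two new gaps fit into an old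
    one. *)
Lemma convergents_next a p b q : convergents a p b q ->
  exists a' p' b' q', [/\ convergents a' p' b' q', (a < a')%N &
    forall x, ret F a' p' (ret F a' p' x) < ret F a p x].
Proof.
move=> [det a0 ab bp lt].
have [k k0 /andP[k1 k2]] := euclid bp lt.
pose a' := (a + k * b)%N; pose p' := p + k%:Z * q.
have E : a'%:R * rho - p'%:~R = a%:R * rho - p%:~R - k%:R * (q%:~R - b%:R * rho).
  by rewrite natrD intrD intrM natrM; ring.
have a'0 : (0 < a')%N by rewrite addn_gt0 a0.
have A'0 : 0 < a'%:R * rho - p'%:~R.
  by rewrite lt_neqAle eq_sym subr_eq0 rho_irr//= E.
have A'b : a'%:R * rho - p'%:~R < q%:~R - b%:R * rho by rewrite E.
have [l l0 /andP[l1 l2]] := euclid A'0 A'b.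
pose b' := (b + l * a')%N; pose q' := q + l%:Z * p'.
have E' : q'%:~R - b'%:R * rho = q%:~R - b%:R * rho - l%:R * (a'%:R * rho - p'%:~R).
  by rewrite natrD intrD intrM natrM; ring.
have b0 : (0 < b)%N by exact: leq_trans ab.
exists a', p', b', q'; split.
- split => //.
  + by rewrite -det /b' /q' /a' /p' !PoszD !PoszM; ring.
  + by rewrite /b' (leq_trans (leq_pmull a' l0))// leq_addl.
  + by rewrite lt_neqAle eq_sym subr_eq0 eq_sym rho_irr ?E'//= addn_gt0 b0.
  + by rewrite E'.
- by rewrite -[X in (X < _)%N]addn0 ltn_add2l muln_gt0 k0.
- move=> x; rewrite ret_ret// /ret.
  have aa : (a <= a' + a')%N by rewrite /a'; lia.
  rewrite -(subnKC aa) addnC iterD.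
  have k_ge1 : 1 <= k%:R :> R by rewrite ler1n.
  have kb : q%:~R - b%:R * rho <= k%:R * (q%:~R - b%:R * rho).
    by rewrite ler_peMl// ltW.
  have : iter (a' + a' - a) F (iter a F x) < iter a F x + (p' + p' - p)%:~R.
    by apply: iter_lt; rewrite natrB// natrD (intrD _ (p' + p')) (intrD _ p') mulrNz; lra.
  by rewrite (intrD _ (p' + p')) (intrD _ p') mulrNz; lra.
Qed.

End Rotation.

Section Scales.
Variable R : realType.
Variables (F dF Xi : R -> R) (hX rho : R).
Hypothesis F1 : degree_one 1 F.
Hypothesis F_inc : {homo F : x y / x < y}.
Hypothesis F_der : forall x : R, is_derive x 1 F (dF x).
Hypothesis Xi1 : degree_one hX Xi.
Hypothesis Xi_nd : {homo Xi : x y / x <= y}.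
Hypothesis F_cr : forall p0 p q r s, p0 < p -> p < q -> q < r -> r < s ->
  cross_ratio (F p) (F q) (F r) (F s) <=
  expR (Xi s - Xi p0) * cross_ratio p q r s.
Hypothesis F_rho : iter n F 0 / n%:R @[n --> \oo] --> rho.
Hypothesis rho_irr : forall (q : nat) (p : int), (0 < q)%N ->
  q%:R * rho != p%:~R.

(** Two adjacent new gaps fit into an old one and are comparable with factor [K], so every step
    multiplies gap lengths by at most [K / (1 + K)]. That gaps shrink to zero, which excludes
    wandering intervals, thus comes from the real bounds. *)
Lemma small_scales (d : R) (n : nat) : 0 < d -> exists a p b q,
  [/\ good_pair F a p b q, (n < a)%N & forall x, ret F a p x - x < d].
Proof.
move=> d0; set K := bounds_const hX.
have K0 : 0 < K by exact: bounds_const_gt0.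
pose l := K / (1 + K).
have l0 : 0 <= l by rewrite divr_ge0; lra.
have l1 : `|l| < 1 by rewrite ger0_norm// ltr_pdivrMr; lra.
have geo N : exists a p b q, [/\ convergents rho a p b q, (N < a)%N &
    forall x, ret F a p x - x < l ^+ N].
  elim: N => [|N [a [p [b [q [cv Na mN]]]]]].
    have [a [p [b [q [cv h]]]]] := convergents_first F1 F_inc F_rho rho_irr.
    by exists a, p, b, q; split => //; exact: cv_pos cv.
  have [a' [p' [b' [q' [cv' aa' h]]]]] := convergents_next F1 F_inc F_rho rho_irr cv.
  exists a', p', b', q'; split => //; first exact: leq_trans aa'.
  move=> x; have gp' := convergents_good F1 F_inc F_rho cv'.
  have := gap_prev F1 F_inc F_der Xi1 Xi_nd F_cr gp' x; rewrite -/K => g.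
  have := mN x; have := h x => h1 h2.
  rewrite exprS /l mulrAC ltr_pdivlMr; last by lra.
  have : K * (ret F a p x - x) < K * l ^+ N by rewrite ltr_pM2l.
  have : K * (ret F a' p' (ret F a' p' x)) < K * ret F a p x by rewrite ltr_pM2l.
  lra.
have := cvg_expr l1 => /cvgrPdist_lt/(_ _ d0)[N _ hN].
have [a [p [b [q [cv Na mN]]]]] := geo (maxn N n).
exists a, p, b, q; split.
- exact: convergents_good cv.
- by apply: leq_ltn_trans Na; exact: leq_maxr.
- move=> x; apply: lt_trans (mN x) _.
  have := hN (maxn N n) (leq_maxl _ _); rewrite sub0r normrN.
  by apply: le_lt_trans; exact: ler_norm.
Qed.

End Scales.

(** * Existence of a conformal distribution function *)

Section Existence.
Variable R : realType.
Variables (F dF Xi : R -> R) (hX t : R).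
Hypothesis F1 : degree_one 1 F.
Hypothesis F_inc : {homo F : x y / x < y}.
Hypothesis F_der : forall x : R, is_derive x 1 F (dF x).
Hypothesis dF_cont : continuous dF.
Hypothesis Xi1 : degree_one hX Xi.
Hypothesis Xi_nd : {homo Xi : x y / x <= y}.
Hypothesis F_cr : forall p0 p q r s, p0 < p -> p < q -> q < r -> r < s ->
  cross_ratio (F p) (F q) (F r) (F s) <=
  expR (Xi s - Xi p0) * cross_ratio p q r s.
Hypothesis scales : forall (d : R) (n : nat), 0 < d -> exists a p b q,
  [/\ good_pair F a p b q, (n < a)%N & forall x, ret F a p x - x < d].
Hypothesis t_gt0 : 0 < t.

Variable G : R -> R.
Hypothesis GK : cancel G F.

Let K := bounds_const hX.
Let K_gt0 : 0 < K. Proof. exact: bounds_const_gt0. Qed.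

Lemma derivative_periodic : degree_one 0 dF.
Proof.
move=> x; rewrite addr0.
have d1 : is_derive x 1 (F \o (fun y => y + 1)) (dF (x + 1) * 1).
  apply: (@is_derive1_comp R F (fun y => y + 1)).
  by rewrite -[X in is_derive _ _ _ X]addr0; apply: is_deriveD.
have d2 : is_derive x 1 (F \o (fun y => y + 1)) (dF x + 0).
  have -> : F \o (fun y => y + 1) = F + cst 1 by apply/funext => y; exact: F1.
  exact: is_deriveD.
by rewrite -[LHS]mulr1 -(@derive_val _ _ _ _ _ _ _ d1) (@derive_val _ _ _ _ _ _ _ d2) addr0.
Qed.

Lemma derivative_shift (k : int) x : dF (x + k%:~R) = dF x.
Proof. by rewrite (degree_oneD derivative_periodic) mulr0 addr0. Qed.

Lemma iter_der_shift n (k : int) x : iter_der F dF n (x + k%:~R) = iter_der F dF n x.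
Proof. by apply: eq_bigr => i _; rewrite iter_shift// derivative_shift. Qed.

Lemma iterGK n : cancel (iter n G) (iter n F).
Proof. by elim: n => [|n IH] x //; rewrite iterSr/= GK IH. Qed.

(* The mass at [F^-n x] of the measure with unit mass at [x] which, along the
   backward orbit, transforms as a conformal measure does. *)
Definition weight x n := iter_der F dF n (iter n G x) `^ t.

Let weight_ge0 x n : 0 <= weight x n. Proof. exact: powR_ge0. Qed.

Let weight0 x : weight x 0 = 1.
Proof. by rewrite /weight /iter_der big_ord0 powR1. Qed.

Let weightS x n : weight x n.+1 = dF (iter n.+1 G x) `^ t * weight x n.
Proof.
rewrite /weight -add1n iter_derD.
rewrite powRM ?(iter_der_ge0 F_inc F_der)// /iter_der big_ord_recl big_ord0 mulr1.
by rewrite /= GK.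
Qed.

Let c0 := (K^-1 / 2) `^ t.
Let c0_gt0 : 0 < c0. Proof. by rewrite powR_gt0// divr_gt0 ?invr_gt0. Qed.

(** Every new scale adds at least [c0]: a gap inside the current interval is the image under [A] of
    one containing a point [z] with [(F^a)' z >= K^-1], and continuity keeps half of that bound near
    [z]. Nested intervals retain the earlier terms, and [n0 < a] makes the new term a different
    one. *)
Let many_returns (N : nat) : exists (n0 : nat) (u v : R), u < v /\
  forall x, u <= x <= v -> N%:R * c0 <= \sum_(n < n0) weight x n.
Proof.
elim: N => [|N [n0 [u [v [uv IH]]]]].
  by exists 0%N, 0, 1; split => // x _; rewrite mul0r big_ord0.
have d0 : 0 < (v - u) / 2 by rewrite divr_gt0// subr_gt0.
have [a [p [b [q [gp n0a md]]]]] := scales n0 d0.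
have F_cont := lift_cont F_der.
have [x xE] := ret_surj F1 F_cont a p ((u + v) / 2).
have [z /andP[xz zx] zK] := return_der_ge F1 F_inc F_der Xi1 Xi_nd F_cr gp x.
have [d d_gt0 hd] : exists2 d : R, 0 < d & forall y, z - d <= y <= z + d ->
    K^-1 / 2 <= iter_der F dF a y.
  have [r /= r0 hr] : \forall y \near z, K^-1 / 2 < iter_der F dF a y.
    apply: (cvgr_gt _ (@iter_der_cont _ _ _ F_der dF_cont a z)).
    by apply: lt_le_trans zK; rewrite ltr_pdivrMr// ltr_pMr ?invr_gt0// ltr1n.
  exists (r / 2); first by rewrite divr_gt0.
  by move=> y zy; apply/ltW/hr; rewrite /= ltr_norml; lra.
set A := ret F a p in xE xz zx md *.
have A_inc y y' : y < y' -> A y < A y' by rewrite /A ret_lt.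
have Az1 := A_inc _ _ xz; have Az2 := A_inc _ _ zx.
have Azd1 : A (z - d) < A z by apply: A_inc; lra.
have Azd2 : A z < A (z + d) by apply: A_inc; lra.
have := md (A x); rewrite xE in Az1 Az2 * => mAx.
exists a.+1, (Num.max u (A (z - d))), (Num.min v (A (z + d))); split.
  apply: (@lt_trans _ _ (A z)); first by rewrite gt_max; lra.
  by rewrite lt_min; lra.
move=> y; rewrite ge_max le_min => /andP[/andP[uy zy] /andP[yv yz]].
rewrite big_ord_recr /= -natr1 mulrDl mul1r lerD//.
  apply: le_trans (IH y _) _; first by rewrite uy.
  rewrite -(subnK (ltnW n0a)) addnC big_split_ord /= lerDl.
  by apply: sumr_ge0.
rewrite /weight /c0; apply: ge0_ler_powR => //; rewrite ?nnegrE ?(ltW t_gt0)//.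
- by rewrite divr_ge0// invr_ge0 ltW.
- exact: iter_der_ge0 F_inc F_der _ _.
- rewrite -(iter_der_shift a p); apply: hd.
  move: zy yz; rewrite -{1 2}(iterGK a y).
  have -> : iter a F (iter a G y) = A (iter a G y + p%:~R).
    by rewrite /A ret_shift// /ret subrK.
  by rewrite /A !ret_le// => -> ->.
Qed.

(** A truncated sum of atoms violates the transformation rule only at its two ends, where the
    weights are 1 and [weight x a]. Cutting at a return time [a] bounds the latter by
    [return_der_le], while the total is as large as desired. *)
Let good_weights (e : R) : 0 < e -> exists (x : R) (a : nat),
  (weight x a + 1) <= e * \sum_(n < a) weight x n /\ 0 < \sum_(n < a) weight x n.
Proof.
move=> e0; pose Ck := (upper_const hX * K) `^ t.
have [N hN] : exists N : nat, Ck + 1 < e * (N.+1%:R * c0).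
  exists (Num.truncn ((Ck + 1) / (e * c0))).
  rewrite mulrCA -ltr_pdivrMr ?mulr_gt0//.
  by apply: truncnS_gt.
have [n0 [u [v [uv hw]]]] := many_returns N.+1.
have [a [p [b [q [gp n0a _]]]]] := scales n0 (@ltr01 R).
exists u, a; have := hw u; rewrite lexx (ltW uv) => /(_ isT) h.
have le_a : N.+1%:R * c0 <= \sum_(n < a) weight u n.
  apply: (le_trans h); rewrite -(subnK (ltnW n0a)) addnC big_split_ord /= lerDl.
  by apply: sumr_ge0.
split; last by apply: lt_le_trans le_a; rewrite mulr_gt0.
have : weight u a <= Ck.
  rewrite /weight /Ck; apply: ge0_ler_powR => //; rewrite ?nnegrE ?(ltW t_gt0)//.
  - exact: iter_der_ge0 F_inc F_der _ _.
  - by apply: mulr_ge0; rewrite ltW// upper_const_gt0.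
  - exact: (return_der_le F1 F_inc F_der Xi1 Xi_nd F_cr gp).
have : e * (N.+1%:R * c0) <= e * \sum_(n < a) weight u n by rewrite ler_pM2l.
lra.
Qed.

(* Up to [e], the distribution function of a conformal probability measure. *)
Definition almost_conformal (e : R) (H : R -> R) :=
  [/\ H 0 = 0, {homo H : x y / x <= y}, degree_one 1 H &
   forall u v W : R, u <= v ->
   ((forall z, u <= z <= v -> dF z `^ t <= W) ->
     H v - H u <= W * (H (F v) - H (F u)) + e * (v - u + 1)) /\
   ((forall z, u <= z <= v -> W <= dF z `^ t) ->
     W * (H (F v) - H (F u)) <= H v - H u + e * (v - u + 1))].

Lemma almost_conformal_exists (e : R) : 0 < e -> exists H, almost_conformal e H.
Proof.
move=> e0; have [x [a [We S0]]] := good_weights e0.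
set S := \sum_(n < a) weight x n in We S0.
pose fl (y : R) : R := (Num.floor y)%:~R.
have fl_nd : {homo fl : y z / y <= z} by move=> y z yz; rewrite ler_int le_floor.
have fl1 y : fl (y + 1) = fl y + 1 by rewrite /fl floorDrz ?int_num1// intrD floor1.
pose y n := iter n G x.
(* Atoms proportional to [weight x n] at the translates of [y n], normalised to total mass one per
   period and to [H 0 = 0]. *)
pose H z := (\sum_(n < a) weight x n * (fl (z - y n) - fl (- y n))) / S.
have HE u v : H v - H u =
    (\sum_(n < a) weight x n * (fl (v - y n) - fl (u - y n))) / S.
  rewrite /H -mulrBl -sumrB; congr (_ / _); apply: eq_bigr => n _; ring.
have flF u n : fl (F u - y n) = fl (u - y n.+1).
  have yF : F (y n.+1) = y n by rewrite /y /= GK.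
  rewrite /fl; congr (_%:~R).
  have E k : (k <= Num.floor (F u - y n)) = (k <= Num.floor (u - y n.+1)).
    rewrite !floor_ge_int !lerBrDr ![k%:~R + _]addrC -yF.
    have -> : F (y n.+1) + k%:~R = F (y n.+1 + k%:~R).
      exact/esym/(iter_shift F1 1).
    exact: (iter_leq F_inc 1).
  by apply/eqP; rewrite eq_le -E lexx E lexx.
have c_le u v n : u <= v -> fl (v - y n) - fl (u - y n) <= v - u + 1.
  move=> uv; rewrite /fl; have := floor_le (v - y n).
  by have := floorD1_gt (u - y n); rewrite intrD; lra.
have c_ge0 u v n : u <= v -> 0 <= fl (v - y n) - fl (u - y n).
  by move=> uv; rewrite subr_ge0 fl_nd// lerD2r.
exists H; split.
- by rewrite /H big1 ?mul0r// => n _; rewrite sub0r subrr mulr0.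
- by move=> u v uv; rewrite -subr_ge0 HE divr_ge0 ?(ltW S0)// sumr_ge0// => n _;
    rewrite mulr_ge0// c_ge0.
- move=> z; suff : H (z + 1) - H z = 1 by lra.
  rewrite HE.
  under eq_bigr => n _ do rewrite addrAC fl1 addrAC subrr add0r mulr1.
  by rewrite -/S divff// gt_eqF.
move=> u v W uv; pose c n := fl (v - y n) - fl (u - y n).
have E1 : H v - H u = (\sum_(n < a) weight x n * c n) / S by exact: HE.
have E2 : H (F v) - H (F u) = (\sum_(n < a) weight x n * c n.+1) / S.
  by rewrite HE; congr (_ / _); apply: eq_bigr => n _; rewrite !flF.
(* [F] carries atom [n + 1] to atom [n], so composing with [F] shifts the index; the reindexing
   leaves just the two end terms. *)
have tele : \sum_(n < a) weight x n.+1 * c n.+1 =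
    \sum_(n < a) weight x n * c n - weight x 0 * c 0%N + weight x a * c a.
  elim: (a) => [|m IH]; first by rewrite !big_ord0; ring.
  by rewrite big_ord_recr /= IH [in RHS]big_ord_recr /=; ring.
have hit n : c n != 0 -> exists k : int, u <= y n + k%:~R <= v.
  move=> cn; have lt : Num.floor (u - y n) < Num.floor (v - y n).
    rewrite lt_neqAle le_floor ?lerD2r// andbT; apply: contra cn => /eqP cE.
    by rewrite /c /fl cE subrr.
  exists (Num.floor (v - y n)); have := floor_le (v - y n).
  by move: lt; rewrite floor_lt_int; lra.
have We0 := weight_ge0 x a.
have err m : 0 <= m <= weight x a + 1 -> forall d, 0 <= d <= v - u + 1 ->
    m * d <= e * (v - u + 1) * S.
  move=> /andP[m0 m1] d /andP[d0 d1].
  apply: le_trans (_ : _ <= (e * S) * (v - u + 1)) _; last by rewrite mulrAC.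
  by apply: ler_pM => //; apply: le_trans We.
have c0b : 0 <= c 0%N <= v - u + 1 by rewrite c_ge0// c_le.
have cab : 0 <= c a <= v - u + 1 by rewrite c_ge0// c_le.
rewrite E1 E2; split => hW.
  rewrite mulrA -[e * _](mulfK (lt0r_neq0 S0)) -mulrDl.
  rewrite ler_pM2r ?invr_gt0//.
  have h1 : \sum_(n < a) weight x n.+1 * c n.+1 <=
      W * \sum_(n < a) weight x n * c n.+1.
    rewrite mulr_sumr; apply: ler_sum => n _; rewrite weightS mulrA.
    have [->|/hit[k uk]] := eqVneq (c n.+1) 0; first by rewrite !mulr0.
    rewrite ler_wpM2r ?c_ge0// ler_wpM2r//.
    by rewrite -(derivative_shift k); exact: hW.
  have := err 1 _ _ c0b; rewrite lerDr We0 ler01 => /(_ isT).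
  have : 0 <= weight x a * c a by rewrite mulr_ge0//; case/andP: cab.
  rewrite tele weight0 in h1; lra.
rewrite mulrA -[e * _](mulfK (lt0r_neq0 S0)) -mulrDl.
rewrite ler_pM2r ?invr_gt0//.
have h1 : W * \sum_(n < a) weight x n * c n.+1 <=
    \sum_(n < a) weight x n.+1 * c n.+1.
  rewrite mulr_sumr; apply: ler_sum => n _; rewrite weightS mulrA.
  have [->|/hit[k uk]] := eqVneq (c n.+1) 0; first by rewrite !mulr0.
  rewrite ler_wpM2r ?c_ge0// ler_wpM2r//.
  by rewrite -(derivative_shift k); exact: hW.
have := err (weight x a) _ _ cab; rewrite We0 lerDl ler01 => /(_ isT).
have : 0 <= c 0%N by case/andP: c0b.
rewrite tele weight0 in h1; lra.
Qed.

End Existence.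

(** * Passage to the limit *)

Section Limit.
Variable R : realType.
Variables (F dF : R -> R) (t : R).
Hypothesis F1 : degree_one 1 F.
Hypothesis F_inc : {homo F : x y / x < y}.
Hypothesis F_cont : continuous F.
Hypothesis w_cont : continuous (fun x => dF x `^ t).
Hypothesis approx : forall e : R, 0 < e -> exists H, almost_conformal F dF t e H.

Lemma ultra_bounded_cvg (U : set_system nat) (u : nat -> R) (a b : R) :
  UltraFilter U -> (forall n, a <= u n <= b) -> exists l : R, u @ U --> l.
Proof.
move=> UU uab.
have : U (u @^-1` `[a, b]%classic).
  by apply: filterS filterT => n _ /=; rewrite in_itv /=; exact: uab.
rewrite -[U _]/((u @ U) _) => /(segment_compact (a := a) (b := b))[l [_ cl]]; exists l => A nA.
have [//|UnA] := @in_ultra_setVsetC _ U (u @^-1` A) _.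
by have [x [nAx Ax]] := cl _ _ (UnA : (u @ U) (~` A)) nA; case: nAx.
Qed.

(** An ultrafilter gives a pointwise limit at all points at once, without a diagonal extraction; the
    limit is then made right continuous. The inequalities of [almost_conformal] concern increments
    between arbitrary points and pass through both operations. *)
Lemma conformal_exists : exists H, conformal F dF t 1 H.
Proof.
have n0 n : 0 < n.+1%:R^-1 :> R by rewrite invr_gt0.
pose Hs n := projT1 (cid (approx (n0 n))).
have HsP n : almost_conformal F dF t n.+1%:R^-1 (Hs n).
  exact: projT2 (cid (approx (n0 n))).
have [U [UU sU]] := ultraFilterLemma (_ : ProperFilter (nbhs (\oo : set_system nat))).
have bnd n y : (Num.floor y)%:~R <= Hs n y <= (Num.floor y + 1)%:~R.
  have [h0 hnd h1 _] := HsP n.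
  have hk (k : int) : Hs n k%:~R = k%:~R.
    by rewrite -[LHS]/(Hs n _) -[X in Hs n X]add0r (degree_oneD h1) h0 add0r mulr1.
  apply/andP; split; first by rewrite -hk hnd// floor_le.
  by rewrite -hk hnd// ltW// floorD1_gt.
have limP y : exists l : R, Hs n y @[n --> U] --> l.
  exact: ultra_bounded_cvg UU (fun n => bnd n y).
pose L y := projT1 (cid (limP y)).
have LP y : Hs n y @[n --> U] --> L y by exact: projT2 (cid (limP y)).
have L_nd : {homo L : x y / x <= y}.
  move=> x y xy; apply: ler_cvg_to (LP x) (LP y) _; near=> n.
  by have [_ nd _ _] := HsP n; exact: nd.
have L1 : degree_one 1 L.
  move=> x; apply: (cvg_unique _ (LP (x + 1))) => //.
  have -> : (fun n => Hs n (x + 1)) = (fun n => Hs n x + 1).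
    by apply/funext => n; have [_ _ h1 _] := HsP n; exact: h1.
  by apply: cvgD; [exact: LP | exact: cvg_cst].
have err (d : R) : n.+1%:R^-1 * d @[n --> U] --> (0 : R).
  rewrite -[X in _ --> X](mul0r d); apply: cvgMl; apply: cvg_trans cvg_harmonic.
  by move=> A; exact: sU.
have LB u v : Hs n v - Hs n u @[n --> U] --> L v - L u.
  exact: cvgB (LP v) (LP u).
have LF u v W : W * (Hs n (F v) - Hs n (F u)) @[n --> U] --> W * (L (F v) - L (F u)).
  by apply: cvgMr; exact: LB.
have L_up u v W : u <= v -> (forall z, u <= z <= v -> dF z `^ t <= W) ->
    L v - L u <= W * (L (F v) - L (F u)).
  move=> uv hW; rewrite -[leRHS]addr0.
  apply: ler_cvg_to (LB u v) (cvgD (LF u v W) (err (v - u + 1))) _; near=> n.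
   have [_ _ _ h] := HsP n.
  by have [hu _] := h u v W uv; exact: hu.
have L_lo u v W : u <= v -> (forall z, u <= z <= v -> W <= dF z `^ t) ->
    W * (L (F v) - L (F u)) <= L v - L u.
  move=> uv hW; rewrite -[leRHS]addr0.
  apply: ler_cvg_to (LF u v W) (cvgD (LB u v) (err (v - u + 1))) _; near=> n.
   have [_ _ _ h] := HsP n.
  by have [_ hu] := h u v W uv; exact: hu.
pose H x := inf [set L y | y in [set` `]x, +oo[]].
have lbS x : lbound [set L y | y in [set` `]x, +oo[]] (L x).
  by move=> _ [y /= + <-]; rewrite in_itv /= andbT => xy; rewrite L_nd// ltW.
have hlb x : has_lbound [set L y | y in [set` `]x, +oo[]] by exists (L x).
have ne x : [set L y | y in [set` `]x, +oo[]] !=set0.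
  by exists (L (x + 1)), (x + 1) => //=; rewrite in_itv /= andbT ltrDl.
have H_le x y : x < y -> H x <= L y.
  by move=> xy; apply: ge_inf => //; exists y => //=; rewrite in_itv /= andbT.
have H_ge x : L x <= H x by apply: lb_le_inf.
have H_nd : {homo H : x y / x <= y}.
  move=> x y; rewrite le_eqVlt => /predU1P[->//|xy].
  exact: le_trans (H_le _ _ xy) (H_ge y).
(* Needed for [phi] the identity and for [phi = F]: being increasing and continuous, [F] preserves
   limits from the right. *)
have Hcvg (phi : R -> R) x : {homo phi : y z / y < z} -> continuous phi ->
    L (phi (x + e)) @[e --> 0^'+] --> H (phi x).
  move=> phi_inc phi_c.
  apply: (@increasing_cvg_at_right_comp _ (fun e => phi (x + e)) L 0 (BInfty _ false)).
  - by [].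
  - by move=> y z _ _ yz; apply: phi_inc; rewrite ltrD2l.
  - apply: cvg_at_right_filter.
    apply: (@continuous_comp _ _ _ (fun e => x + e) phi); last exact: phi_c.
    by apply: cvgD; [exact: cvg_cst | exact: cvg_id].
  - rewrite addr0; apply: (nondecreasing_at_right_cvgr (b := BInfty _ false)) => //.
    by move=> y z _ _; exact: L_nd.
exists H; split => //.
- move=> x; have hc : L (x + e + 1) @[e --> 0^'+] --> H (x + 1).
    apply: (Hcvg (fun y => y + 1)).
      by move=> y z yz; rewrite ltrD2r.
    by move=> y; apply: cvgD; [exact: cvg_id | exact: cvg_cst].
  apply: (cvg_unique _ hc) => //.
  have -> : (fun e => L (x + e + 1)) = (fun e => L (x + e) + 1).
    by apply/funext => e; exact: L1.
  apply: cvgD; last exact: cvg_cst.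
  by apply: (Hcvg id) => // y; exact: cvg_id.
- move=> x e e0; have [_ [y /= xy <-] Ly] := inf_adherent e0 (conj (ne x) (hlb x)).
  rewrite in_itv /= andbT in xy; exists ((y - x) / 2).
    by rewrite divr_gt0// subr_gt0.
  by apply: le_lt_trans Ly; apply: H_le; lra.
have F_nd := ltW_homo F_inc.
exists (H \o F); first by move=> x y xy /=; apply/H_nd/F_nd.
move=> z e e0; have /cvgrPdist_le/(_ _ e0)[/= d d0 hd] := @w_cont z.
exists d => // p q /andP[pz zq] zp qz.
pose w := dF z `^ t.
have wz x : z - d < x < z + d -> w - e <= dF x `^ t <= w + e.
  move=> xz; have : `|z - x| < d by rewrite ltr_norml; lra.
  by move=> /hd /=; rewrite -/w ler_norml; lra.
have idc : continuous (@id R) by move=> y; exact: cvg_id.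
(* The inequalities hold for [L] on the interval translated by a small [r > 0], which still lies in
   the neighbourhood of [z] where the density is within [e] of its value at [z]; letting [r] tend to
   0 gives them for [H]. *)
have cL u v W : L (v + r) - L (u + r) - W * (L (F (v + r)) - L (F (u + r)))
    @[r --> 0^'+] --> H v - H u - W * (H (F v) - H (F u)).
  by apply: cvgB; [|apply: cvgMr]; apply: cvgB;
    solve [exact: (Hcvg id) | exact: (Hcvg F)].
have near_q : \forall r \near 0^'+, q + r < z + d.
  near=> r; rewrite -ltrBrDl; near: r; apply: nbhs_right_lt.
  by rewrite subr_gt0.
rewrite ler_norml -/w /=; apply/andP; split.
  suff : 0 <= H q - H p - (w - e) * (H (F q) - H (F p)) by lra.
  apply: (cvgr_to_ge (cL p q (w - e))); near=> r.
  have r0 : 0 < r by near: r; exact: nbhs_right_gt.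
  have rq : q + r < z + d by near: r.
  rewrite subr_ge0; apply: L_lo; first by rewrite lerD2r (le_trans pz).
  by move=> x px; have /andP[] := wz x ltac:(lra).
suff : H q - H p - (w + e) * (H (F q) - H (F p)) <= 0 by lra.
apply: (cvgr_to_le (cL p q (w + e))); near=> r.
have r0 : 0 < r by near: r; exact: nbhs_right_gt.
have rq : q + r < z + d by near: r.
rewrite subr_le0; apply: L_up; first by rewrite lerD2r (le_trans pz).
by move=> x px; have /andP[] := wz x ltac:(lra).
Unshelve. all: end_near. Qed.

End Limit.

(** * Cross-ratio distortion at regular and critical points *)

Section PowerMap.
Variable R : realType.
Implicit Types x y d : R.

(** [E] and [Ch] are twice the hyperbolic sine and cosine. In logarithmic coordinates a power map is
    multiplication by [d], and a cross-ratio is a quotient of products of values of [E]. *)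
Let E x : R := expR x - expR (- x).
Let Ch x : R := expR x + expR (- x).

Let E_gt0 x : 0 < x -> 0 < E x.
Proof. by move=> x0; rewrite subr_gt0 ltr_expR; lra. Qed.

Let E_ge0 x : 0 <= x -> 0 <= E x.
Proof. by move=> x0; rewrite subr_ge0 ler_expR; lra. Qed.

Let is_derive_expM d x : is_derive x 1 (fun y => expR (d * y)) (d * expR (d * x)).
Proof.
rewrite mulrC; apply: (@is_derive1_comp _ expR (fun y => d * y)).
by rewrite -[X in is_derive _ _ _ X]mulr1; apply: is_deriveZ.
Qed.

Let is_derive_E d x : is_derive x 1 (fun y => E (d * y)) (d * Ch (d * x)).
Proof.
rewrite /E /Ch mulrDr -[X in _ + X]opprK -mulNr.
have -> : (fun y => expR (d * y) - expR (- (d * y))) =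
    (fun y => expR (d * y)) - (fun y => expR (- d * y)).
  by apply/funext => y; rewrite !fctE mulNr.
by rewrite -[in - d * _](mulNr d x); apply: is_deriveB.
Qed.

Let is_derive_Ch d x : is_derive x 1 (fun y => Ch (d * y)) (d * E (d * x)).
Proof.
rewrite /E /Ch mulrBr -mulNr.
have -> : (fun y => expR (d * y) + expR (- (d * y))) =
    (fun y => expR (d * y)) + (fun y => expR (- d * y)).
  by apply/funext => y; rewrite !fctE mulNr.
by rewrite -[in - d * _](mulNr d x); apply: is_deriveD.
Qed.

Lemma mvt_segment (f df : R -> R) x y : x < y ->
  (forall z : R, x <= z <= y -> is_derive z 1 f (df z)) ->
  exists2 z, x < z < y & f y - f x = df z * (y - x).
Proof.
move=> xy fd; have [z|z|z] := @MVT R f df x y xy.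
- by rewrite in_itv /= => /andP[xz zy]; apply: fd; rewrite !ltW.
- apply: derivable_within_continuous => u; rewrite in_itv /= => xuy.
  by have := fd u xuy => -[].
- by rewrite in_itv /= => zxy e; exists z.
Qed.

Let E_der_ge0 d y : 1 <= d -> 0 <= y -> 0 <= d * Ch (d * y) * E y - E (d * y) * Ch y.
Proof.
move=> d1; rewrite le_eqVlt => /predU1P[<-|y0].
  by rewrite /E !mulr0 oppr0 subrr mulr0 mul0r subrr.
pose N z := d * Ch (d * z) * E (1 * z) - E (d * z) * Ch (1 * z).
have dN (z : R) : is_derive z 1 N ((d ^+ 2 - 1) * (E (d * z) * E z)).
  have h1 := is_deriveM (is_deriveZ d (is_derive_Ch d z)) (is_derive_E 1 z).
  have h2 := is_deriveM (is_derive_E d z) (is_derive_Ch 1 z).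
  apply: is_derive_eq (is_deriveB h1 h2) _.
  by rewrite /= /GRing.scale /= !mul1r; ring.
have [z /andP[z0 _] Nz] := mvt_segment y0 (fun z _ => dN z).
have N0 : N 0 = 0 by rewrite /N /E !mulr0 oppr0 subrr mulr0 mul0r subrr.
move: Nz; rewrite N0 /N !mul1r !subr0 => ->.
have d2 : 0 <= d ^+ 2 - 1 by rewrite subr_ge0 exprn_ege1.
rewrite !mulr_ge0 ?E_ge0 ?mulr_ge0 ?(ltW z0) ?(ltW y0)//; lra.
Qed.

(** Monotonicity of [E (d * x) / E x]. The numerator of its derivative vanishes at 0 and has
    derivative [(d ^+ 2 - 1) * E (d * x) * E x]. *)
Let E_mul_le d x y : 1 <= d -> 0 < x -> x <= y -> E (d * x) * E y <= E (d * y) * E x.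
Proof.
move=> d1 x0; rewrite le_eqVlt => /predU1P[->//|xy].
have xE := E_gt0 x0; have yE := E_gt0 (lt_trans x0 xy).
rewrite -ler_pdivrMr// mulrAC -ler_pdivlMr//.
pose g z := E (d * z) * (E (1 * z))^-1.
pose dg z := (d * Ch (d * z) * E z - E (d * z) * Ch z) / E z ^+ 2.
suff : g x <= g y by rewrite /g !mul1r.
have [z z1|z /andP[xz _] gz] := @mvt_segment g dg x y xy.
  have z0 : 0 < z by apply: lt_le_trans x0 _; case/andP: z1.
  have zE : E (1 * z) != 0 by rewrite mul1r gt_eqF// E_gt0.
  have h2 := @is_deriveV _ (fun y => E (1 * y)) z _ 1 zE (is_derive_E 1 z).
  apply: is_derive_eq (is_deriveM (is_derive_E d z) h2) _.
  by move: zE; rewrite /dg /GRing.scale /= !mul1r => zE; field.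
have z0 := lt_trans x0 xz.
rewrite -subr_ge0 gz mulr_ge0 ?subr_ge0 ?(ltW xy)// /dg divr_ge0//.
  by rewrite E_der_ge0// ltW.
by rewrite exprn_ge0// E_ge0// ltW.
Qed.

Let cross_ratio_expR a1 a2 a3 a4 :
  cross_ratio (expR a1) (expR a2) (expR a3) (expR a4) =
  (E ((a2 - a1) / 2) * E ((a4 - a3) / 2)) /
  (E ((a3 - a1) / 2) * E ((a4 - a2) / 2)).
Proof.
have h a b : expR b - expR a = expR ((a + b) / 2) * E ((b - a) / 2).
  by rewrite /E mulrBr -!expRD; congr (expR _ - expR _); field.
rewrite /cross_ratio !h.
rewrite mulrACA [X in _ / X]mulrACA -!expRD.
have -> : (a1 + a3) / 2 + (a2 + a4) / 2 = (a1 + a2) / 2 + (a3 + a4) / 2 by field.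
by rewrite invfM mulrACA divff ?mul1r// gt_eqF// expR_gt0.
Qed.

(* The negative Schwarzian derivative of a power map, in cross-ratio form. *)
Lemma cross_ratio_powR d p q r s : 1 <= d -> 0 < p -> p < q -> q < r -> r < s ->
  cross_ratio (p `^ d) (q `^ d) (r `^ d) (s `^ d) <= cross_ratio p q r s.
Proof.
move=> d1 p0 pq qr rs; have q0 := lt_trans p0 pq.
have r0 := lt_trans q0 qr; have s0 := lt_trans r0 rs.
have powE x : 0 < x -> x `^ d = expR (d * ln x) by move=> x0; rewrite /powR gt_eqF.
have lnK x : 0 < x -> x = expR (ln x) by move=> x0; rewrite lnK.
rewrite !powE// [in leRHS](lnK p)// [in leRHS](lnK q)// [in leRHS](lnK r)// [in leRHS](lnK s)//.
rewrite !cross_ratio_expR -!mulrBr -!mulrA.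
have lnlt x y : 0 < x -> x < y -> ln x < ln y.
  by move=> x0 xy; rewrite ltr_ln ?posrE// (lt_trans x0).
have l1 := lnlt _ _ p0 pq; have l2 := lnlt _ _ q0 qr; have l3 := lnlt _ _ r0 rs.
move: (ln p) (ln q) (ln r) (ln s) l1 l2 l3 => a b c e l1 l2 l3.
have x12 : 0 < (b - a) / 2 by lra.
have x34 : 0 < (e - c) / 2 by lra.
have x13 : (b - a) / 2 <= (c - a) / 2 by lra.
have x24 : (e - c) / 2 <= (e - b) / 2 by lra.
move: ((b - a) / 2) ((e - c) / 2) ((c - a) / 2) ((e - b) / 2) x12 x34 x13 x24
  => u v u' v' u0 v0 uu' vv'.
have u'0 := lt_le_trans u0 uu'; have v'0 := lt_le_trans v0 vv'.
have d0 : 0 < d by lra.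
have Ed x : 0 < x -> 0 < E (d * x) by move=> x0; rewrite E_gt0// mulr_gt0.
rewrite !mulrA ler_pdivrMr ?mulr_gt0 ?Ed// mulrAC ler_pdivlMr ?mulr_gt0 ?E_gt0//.
rewrite mulrACA [leRHS]mulrACA [X in _ <= X * _]mulrC [X in _ <= _ * X]mulrC.
by apply: ler_pM; [exact/ltW/mulr_gt0/E_gt0/u'0/Ed|exact/ltW/mulr_gt0/E_gt0/v'0/Ed|
  exact: E_mul_le..].
Qed.

(* The local normal form of [F] at a critical point of order [d]. *)
Definition power_map d y := y * `|y| `^ (d - 1).

Lemma power_mapN d y : power_map d (- y) = - power_map d y.
Proof. by rewrite /power_map normrN mulNr. Qed.

Lemma power_map_pos d y : 0 < d -> 0 < y -> power_map d y = y `^ d.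
Proof. by move=> d0 y0; rewrite /power_map gtr0_norm// mulr_powRB1 ?ltW. Qed.

End PowerMap.

Section LocalDistortion.
Variable R : realType.
Implicit Types (x y z p q r s : R).

Let power_map_slope_pos (d x y : R) : 1 <= d -> 0 <= x -> x < y ->
  y `^ (d - 1) * (y - x) <= power_map d y - power_map d x <=
  d * y `^ (d - 1) * (y - x).
Proof.
move=> d1 x0 xy; have y0 : 0 < y by lra.
have dB : 0 <= d - 1 by lra.
rewrite /power_map (ger0_norm x0) (gtr0_norm y0).
have xy_d : x `^ (d - 1) <= y `^ (d - 1) by apply: ge0_ler_powR; rewrite ?nnegrE; lra.
have yd : 0 <= y `^ (d - 1) by exact: powR_ge0.
apply/andP; split.
  have := ler_wpM2l x0 xy_d; lra.
move: x0; rewrite le_eqVlt => /predU1P[x0|x0].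
  rewrite -x0 mul0r !subr0 mulrC -mulrA ler_peMl ?mulr_ge0//; lra.
rewrite !mulr_powRB1; [|lra..].
have [z zxy|z /andP[xz zy] ->] := @mvt_segment _ (fun a => a `^ d) (fun a => d * a `^ (d - 1)) x y xy.
  by apply: is_derive1_powR; lra.
rewrite ler_wpM2r ?ler_wpM2l//; [lra|lra|].
by apply: ge0_ler_powR; rewrite ?nnegrE; lra.
Qed.

(** The derivative is largest at the endpoint farthest from 0, and the mean slope is a fixed
    fraction of that scale even across 0: the longer of the two sides is at least half of the
    interval, whence [2^-1]. *)
Lemma power_map_slope (d x y e : R) : 1 <= d -> x < y -> e = Num.max `|x| `|y| ->
  2^-1 * e `^ (d - 1) * (y - x) <= power_map d y - power_map d x <=
  d * e `^ (d - 1) * (y - x).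
Proof.
move=> d1 xy eE; have e_ge0 : 0 <= e by rewrite eE le_max normr_ge0.
have dB : 0 <= d - 1 by lra.
have ed : 0 <= e `^ (d - 1) by exact: powR_ge0.
have edxy : 0 <= e `^ (d - 1) * (y - x) by rewrite mulr_ge0//; lra.
have [x0|x0] := leP 0 x.
  have -> : e = y by rewrite eE !ger0_norm ?(le_trans x0 (ltW xy))// max_r// ltW.
  have /andP[h1 ->] := power_map_slope_pos d1 x0 xy; rewrite andbT.
  have : 0 <= y `^ (d - 1) * (y - x) by rewrite mulr_ge0 ?powR_ge0//; lra.
  lra.
have [y0|y0] := leP y 0.
  have -> : e = - x by rewrite eE (ltr0_norm x0) ler0_norm// max_l// lerN2 ltW.
  have yx : - y < - x by lra.
  have y0' : 0 <= - y by lra.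
  have /andP[h1 h2] := power_map_slope_pos d1 y0' yx.
  rewrite !power_mapN in h1 h2.
  have : 0 <= (- x) `^ (d - 1) * (- x - - y) by rewrite mulr_ge0 ?powR_ge0//; lra.
  lra.
have xe : - x <= e by rewrite eE (ltr0_norm x0) le_max lexx.
have ye : y <= e by rewrite eE (gtr0_norm y0) le_max lexx orbT.
have xd : (- x) `^ (d - 1) <= e `^ (d - 1) by apply: ge0_ler_powR; rewrite ?nnegrE; lra.
have yd : y `^ (d - 1) <= e `^ (d - 1) by apply: ge0_ler_powR; rewrite ?nnegrE; lra.
rewrite /power_map (ltr0_norm x0) (gtr0_norm y0).
have x0' : 0 <= - x by lra.
have h1 := ler_wpM2l x0' xd; have h2 := ler_wpM2l (ltW y0) yd.
have h3 : 0 <= - x * (- x) `^ (d - 1) by rewrite mulr_ge0 ?powR_ge0.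
have h4 : 0 <= y * y `^ (d - 1) by rewrite mulr_ge0 ?powR_ge0// ltW.
apply/andP; split; last first.
  have : 0 <= (d - 1) * (e `^ (d - 1) * (y - x)) by rewrite mulr_ge0.
  lra.
have [xy'|xy'] := leP (- x) y.
  have ey : e = y by rewrite eE (ltr0_norm x0) (gtr0_norm y0) max_r.
  have : e `^ (d - 1) * (y - x) <= e `^ (d - 1) * (2 * y) by rewrite ler_wpM2l//; lra.
  rewrite {2}ey; lra.
have ex : e = - x by rewrite eE (ltr0_norm x0) (gtr0_norm y0) max_l// ltW.
have : e `^ (d - 1) * (y - x) <= e `^ (d - 1) * (2 * - x) by rewrite ler_wpM2l//; lra.
rewrite {2}ex; lra.
Qed.

(** The distortion of a cross-ratio is a product of two ratios of mean slopes, each over an interval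
    and a larger one containing it. *)
Lemma cross_ratio_slopes (g : R -> R) (E1 E2 : R) p q r s :
  p < q -> q < r -> r < s -> g p < g q -> g q < g r -> g r < g s ->
  (g q - g p) * (r - p) <= E1 * ((g r - g p) * (q - p)) ->
  (g s - g r) * (s - q) <= E2 * ((g s - g q) * (s - r)) ->
  cross_ratio (g p) (g q) (g r) (g s) <= E1 * E2 * cross_ratio p q r s.
Proof.
move=> pq qr rs gpq gqr grs h1 h2.
rewrite /cross_ratio ler_pdivrMr ?mulr_gt0//; [|lra..].
rewrite mulrA mulrAC ler_pdivlMr ?mulr_gt0//; [|lra..].
rewrite [leLHS](_ : _ = ((g q - g p) * (r - p)) * ((g s - g r) * (s - q))); last by ring.
rewrite [leRHS](_ : _ = (E1 * ((g r - g p) * (q - p))) * (E2 * ((g s - g q) * (s - r))));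
  last by ring.
by apply: ler_pM => //; apply: mulr_ge0; lra.
Qed.

(** Denjoy's estimate: where [dg] stays above [m] and [ddg] below [C0], the logarithm of [dg] is
    Lipschitz with constant [C0 / m]. It is used once for each ratio in [cross_ratio_slopes]. *)
Lemma C2_distortion (g dg ddg : R -> R) z (rad : R) : 0 < rad ->
  (forall x : R, `|x - z| < rad -> is_derive x 1 g (dg x)) ->
  (forall x : R, `|x - z| < rad -> is_derive x 1 dg (ddg x)) ->
  {for z, continuous ddg} -> 0 < dg z ->
  exists (e m B C : R), [/\ 0 < e <= rad, 0 < m, 0 <= C,
    (forall x y, `|x - z| < e -> `|y - z| < e -> x < y ->
       m * (y - x) <= g y - g x <= B * (y - x)) &
    (forall p q r s, `|p - z| < e -> `|s - z| < e -> p < q -> q < r -> r < s ->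
      cross_ratio (g p) (g q) (g r) (g s) <=
      expR (C * (s - p)) * cross_ratio p q r s)].
Proof.
move=> rad0 gd dgd ddgc dgz.
have dgc : {for z, continuous dg}.
  apply/differentiable_continuous/derivable1_diffP.
  by have := dgd z; rewrite subrr normr0 => /(_ rad0) [].
set m := dg z / 2; set C0 := `|ddg z| + 1.
have m0 : 0 < m by rewrite divr_gt0.
have [e1 /= e10 he1] : \forall x \near z, m < dg x < dg z + 1.
  near=> x; apply/andP; split; near: x.
    by apply: (cvgr_gt _ dgc); rewrite ltr_pdivrMr// ltr_pMr// ltr1n.
  by apply: (cvgr_lt _ dgc); rewrite ltrDl.
have [e2 /= e20 he2] : \forall x \near z, `|ddg x| < C0.
  by apply: (cvgr_lt _ (cvg_norm ddgc)); rewrite ltrDl.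
pose e := Num.min rad (Num.min e1 e2).
have e0 : 0 < e by rewrite !lt_min rad0 e10.
have er : e <= rad by rewrite ge_min lexx.
have ee1 : e <= e1 by rewrite !ge_min lexx !orbT.
have ee2 : e <= e2 by rewrite !ge_min lexx !orbT.
have near_dg x : `|x - z| < e -> m <= dg x <= dg z + 1.
  move=> xz; have /andP[/ltW -> /ltW -> //] : m < dg x < dg z + 1.
  by apply: he1; rewrite /= distrC; lra.
have near_ddg x : `|x - z| < e -> `|ddg x| <= C0.
  by move=> xz; rewrite ltW// he2//= distrC; lra.
have between x y w : `|x - z| < e -> `|y - z| < e -> x <= w <= y -> `|w - z| < e.
  by rewrite !ltr_norml; lra.
have slope x y : `|x - z| < e -> `|y - z| < e -> x < y ->
    exists2 w, x < w < y & g y - g x = dg w * (y - x).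
  move=> xz yz xy; apply: mvt_segment => // w xwy.
  by apply: gd; apply: lt_le_trans er; exact: between xwy.
have slope_bd x y : `|x - z| < e -> `|y - z| < e -> x < y ->
    m * (y - x) <= g y - g x <= (dg z + 1) * (y - x).
  move=> xz yz xy; have [w /andP[xw wy] ->] := slope _ _ xz yz xy.
  have /near_dg/andP[w1 w2] : `|w - z| < e by apply: between xz yz _; rewrite !ltW.
  by rewrite !ler_wpM2r// subr_ge0 ltW.
have C00 : 0 <= C0 by rewrite addr_ge0.
pose C1 := C0 / m; have C10 : 0 <= C1 by rewrite divr_ge0// ltW.
have ratio u v x y : `|x - z| < e -> `|y - z| < e -> x <= u <= y -> x <= v <= y ->
    dg u <= expR (C1 * (y - x)) * dg v.
  move=> xz yz xuy xvy.
  have uz := between _ _ _ xz yz xuy; have vz := between _ _ _ xz yz xvy.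
  have /andP[v1 _] := near_dg _ vz.
  have duv : dg u - dg v <= C0 * (y - x).
    have aux a b : x <= a <= y -> x <= b <= y -> a < b -> `|dg b - dg a| <= C0 * (y - x).
      move=> xa xb ab; have [|w wab ->] := @mvt_segment _ dg ddg a b ab.
        move=> w wab; apply: dgd; apply: lt_le_trans er.
        by apply: (between _ _ _ xz yz); lra.
      rewrite normrM ler_pM ?normr_ge0//.
        by apply: near_ddg; apply: (between _ _ _ xz yz); lra.
      by rewrite ger0_norm; lra.
    have [uv|uv|->] := ltgtP u v.
    - have := aux u v xuy xvy uv; rewrite ler_norml; lra.
    - have := aux v u xvy xuy uv; rewrite ler_norml; lra.
    - by rewrite subrr mulr_ge0//; lra.
  apply: le_trans (_ : (1 + C1 * (y - x)) * dg v <= _).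
    have : C0 * (y - x) <= C1 * (y - x) * dg v.
      have -> : C0 = C1 * m by rewrite /C1 divfK// gt_eqF.
      rewrite mulrAC ler_wpM2l//; apply: mulr_ge0 => //; lra.
    lra.
  by rewrite ler_wpM2r ?expR_ge1Dx//; lra.
exists e, m, (dg z + 1), (C1 + C1); split => //; first by rewrite e0.
  exact: addr_ge0.
move=> p q r s pz sz pq qr rs.
have qz : `|q - z| < e by apply: (between _ _ _ pz sz); lra.
have rz : `|r - z| < e by apply: (between _ _ _ pz sz); lra.
have g_inc x y : `|x - z| < e -> `|y - z| < e -> x < y -> g x < g y.
  move=> xz yz xy; have /andP[h _] := slope_bd _ _ xz yz xy.
  have : 0 < m * (y - x) by rewrite mulr_gt0// subr_gt0.
  lra.
have pr := lt_trans pq qr; have qs := lt_trans qr rs.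
rewrite mulrDl expRD; apply: cross_ratio_slopes => //; try exact: g_inc.
- have [u /andP[pu uq] ->] := slope _ _ pz qz pq.
  have [v /andP[pv vr] ->] := slope _ _ pz rz pr.
  have h : dg u <= expR (C1 * (s - p)) * dg v by apply: ratio => //; lra.
  have : 0 <= (q - p) * (r - p) by apply: mulr_ge0; lra.
  move=> /ler_wpM2r/(_ _ _ h); lra.
- have [u /andP[pu uq] ->] := slope _ _ rz sz rs.
  have [v /andP[pv vr] ->] := slope _ _ qz sz qs.
  have h : dg u <= expR (C1 * (s - p)) * dg v by apply: ratio => //; lra.
  have : 0 <= (s - r) * (s - q) by apply: mulr_ge0; lra.
  move=> /ler_wpM2r/(_ _ _ h); lra.
Unshelve. all: end_near. Qed.

End LocalDistortion.

(** * A local condition shared by regular and critical points *)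

Section Tame.
Variable R : realType.
Variables (F dF : R -> R).
Hypothesis F_inc : {homo F : x y / x < y}.
Hypothesis F_der : forall x : R, is_derive x 1 F (dF x).

(** The first property survives critical points and yields a bounded distortion factor; the second
    gives a factor close to 1 on short intervals free of them. As [M] is at once constant and
    inverse length, enlarging it weakens the condition, which suits a compactness argument. *)
Definition tame_at (M u : R) := forall v, u < v -> v - u < M^-1 ->
  (forall xi, u <= xi <= v -> dF xi * (v - u) <= M * (F v - F u)) /\
  ((forall xi, u <= xi <= v -> dF xi != 0) ->
    forall q r, u < q -> q < r -> r < v ->
    cross_ratio (F u) (F q) (F r) (F v) <=
    expR (M * (v - u)) * cross_ratio u q r v).

Definition tame_near (z : R) := exists M0 e : R, [/\ 0 < M0, 0 < e &
  forall M u, M0 <= M -> `|u - z| < e -> tame_at M u].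

Let der_le_slope u v (B : R) : u < v ->
  (forall x y, u <= x -> x < y -> y <= v -> F y - F x <= B * (y - x)) ->
  forall xi, u <= xi <= v -> dF xi <= B.
Proof.
move=> uv hB xi /andP[uxi]; rewrite le_eqVlt => /predU1P[->|xiv].
  have := slope_left (F_der v) => /cvgr_to_le; apply; near=> e.
  have e0 : 0 < e by near: e; exact: nbhs_right_gt.
  have e1 : e < v - u by near: e; apply: nbhs_right_lt; rewrite subr_gt0.
  rewrite ler_pdivrMr//; have := hB (v - e) v; lra.
have := slope_right (F_der xi) => /cvgr_to_le; apply; near=> e.
have e0 : 0 < e by near: e; exact: nbhs_right_gt.
have e1 : e < v - xi by near: e; apply: nbhs_right_lt; rewrite subr_gt0.
rewrite ler_pdivrMr//; have := hB xi (xi + e); lra.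
Unshelve. all: end_near. Qed.

(* Common to both kinds of points: [c1] bounds the slopes of [F] on small
   intervals from above and [c2] from below, up to a common factor. *)
Let tame_criterion (z e c1 c2 C : R) : 0 < e -> 0 < c2 -> 0 <= c1 ->
  (forall u v, `|u - z| < e -> `|v - z| < e -> u < v -> exists2 k : R, 0 <= k &
    c2 * k * (v - u) <= F v - F u /\
    forall x y, u <= x -> x < y -> y <= v -> F y - F x <= c1 * k * (y - x)) ->
  (forall p q r s, `|p - z| < e -> `|s - z| < e -> p < q -> q < r -> r < s ->
    (forall xi, p <= xi <= s -> dF xi != 0) ->
    cross_ratio (F p) (F q) (F r) (F s) <=
    expR (C * (s - p)) * cross_ratio p q r s) ->
  tame_near z.
Proof.
move=> e0 c20 c10 hk hcr.
pose M0 := Num.max (2 / e) (Num.max (c1 / c2) C).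
have e2 : 0 < 2 / e by rewrite divr_gt0.
exists M0, (e / 2); split; rewrite ?divr_gt0//; first by rewrite lt_max e2.
move=> M u; rewrite !ge_max => /and3P[M1 M2 M3] uz v uv vu.
have M_gt0 : 0 < M by exact: lt_le_trans M1.
have vu2 : v - u < e / 2.
  by apply: (lt_le_trans vu); rewrite -[e / 2]invf_div lef_pV2 ?posrE.
have uz' : `|u - z| < e by move: uz; rewrite !ltr_norml; lra.
have vz' : `|v - z| < e by move: uz; rewrite !ltr_norml; lra.
split=> [xi xiuv|nz q r uq qr rv].
  have [k k0 [lo up]] := hk u v uz' vz' uv.
  have := der_le_slope uv up xiuv => dk.
  apply: le_trans (_ : _ <= c1 * k * (v - u)) _.
    by rewrite ler_wpM2r// subr_ge0 ltW.
  apply: le_trans (_ : _ <= M * (c2 * k * (v - u))) _; last by rewrite ler_pM2l.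
  rewrite !mulrA -[X in _ <= X]mulrA -[X in X <= _]mulrA ler_wpM2r//.
    by rewrite mulr_ge0// subr_ge0 ltW.
  by rewrite -ler_pdivrMr.
apply: (le_trans (hcr _ _ _ _ uz' vz' uq qr rv nz)).
rewrite ler_wpM2r ?(ltW (cross_ratio_gt0 _ _ _))// ler_expR ler_wpM2r//.
by rewrite subr_ge0 ltW.
Qed.

Lemma regular_tame (ddF : R -> R) z :
  (forall x : R, is_derive x 1 dF (ddF x)) -> continuous ddF -> 0 < dF z ->
  tame_near z.
Proof.
move=> F_der2 ddF_cont dFz.
have [e [m [B [C [/andP[e0 _] m0 C0 bd cr]]]]] := C2_distortion ltr01
  (fun x _ => F_der x) (fun x _ => F_der2 x) (ddF_cont z) dFz.
have mB : m <= B.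
  have := bd z (z + e / 2); rewrite subrr normr0 => /(_ e0).
  have -> : z + e / 2 - z = e / 2 by ring.
  rewrite gtr0_norm ?divr_gt0// => /(_ ltac:(lra) ltac:(lra))/andP[h1 h2].
  by have := le_trans h1 h2; rewrite ler_pM2r// divr_gt0.
apply: (@tame_criterion z e B m C) => //; first by lra.
  move=> u v uz vz uv; exists 1 => //; rewrite !mulr1; split.
    by have /andP[] := bd u v uz vz uv.
  move=> x y ux xy yv.
  have xz : `|x - z| < e by move: uz vz; rewrite !ltr_norml; lra.
  have yz : `|y - z| < e by move: uz vz; rewrite !ltr_norml; lra.
  by have /andP[] := bd x y xz yz xy.
by move=> p q r s pz sz pq qr rs _; exact: cr.
Qed.

Lemma cross_ratio_opp (p q r s : R) :
  cross_ratio (- s) (- r) (- q) (- p) = cross_ratio p q r s.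
Proof.
rewrite /cross_ratio !opprK ![- _ + _]addrC.
by congr (_ / _); rewrite mulrC.
Qed.

(** Near [c], [F - F c] is a power map after [psi]. The diffeomorphism [psi] obeys [C2_distortion],
    and the power map contracts cross-ratios on either side of 0; as [dF c = 0], excluding zeros of
    [dF] puts the four points on one side of [c]. *)
Lemma power_law_tame c d : dF c = 0 -> power_law_at F c d -> tame_near c.
Proof.
move=> dFc [U [psi [oU Uc [[psi_der _] o_im [h [[h_der _] hK]]] FE]]].
have [rad /= rad0 radU] : nbhs c U by exact: open_nbhs_nbhs.
have near_U x : `|x - c| < rad -> U x by move=> xc; apply: radU; rewrite /= distrC.
pose dpsi := (psi^`())%classic; pose ddpsi := (dpsi^`())%classic.
have der1 (x : R) : `|x - c| < rad -> is_derive x 1 psi (dpsi x).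
  move=> /near_U Ux; rewrite /dpsi derive1E; apply: derivableP.
  exact: (psi_der 0%N x).
have der2 (x : R) : `|x - c| < rad -> is_derive x 1 dpsi (ddpsi x).
  move=> /near_U Ux; rewrite /ddpsi derive1E; apply: derivableP.
  exact: (psi_der 1%N x).
have der3 : {for c, continuous ddpsi}.
  apply/differentiable_continuous/derivable1_diffP.
  exact: (psi_der 2%N c).
have psi_c : psi c = 0.
  have /eqP : psi c * `|psi c| `^ (d - 1) = 0 by have := FE c Uc; lra.
  by rewrite mulf_eq0 powR_eq0 normr_eq0 => /orP[/eqP//|/andP[/eqP]].
have cc : `|c - c| < rad by rewrite subrr normr0.
have FP x : `|x - c| < rad -> F x = F c + power_map d (psi x).
  by move=> xc; rewrite FE//; exact: near_U.
have psi_pos x : `|x - c| < rad -> c < x -> 0 < psi x.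
  move=> xc cx; have := @F_inc _ _ cx; rewrite (FP x xc) => h1.
  rewrite ltNge; apply/negP => psi0.
  suff : power_map d (psi x) <= 0 by lra.
  by rewrite mulr_le0_ge0// powR_ge0.
have psi_neg x : `|x - c| < rad -> x < c -> psi x < 0.
  move=> xc cx; have := @F_inc _ _ cx; rewrite (FP x xc) => h1.
  rewrite ltNge; apply/negP => psi0.
  suff : 0 <= power_map d (psi x) by lra.
  by rewrite mulr_ge0// powR_ge0.
(* [psi] inherits its sign on either side of [c] from the monotonicity of [F], and the
   differentiable inverse [h] prevents its derivative from vanishing. *)
have dpsi_c : 0 < dpsi c.
  rewrite lt_neqAle; apply/andP; split; last first.
    have := slope_right (der1 c cc) => /cvgr_to_ge; apply; near=> e.
    have e0 : 0 < e by near: e; exact: nbhs_right_gt.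
    have er : e < rad by near: e; exact: nbhs_right_lt.
    rewrite psi_c subr0 divr_ge0 ?(ltW e0)// ltW// psi_pos ?ltrDl//.
    by rewrite addrAC subrr add0r gtr0_norm.
  have h_c : derivable h (psi c) 1 by apply: (h_der 0%N) => //; exists c.
  have hd : is_derive (psi c) 1 h (h^`()%classic (psi c)).
    by rewrite derive1E; exact: derivableP.
  have comp := is_derive1_comp hd (der1 c cc).
  have idd : is_derive c 1 (h \o psi) 1.
    apply: (@near_eq_is_derive _ _ _ id).
    have : nbhs c U by exact: open_nbhs_nbhs.
    by apply: filterS => x Ux /=; rewrite hK.
  have := @derive_val _ _ _ _ _ _ _ comp.
  rewrite (@derive_val _ _ _ _ _ _ _ idd) => e1.
  by apply/eqP => d0; move: e1; rewrite -d0 mulr0 => /eqP; rewrite oner_eq0.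
have [e [m [B [C [/andP[e0 er] m0 C0 bd cr]]]]] := C2_distortion rad0 der1 der2 der3 dpsi_c.
have sub_rad x : `|x - c| < e -> `|x - c| < rad by move=> /lt_le_trans; apply.
have cce : `|c - c| < e by rewrite subrr normr0.
have psi_inc x y : `|x - c| < e -> `|y - c| < e -> x < y -> psi x < psi y.
  move=> xz yz xy; have /andP[h1 _] := bd _ _ xz yz xy.
  have : 0 < m * (y - x) by rewrite mulr_gt0// subr_gt0.
  lra.
have mB : m <= B.
  have ee : `|c + e / 2 - c| < e.
    by have -> : c + e / 2 - c = e / 2; [ring|rewrite gtr0_norm; lra].
  have /andP[h1 h2] := bd c (c + e / 2) cce ee ltac:(lra).
  have := le_trans h1 h2; rewrite ler_pM2r//.
  by have -> : c + e / 2 - c = e / 2; [ring|rewrite divr_gt0].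
(* Otherwise [F (c + r) - F c >= psi (c + r) >= m * r] for small [r > 0], against [dF c = 0]. *)
have d1 : 1 < d.
  rewrite ltNge; apply/negP => d_le1.
  suff : m <= dF c by rewrite dFc leNgt m0.
  have psi_cc : psi x @[x --> c] --> psi c.
    by apply/differentiable_continuous/derivable1_diffP; have [] := der1 c cc.
  have := slope_right (F_der c) => /cvgr_to_ge; apply.
  have [e1 /= e10 he1] : \forall x \near c, psi x < 1.
    by apply: (cvgr_lt _ psi_cc); rewrite psi_c.
  near=> r; have r0 : 0 < r by near: r; exact: nbhs_right_gt.
  have re : r < e by near: r; exact: nbhs_right_lt.
  have re1 : r < e1 by near: r; exact: nbhs_right_lt.
  have xc : `|c + r - c| < e by rewrite addrAC subrr add0r gtr0_norm.
  rewrite ler_pdivlMr//; rewrite FP ?sub_rad// addrAC subrr add0r.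
  have /andP[h1 _] := bd c (c + r) cce xc ltac:(lra).
  rewrite psi_c subr0 addrAC subrr add0r in h1.
  apply: (le_trans h1).
  have p0 : 0 < psi (c + r) by apply: psi_pos; [exact: sub_rad|rewrite ltrDl].
  have p1 : psi (c + r) < 1.
    by apply: he1; rewrite /= opprD addrA subrr add0r normrN gtr0_norm.
  rewrite /power_map (gtr0_norm p0) ler_peMr ?(ltW p0)//.
  rewrite -[X in X <= _](powRr0 (psi (c + r))).
  by rewrite ger_powR ?p0 ?(ltW p1)// subr_le0.
have {}d1' : 1 <= d by exact: ltW.
have between u v w : `|u - c| < e -> `|v - c| < e -> u <= w <= v -> `|w - c| < e.
  by rewrite !ltr_norml; lra.
apply: (@tame_criterion c e (d * B) (2^-1 * m) C) => //.
- by rewrite mulr_gt0// invr_gt0.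
- by rewrite mulr_ge0; lra.
- move=> u v uc vc uv; set k := Num.max `|psi u| `|psi v|.
  exists (k `^ (d - 1)); first exact: powR_ge0.
  have k_ge0 : 0 <= k by rewrite le_max normr_ge0.
  split.
    rewrite (FP u (sub_rad _ uc)) (FP v (sub_rad _ vc)).
    rewrite [X in _ <= X](_ : _ = power_map d (psi v) - power_map d (psi u)); last by ring.
    have /andP[h1 _] := power_map_slope d1' (psi_inc _ _ uc vc uv) (erefl k).
    apply: le_trans h1; have /andP[h1 _] := bd _ _ uc vc uv.
    rewrite [X in X <= _](_ : _ = 2^-1 * k `^ (d - 1) * (m * (v - u))); last by ring.
    by rewrite ler_wpM2l// mulr_ge0 ?invr_ge0 ?powR_ge0.
  move=> x y ux xy yv.
  have xc : `|x - c| < e by apply: (between _ _ _ uc vc); lra.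
  have yc : `|y - c| < e by apply: (between _ _ _ uc vc); lra.
  have pxy := psi_inc _ _ xc yc xy.
  rewrite (FP x (sub_rad _ xc)) (FP y (sub_rad _ yc)).
  rewrite [X in X <= _](_ : _ = power_map d (psi y) - power_map d (psi x)); last by ring.
  have /andP[_ h1] := power_map_slope d1' pxy (erefl _).
  apply: (le_trans h1); set k' := Num.max _ _.
  have kk : k' <= k.
    have pu : psi u <= psi x.
      by move: ux; rewrite le_eqVlt => /predU1P[->//|/psi_inc h2]; exact/ltW/h2.
    have pv : psi y <= psi v.
      by move: yv; rewrite le_eqVlt => /predU1P[->//|/psi_inc h2]; exact/ltW/h2.
    have l1 := ler_norm (psi v); have l2 := ler_norm (- psi u).
    rewrite normrN in l2.
    have ku : `|psi u| <= k by rewrite le_max lexx.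
    have kv : `|psi v| <= k by rewrite le_max lexx orbT.
    by rewrite ge_max !ler_norml; apply/andP; split; lra.
  have k'0 : 0 <= k' by rewrite le_max normr_ge0.
  have kkd : k' `^ (d - 1) <= k `^ (d - 1) by apply: ge0_ler_powR; rewrite ?nnegrE// subr_ge0.
  have /andP[_ h2] := bd _ _ xc yc xy.
  rewrite [X in _ <= X](_ : _ = d * (k `^ (d - 1) * (B * (y - x)))); last by ring.
  rewrite -mulrA ler_wpM2l//; first by lra.
  by apply: ler_pM => //; [exact: powR_ge0|lra].
move=> p q r s pc sc pq qr rs nz.
have qc : `|q - c| < e by apply: (between _ _ _ pc sc); lra.
have rc : `|r - c| < e by apply: (between _ _ _ pc sc); lra.
rewrite (FP p (sub_rad _ pc)) (FP q (sub_rad _ qc)).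
rewrite (FP r (sub_rad _ rc)) (FP s (sub_rad _ sc)).
rewrite ![F c + _]addrC cross_ratio_shift.
apply: le_trans (cr _ _ _ _ pc sc pq qr rs).
have lpq := psi_inc _ _ pc qc pq; have lqr := psi_inc _ _ qc rc qr.
have lrs := psi_inc _ _ rc sc rs; have d0 : 0 < d by lra.
have [cp|pc'] := ltP c p.
  have pp := psi_pos _ (sub_rad _ pc) cp.
  have qp := lt_trans pp lpq; have rp := lt_trans qp lqr.
  rewrite !power_map_pos ?(lt_trans rp lrs)//.
  exact: cross_ratio_powR.
have sc' : s < c.
  rewrite ltNge; apply/negP => cs; have := nz c; rewrite pc' cs => /(_ isT).
  by rewrite dFc eqxx.
have sp := psi_neg _ (sub_rad _ sc) sc'.
rewrite -(opprK (psi p)) -(opprK (psi q)) -(opprK (psi r)) -(opprK (psi s)).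
have ns : 0 < - psi s by rewrite oppr_gt0.
have nsr : - psi s < - psi r by rewrite ltrN2.
have nrq : - psi r < - psi q by rewrite ltrN2.
have nqp : - psi q < - psi p by rewrite ltrN2.
have nr := lt_trans ns nsr; have nq := lt_trans nr nrq; have np := lt_trans nq nqp.
rewrite !(power_mapN _ (- _)) !cross_ratio_opp !power_map_pos//.
by rewrite -[X in _ <= X]cross_ratio_opp; exact: cross_ratio_powR.
Unshelve. all: end_near. Qed.

End Tame.

(** * From local to global distortion *)

Section GlobalDistortion.
Variable R : realType.
Variables (F dF : R -> R).
Hypothesis F1 : degree_one 1 F.
Hypothesis F_inc : {homo F : x y / x < y}.
Hypothesis F_der : forall x : R, is_derive x 1 F (dF x).
Hypothesis dF_cont : continuous dF.
Hypothesis F_tame : forall z, tame_near F dF z.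
Variable L : seq R.
Hypothesis F_crit : forall x, dF x = 0 -> exists2 c, c \in L &
  exists k : int, x = c + k%:~R.

Let dF1 := derivative_periodic F1 F_der.
Let F_cont := lift_cont F_der.

Let uniformly_tame : exists2 M : R, 0 < M & forall u, tame_at F dF M u.
Proof.
have [M [M0 MP]] : exists M : R, 0 < M /\ forall u, 0 <= u <= 1 -> tame_at F dF M u.
  have := @segment_compact R 0 1; rewrite compact_near_coveringP.
  move=> /(_ R +oo (fun M u => tame_at F dF M u) _) cover.
  have {}cover : \forall M \near +oo, `[0, 1]%classic `<=` (fun u => tame_at F dF M u).
    apply: cover => z _; have [M0 [e [M00 e0 h]]] := F_tame z.
    exists ([set u | `|u - z| < e], [set M | M0 <= M]) => /=.
      split; last by apply: nbhs_pinfty_ge; exact: num_real.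
      by apply/nbhs_ballP; exists e => //= u /=; rewrite distrC.
    by move=> [u M] /= [uz MM]; exact: h.
  have [M [M_gt0 MP]] := filter_ex (filterI (nbhs_pinfty_gt (num_real (0 : R))) cover).
  by exists M; split => // u u01; apply: MP; rewrite /= in_itv.
exists M => // u; pose k := Num.floor u.
have uk : 0 <= u - k%:~R <= 1.
  by have := floor_itv u; rewrite -/k intrD; lra.
have sh x : F x = F (x - k%:~R) + k%:~R.
  by have := degree_oneD F1 k (x - k%:~R); rewrite subrK mulr1.
have dsh x : dF x = dF (x - k%:~R).
  by have := degree_oneD dF1 k (x - k%:~R); rewrite subrK mulr0 addr0.
move=> v uv vu; have e : (v - k%:~R) - (u - k%:~R) = v - u by ring.
have := MP _ uk (v - k%:~R); rewrite e ltrD2r => /(_ uv vu)[h1 h2]; split.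
  move=> xi xiuv; rewrite dsh (sh v) (sh u).
  by have := h1 (xi - k%:~R) ltac:(lra); lra.
move=> nz q r uq qr rv.
rewrite (sh u) (sh q) (sh r) (sh v) cross_ratio_shift.
rewrite -(cross_ratio_shift (- k%:~R) u q r v).
by apply: h2; [move=> xi xiuv; rewrite -[xi](addrK k%:~R) -dsh; apply: nz|..]; lra.
Qed.

Let mean_slope : exists2 K : R, 1 <= K & forall u v xi, u < v -> u <= xi <= v ->
  dF xi * (v - u) <= K * (F v - F u).
Proof.
have [M M0 MP] := uniformly_tame.
have [x0 B] : exists x0, forall x, dF x <= dF x0.
  have [||x0 h] := @periodic_min R (fun x => - dF x).
  - by move=> x; apply: cvgN; exact: dF_cont.
  - by move=> x; rewrite dF1 !addr0.
  by exists x0 => x; rewrite -lerN2.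
pose l := Num.min M^-1 1; have l0 : 0 < l by rewrite lt_min invr_gt0 M0 ltr01.
have l1 : l <= 1 by rewrite ge_min lexx orbT.
have lM : l <= M^-1 by rewrite ge_min lexx.
have [y0 mu] : exists y0, forall x, F (y0 + l) - F y0 <= F (x + l) - F x.
  apply: (@periodic_min R (fun x => F (x + l) - F x)) => x.
    apply: cvgB; last exact: F_cont.
    apply: (@continuous_comp _ _ _ (fun x => x + l) F); last exact: F_cont.
    by apply: cvgD; [exact: cvg_id | exact: cvg_cst].
  by rewrite addrAC !F1; ring.
have mu0 : 0 < F (y0 + l) - F y0 by rewrite subr_gt0 F_inc// ltrDl.
set m := F (y0 + l) - F y0 in mu mu0 *; set B0 := dF x0 in B *.
have B0_ge0 : 0 <= B0 by exact: dF_ge0 F_inc F_der _.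
(* The last three entries serve lengths below [M^-1], lengths from there to 1, and lengths above 1.
   In the last range [F v - F u] is at least the integer part of [v - u], which exceeds half of
   it. *)
pose K := Num.max 1 (Num.max M (Num.max (B0 / m) (B0 * 2))).
exists K; first by rewrite le_max lexx.
have K1 : M <= K by rewrite !le_max lexx !orbT.
have K2 : B0 / m <= K by rewrite !le_max lexx !orbT.
have K3 : B0 * 2 <= K by rewrite !le_max lexx !orbT.
move=> u v xi uv xiuv; have Fuv : 0 < F v - F u by rewrite subr_gt0 F_inc.
have [vu|vu] := ltP (v - u) M^-1.
  have [h _] := MP u v uv vu; apply: (le_trans (h xi xiuv)).
  by rewrite ler_wpM2r// ltW.
apply: le_trans (_ : B0 * (v - u) <= _).
  by rewrite ler_wpM2r ?B// subr_ge0 ltW.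
have F_le x y : x <= y -> F x <= F y by exact: (ltW_homo F_inc).
have [vu1|vu1] := leP (v - u) 1.
  apply: le_trans (_ : B0 <= _); first by rewrite ler_piMr.
  apply: le_trans (_ : K * m <= _); first by rewrite -ler_pdivrMr.
  rewrite ler_wpM2l//; first by apply: le_trans K1; exact: ltW.
  apply: le_trans (mu u) _; rewrite lerD2r F_le//; lra.
apply: le_trans (_ : B0 * 2 * (F v - F u) <= _); last by rewrite ler_wpM2r// ltW.
rewrite -mulrA ler_wpM2l//.
set n := Num.truncn (v - u).
have vu0 : 0 <= v - u by rewrite subr_ge0 ltW.
have /andP[n1 n2] := truncn_itv vu0; rewrite -/n in n1 n2.
have n_ge1 : 1 <= n%:R :> R by rewrite ler1n truncn_gt0 ltW.
have : F (u + (n%:Z)%:~R) <= F v by apply: F_le; rewrite -pmulrn; lra.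
rewrite (degree_oneD F1) mulr1 -pmulrn.
by move: n2; rewrite -natr1; lra.
Qed.

(** [K * K = expR ka] is the worst factor for any four points. It is paid by the jump of [Xi] if a
    critical point is met, and by length if the interval is long; otherwise the linear term covers
    the factor from [tame_at]. Floors count points of [(p0, s]], so [p0 < p] ensures that a critical
    point at [p] is counted. *)
Lemma distortion_control : exists (hX : R) (Xi : R -> R),
  [/\ degree_one hX Xi, {homo Xi : x y / x <= y} &
    forall p0 p q r s, p0 < p -> p < q -> q < r -> r < s ->
    cross_ratio (F p) (F q) (F r) (F s) <=
    expR (Xi s - Xi p0) * cross_ratio p q r s].
Proof.
have [M M0 MP] := uniformly_tame; have [K K1 KP] := mean_slope.
pose ka := ln (K * K).
have K_gt0 : 0 < K by lra.
have KK : K * K = expR ka by rewrite lnK// posrE mulr_gt0.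
have ka0 : 0 <= ka by rewrite ln_ge0// mulr_ege1.
pose N (x : R) : R := \sum_(c <- L) (Num.floor (x - c))%:~R.
have N_nd : {homo N : x y / x <= y}.
  by move=> x y xy; apply: ler_sum => c _; rewrite ler_int le_floor// lerD2r.
have N1 : degree_one (size L)%:R N.
  move=> x; rewrite /N; under eq_bigr => c _ do
    rewrite addrAC floorDrz ?int_num1// intrD floor1.
  by rewrite big_split /= -[in RHS]sum1_size natr_sum.
pose A := Num.max M (ka * M).
have AM : M <= A by rewrite le_max lexx.
have AkM : ka * M <= A by rewrite le_max lexx orbT.
have A0 : 0 < A by exact: lt_le_trans AM.
exists (A + ka * (size L)%:R), (fun x => A * x + ka * N x); split.
- by move=> x; rewrite N1; ring.
- by move=> x y xy; rewrite lerD// ler_wpM2l ?N_nd// ltW.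
move=> p0 p q r s pp pq qr rs.
have pr := lt_trans pq qr; have qs := lt_trans qr rs; have ps := lt_trans pq qs.
have cr0 := cross_ratio_gt0 pq qr rs.
have AA : A * (s - p) <= A * (s - p0) by rewrite ler_wpM2l ?(ltW A0)//; lra.
have A_ge0 : 0 <= A * (s - p0) by rewrite mulr_ge0 ?(ltW A0)//; lra.
have NN : 0 <= ka * (N s - N p0).
  by rewrite mulr_ge0// subr_ge0 N_nd//; lra.
have all_le : cross_ratio (F p) (F q) (F r) (F s) <= expR ka * cross_ratio p q r s.
  have slope x y : x < y -> exists2 w, x < w < y & F y - F x = dF w * (y - x).
    by move=> xy; apply: mvt_segment.
  rewrite -KK; apply: cross_ratio_slopes => //; try exact: F_inc.
  - have [w /andP[pw wq] ->] := slope _ _ pq.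
    have := KP p r w pr ltac:(lra); have : 0 <= q - p by lra.
    move=> /ler_wpM2r h /h; lra.
  - have [w /andP[pw wq] ->] := slope _ _ rs.
    have := KP q s w qs ltac:(lra); have : 0 <= s - r by lra.
    move=> /ler_wpM2r h /h; lra.
have [sp|sp] := ltP (s - p) M^-1; last first.
  apply: (le_trans all_le); rewrite ler_pM2r// ler_expR.
  have : ka <= A * (s - p).
    apply: le_trans (_ : ka * M * (s - p) <= _).
      by rewrite -mulrA ler_peMr// mulrC -ler_pdivrMr// mul1r.
    by rewrite ler_wpM2r//; lra.
  lra.
have [nz|] := pselect (forall xi, p <= xi <= s -> dF xi != 0).
  have [_ h] := MP p s ps sp; apply: (le_trans (h nz q r pq qr rs)).
  rewrite ler_pM2r// ler_expR.
  have : M * (s - p) <= A * (s - p) by rewrite ler_wpM2r//; lra.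
  lra.
move=> /existsNP[xi] /not_implyP[xips /negP]; rewrite negbK => /eqP/F_crit[c cL [k xik]].
apply: (le_trans all_le); rewrite ler_pM2r// ler_expR.
have h1 : 1 <= N s - N p0.
  rewrite /N -sumrB (big_rem c)//=.
  apply: le_trans (_ : (Num.floor (s - c))%:~R - (Num.floor (p0 - c))%:~R <= _); last first.
    rewrite lerDl; apply: sumr_ge0 => c' _; rewrite subr_ge0 ler_int le_floor// lerD2r.
    lra.
  have ha : k <= Num.floor (s - c) by rewrite floor_ge_int; lra.
  have hb : Num.floor (p0 - c) < k by rewrite floor_lt_int; lra.
  by rewrite -intrB ler1z -gtz0_ge1 subr_gt0; exact: lt_le_trans hb ha.
have := ler_wpM2l ka0 h1; lra.
Qed.

End GlobalDistortion.

(** * Lifts of multicritical circle maps *)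

Section Circle.
Variable R : realType.
Local Open Scope quotient_scope.
Implicit Types (x y : R) (z : circle R).
Local Notation I := [the zmodClosed R of (@Num.int_num_subdef R : {pred R})].

Lemma circle_piP x y : circle_pi x = circle_pi y <-> exists k : int, x = y + k%:~R.
Proof.
split=> [h0|[k ->]].
  have h : x = y %[mod {ideal_quot I}] := h0.
  have : x - y \is a Num.int by move/eqP : h; rewrite -Quotient.idealrBE.
  by move=> /intrP[k E]; exists k; rewrite -E; ring.
suff h : y + k%:~R = y %[mod {ideal_quot I}] by exact: h.
apply/eqP; rewrite -Quotient.idealrBE addrAC subrr add0r.
have H : (k%:~R : R) \is a Num.int by exact: intr_int.
exact: H.
Qed.

Lemma circle_reprK z : circle_pi (repr z) = z. Proof. exact: reprK. Qed.

Lemma circle_pi_shift x (k : int) : circle_pi (x + k%:~R) = circle_pi x.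
Proof. by apply/circle_piP; exists k. Qed.

Lemma circle_continuous (T : topologicalType) (g : circle R -> T) :
  continuous g <-> continuous (fun x => g (circle_pi x)).
Proof. exact: quotient_continuous. Qed.

Lemma circle_pi_continuous : continuous (@circle_pi R).
Proof. exact: pi_continuous. Qed.

Lemma repr_pi (T : Type) (g : R -> T) x : (forall (k : int) y, g (y + k%:~R) = g y) ->
  g (repr (circle_pi x)) = g x.
Proof.
by move=> gk; have [k ->] := (circle_piP _ _).1 (circle_reprK (circle_pi x)).
Qed.

Lemma periodic_circle_continuous (g : R -> R) : continuous g ->
  (forall (k : int) y, g (y + k%:~R) = g y) ->
  continuous (fun z => g (repr z)).
Proof.
move=> gc gk; apply/circle_continuous.
by have -> : (fun x => g (repr (circle_pi x))) = g by apply/funext => x; exact: repr_pi.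
Qed.

Lemma integer_valued_constant (u : R -> R) : continuous u ->
  (forall x, exists k : int, u x = k%:~R) -> forall x, u x = u 0.
Proof.
move=> uc uk; suff h x y : x <= y -> u x = u y.
  by move=> x; have [/h//|/ltW/h] := leP 0 x.
move=> xy; have [k kE] := uk x; have [l lE] := uk y.
have aux (i j : int) : i < j -> ~ (exists2 c, x <= c <= y & u c = i%:~R + 2^-1).
  move=> _ [c _]; have [n ->] := uk c => e.
  have : (i%:~R : R) < n%:~R by rewrite e ltrDl invr_gt0.
  have : (n%:~R : R) < (i + 1)%:~R by rewrite e intrD ltrD2l invf_lt1// ltr1n.
  by rewrite !ltr_int; lia.
have ivt v : Num.min (u x) (u y) <= v <= Num.max (u x) (u y) ->
    exists2 c, x <= c <= y & u c = v.
  move=> hv; have [|c] := IVT xy _ hv; first exact: continuous_subspaceT.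
  by rewrite in_itv /= => cxy <-; exists c.
have lt1 (i j : int) : i < j -> (i%:~R : R) + 1 <= j%:~R.
  by move=> ij; rewrite -[1]/(1%:~R) -intrD ler_int; lia.
have [kl|kl|kl] := ltgtP k l; last by rewrite kE lE kl.
- exfalso; apply: (aux k l kl); apply: ivt; rewrite kE lE.
  have := lt1 _ _ kl => kl1; rewrite min_l ?max_r; lra.
- exfalso; apply: (aux l k kl); apply: ivt; rewrite kE lE.
  have := lt1 _ _ kl => kl1; rewrite min_r ?max_l; lra.
Qed.

End Circle.

Section MulticriticalLift.
Variable R : realType.
Variable f : circle R -> circle R.
Hypothesis hf : multicritical f.
Hypothesis hrot : irrational_rotation_number f.

Definition lift := circle_lift f.
Definition dlift := (lift^`())%classic.

Let lift_spec : is_lift f lift.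
Proof.
rewrite /lift /circle_lift; apply: getPex.
by have [[_ [F0 F0l _]] _ _ _ _] := hf; exists F0.
Qed.

Lemma pi_lift x : circle_pi (lift x) = f (circle_pi x).
Proof. exact: lift_spec.2. Qed.

Lemma lift_continuous : continuous lift.
Proof. exact: lift_spec.1. Qed.

Lemma lift_increasing : {homo lift : x y / x < y}.
Proof.
have [[_ [F0 [F0c F0l] F0_inc]] _ _ _ _] := hf.
have h : forall x, lift x - F0 x = lift 0 - F0 0.
  apply: (@integer_valued_constant R (fun x => lift x - F0 x)) => x.
    by apply: cvgB; [exact: lift_continuous | exact: F0c].
  have [k ->] : exists k : int, lift x = F0 x + k%:~R.
    by apply/circle_piP; rewrite pi_lift F0l.
  by exists k; ring.
by move=> x y /F0_inc; have := h x; have := h y; lra.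
Qed.

(** The degree is positive as the lift increases. If it were at least 2, the value [lift 0 + 1]
    would be taken strictly between 0 and 1, against the injectivity of [f]. *)
Lemma lift_degree_one : degree_one 1 lift.
Proof.
have h : forall x, lift (x + 1) - lift x = lift (0 + 1) - lift 0.
  apply: (@integer_valued_constant R (fun x => lift (x + 1) - lift x)) => x.
    apply: cvgB; last exact: lift_continuous.
    apply: (@continuous_comp _ _ _ (fun x : R => x + 1) lift); last exact: lift_continuous.
    by apply: cvgD; [exact: cvg_id | exact: cvg_cst].
  have [k ->] : exists k : int, lift (x + 1) = lift x + k%:~R.
    by apply/circle_piP; rewrite !pi_lift -[1]/(1%:~R) circle_pi_shift.
  by exists k; ring.
have [k kE] : exists k : int, lift (0 + 1) = lift 0 + k%:~R.
  by apply/circle_piP; rewrite !pi_lift -[1]/(1%:~R) circle_pi_shift.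
suff k1 : k = 1 by move=> x; have := h x; rewrite kE k1; lra.
have k_gt0 : 0 < k.
  have : lift 0 < lift (0 + 1) by apply: lift_increasing; rewrite add0r.
  by rewrite kE ltrDl ltr0z.
apply/eqP; rewrite eq_le -gtz0_ge1 k_gt0 andbT leNgt; apply/negP => k_gt1.
have k2 : (2 : R) <= k%:~R by rewrite -[2]/(2%:~R) ler_int.
have h01 : (0 : R) <= 0 + 1 by rewrite add0r ler01.
have hv : Num.min (lift 0) (lift (0 + 1)) <= lift 0 + 1 <=
    Num.max (lift 0) (lift (0 + 1)) by rewrite kE min_l ?max_r; lra.
have [c] := @IVT R lift 0 (0 + 1) _ h01 (continuous_subspaceT lift_continuous) hv.
rewrite in_itv /= add0r => /andP[c0 c1] cE.
have [[[g [fK _ _ _]] _] _ _ _ _] := hf.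
have : f (circle_pi c) = f (circle_pi 0).
  by rewrite -!pi_lift cE -[1]/(1%:~R) circle_pi_shift.
move=> /(can_inj fK)/circle_piP[n]; rewrite add0r => cn.
have n01 : n = 0 \/ n = 1.
  by move: c0 c1; rewrite cn -[0]/(0%:~R) -[1]/(1%:~R) !ler_int; lia.
case: n01 cn => -> cn; move: cE; rewrite cn ?mulr0z; first lra.
by rewrite -[1%:~R](add0r 1) kE; lra.
Qed.

Let lift_C3 : Ck_on 3 setT lift.
Proof. by have [] := hf. Qed.

Lemma lift_is_derive (x : R) : is_derive x 1 lift (dlift x).
Proof.
by rewrite /dlift derive1E; apply: derivableP; exact: (lift_C3.1 0%N x).
Qed.

Definition ddlift := (dlift^`())%classic.

Lemma dlift_is_derive (x : R) : is_derive x 1 dlift (ddlift x).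
Proof.
by rewrite /ddlift derive1E; apply: derivableP; exact: (lift_C3.1 1%N x).
Qed.

Lemma dlift_continuous : continuous dlift.
Proof. exact: lift_cont dlift_is_derive. Qed.

Lemma ddlift_continuous : continuous ddlift.
Proof.
by move=> x; apply/differentiable_continuous/derivable1_diffP; exact: (lift_C3.1 2%N x).
Qed.

Lemma dlift_shift (k : int) x : dlift (x + k%:~R) = dlift x.
Proof. exact: derivative_shift lift_degree_one lift_is_derive _ _. Qed.

Lemma circle_derive_pi x : circle_derive f (circle_pi x) = dlift x.
Proof. by rewrite /circle_derive repr_pi//; exact: dlift_shift. Qed.

Let tame z : tame_near lift dlift z.
Proof.
have [_ _ _ pos pow] := hf.
have [dz|dz] := eqVneq (dlift z) 0.
  have [|d] := pow z; first by rewrite /critical_points /= circle_derive_pi.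
  exact: power_law_tame lift_increasing lift_is_derive _ _ dz.
apply: (regular_tame lift_is_derive dlift_is_derive ddlift_continuous).
rewrite -circle_derive_pi; apply: pos => /= h; move/eqP: dz; apply.
by rewrite -circle_derive_pi.
Qed.

Lemma lift_distortion : exists (hX : R) (Xi : R -> R),
  [/\ degree_one hX Xi, {homo Xi : x y / x <= y} &
    forall p0 p q r s, p0 < p -> p < q -> q < r -> r < s ->
    cross_ratio (lift p) (lift q) (lift r) (lift s) <=
    expR (Xi s - Xi p0) * cross_ratio p q r s].
Proof.
have [_ _ /(finite_image (repr : circle R -> R))/finite_seqP[l lE] _ _] := hf.
apply: (distortion_control lift_degree_one lift_increasing lift_is_derive
  dlift_continuous tame (L := l)) => x dx.
have xl : [set` l] (repr (circle_pi x)).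
  by rewrite -lE; exists (circle_pi x) => //; rewrite /critical_points /= circle_derive_pi.
exists (repr (circle_pi x)); first exact: xl.
by apply/circle_piP; rewrite circle_reprK.
Qed.

Lemma lift_rotation : exists2 rho : R,
  iter n lift 0 / n%:R @[n --> \oo] --> rho &
  forall (q : nat) (p : int), (0 < q)%N -> q%:R * rho != p%:~R.
Proof.
have [rho irr piE] := hrot; rewrite /rotation_number in piE.
set l := lim _ in piE.
have not_rat (q : nat) (p : int) : (0 < q)%N -> q%:R * l != p%:~R.
  move=> q0; apply/eqP => ql; apply: irr.
  have [k ->] := (circle_piP _ _).1 piE.
  have qn : (q%:R : R) != 0 by rewrite pnatr_eq0 -lt0n.
  have -> : l = p%:~R / q%:R by rewrite -ql mulrC mulKf.
  exists (p%:~R / q%:R + k%:~R) => //.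
  by rewrite rmorphD rmorph_int fmorph_div /= rmorph_int ratr_nat.
(* Without a limit, [lim] is the default value [point], which is [0]. *)
exists l => //; apply: contrapT => ncv.
have : l = point by rewrite /l dvgP//; apply: contra_not ncv => /cvgP.
move=> l0; have := not_rat 1%N 0 isT; rewrite mul1r l0.
by rewrite eqxx.
Qed.

End MulticriticalLift.

(** * Measures on the circle and their distribution functions *)

Section BoundedMeasurable.
Context d (T : measurableType d) (R : realType) (P : probability T R).
Implicit Types g : T -> R.

Definition bounded_measurable g :=
  measurable_fun setT g /\ exists M : R, forall x, `|g x| <= M.

Lemma bounded_measurable_integrable g : bounded_measurable g ->
  P.-integrable setT (EFin \o g).
Proof.
move=> [mg [M gM]]; apply: measurable_bounded_integrable => //.
  by apply: le_lt_trans (probability_le1 P measurableT) _; exact: ltry.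
by exists M; split => [|y My x _]; [exact: num_real | exact: le_trans (gM x) (ltW My)].
Qed.

Lemma bounded_measurableB g1 g2 : bounded_measurable g1 ->
  bounded_measurable g2 -> bounded_measurable (fun x => g1 x - g2 x).
Proof.
move=> [m1 [M1 h1]] [m2 [M2 h2]]; split; first exact: measurable_funB.
by exists (M1 + M2) => x; apply: (le_trans (ler_normB _ _)); exact: lerD.
Qed.

Lemma bounded_measurableM g1 g2 : bounded_measurable g1 ->
  bounded_measurable g2 -> bounded_measurable (fun x => g1 x * g2 x).
Proof.
move=> [m1 [M1 h1]] [m2 [M2 h2]]; split; first exact: measurable_funM.
by exists (M1 * M2) => x; rewrite normrM ler_pM.
Qed.

Lemma bounded_measurable_cst (r : R) : bounded_measurable (fun _ => r).
Proof. by split; [exact: measurable_cst | exists `|r|]. Qed.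

Lemma Rintegral_le g1 g2 : bounded_measurable g1 -> bounded_measurable g2 ->
  (forall x, g1 x <= g2 x) -> \int[P]_x g1 x <= \int[P]_x g2 x.
Proof.
by move=> b1 b2 h; apply: le_Rintegral => //; exact: bounded_measurable_integrable.
Qed.

Lemma Rintegral_sub g1 g2 : bounded_measurable g1 -> bounded_measurable g2 ->
  \int[P]_x (g1 x - g2 x) = \int[P]_x g1 x - \int[P]_x g2 x.
Proof.
by move=> b1 b2; apply: RintegralB => //; exact: bounded_measurable_integrable.
Qed.

Lemma Rintegral_scale g (r : R) : bounded_measurable g ->
  \int[P]_x (r * g x) = r * \int[P]_x g x.
Proof.
by move=> b; apply: RintegralZl => //; exact: bounded_measurable_integrable.
Qed.

Lemma Rintegral_const (r : R) : \int[P]_x r = r.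
Proof.
rewrite Rintegral_cst// [X in fine X](_ : _ = 1%E) ?mulr1//.
exact: probability_setT.
Qed.

Lemma Rintegral_cvg (g_ : nat -> T -> R) g (M : R) :
  (forall n, measurable_fun setT (g_ n)) -> measurable_fun setT g ->
  (forall n x, `|g_ n x| <= M) -> (forall x, g_ n x @[n --> \oo] --> g x) ->
  \int[P]_x g_ n x @[n --> \oo] --> \int[P]_x g x.
Proof.
move=> mg_ mg gM gg.
have mgE : measurable_fun setT (EFin \o g) by exact/measurable_EFinP.
have iM : P.-integrable setT (EFin \o (fun _ => M)).
  exact/bounded_measurable_integrable/bounded_measurable_cst.
have h1 n : measurable_fun setT (EFin \o g_ n) by exact/measurable_EFinP.
have h2 : {ae P, forall x, setT x -> (EFin \o g_ n) x @[n --> \oo] --> (EFin \o g) x}.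
  by apply: aeW => x _; apply: cvg_EFin; [exact: nearW | exact: gg].
have h3 : {ae P, forall x n, setT x -> (`|(EFin \o g_ n) x| <= (EFin \o (fun _ => M)) x)%E}.
  by apply: aeW => x n _; rewrite /= lee_fin.
have [ig _ cv] := @dominated_convergence _ _ _ P setT measurableT
  (fun n => EFin \o g_ n) (EFin \o g) (EFin \o (fun _ => M)) h1 mgE h2 iM h3.
have fg : (\int[P]_x (g x)%:E)%E \is a fin_num by exact: integrable_fin_num.
by apply: fine_cvg; rewrite fineK//; exact: cv.
Qed.

Lemma weighted_mean (a k : T -> R) (c e : R) :
  bounded_measurable a -> bounded_measurable k -> (forall x, 0 <= a x) ->
  (forall x, 0 < a x -> `|k x - c| <= e) ->
  `|\int[P]_x (a x * k x) - c * \int[P]_x a x| <= e * \int[P]_x a x.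
Proof.
move=> ab kb a0 kc.
have akb : bounded_measurable (fun x => a x * k x) by exact: bounded_measurableM.
have scaled (r : R) : bounded_measurable (fun x => r * a x).
  by apply: bounded_measurableM => //; exact: bounded_measurable_cst.
have akc x : `|a x * k x - c * a x| <= e * a x.
  have := a0 x; rewrite le_eqVlt => /predU1P[<-|ax].
    by rewrite mul0r !mulr0 subrr normr0.
  rewrite [c * _]mulrC -mulrBr normrM gtr0_norm// mulrC.
  by rewrite ler_wpM2r ?(ltW ax)// kc.
rewrite -!Rintegral_scale// -Rintegral_sub// ler_norml.
rewrite lerNl -[- Rintegral _ _ _]mulN1r -Rintegral_scale//; last exact: bounded_measurableB.
apply/andP; split.
all: apply: Rintegral_le => //; try by [exact: bounded_measurableB].
- apply: bounded_measurableM; first exact: bounded_measurable_cst.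
  exact: bounded_measurableB.
- by move=> x; have := akc x; rewrite ler_norml => /andP[]; lra.
- by move=> x; have := akc x; rewrite ler_norml => /andP[]; lra.
Qed.

End BoundedMeasurable.

Section CircleMeasurable.
Variable R : realType.

Lemma circle_continuous_measurable (phi : circle R -> R) : continuous phi ->
  measurable_fun setT (phi : borel_circle R -> R).
Proof.
move=> /continuousP phic; apply: (measurability _ (RGenOpens.measurableE R)).
move=> _ [_ [a [b ->]] <-]; rewrite setTI; apply: sub_sigma_algebra.
by apply: phic; exact: interval_open.
Qed.

Lemma circle_continuous_bounded (phi : circle R -> R) : continuous phi ->
  exists M : R, forall x, `|phi x| <= M.
Proof.
move=> /circle_continuous phic.
have [||x0 h] := @periodic_min R (fun x => - `|phi (circle_pi x)|).
- by move=> x; apply: cvgN; apply: cvg_norm; exact: phic.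
- by move=> x; rewrite addr0 -[1]/(1%:~R) circle_pi_shift.
exists `|phi (circle_pi x0)| => x; rewrite -(circle_reprK x).
by have := h (repr x); rewrite lerN2.
Qed.

Lemma circle_continuous_bm (phi : circle R -> R) : continuous phi ->
  bounded_measurable (phi : borel_circle R -> R).
Proof.
move=> phic; split; first exact: circle_continuous_measurable.
exact: circle_continuous_bounded.
Qed.

Definition floorR (z : R) : R := (Num.floor z)%:~R.

Lemma floorR_le z : floorR z <= z. Proof. exact: floor_le. Qed.

Lemma floorR_gt z : z < floorR z + 1.
Proof. by have := floorD1_gt z; rewrite intrD. Qed.

Lemma floorR_nd : {homo floorR : x y / x <= y}.
Proof. by move=> x y xy; rewrite ler_int le_floor. Qed.

Lemma floorR_shift (k : int) z : floorR (z + k%:~R) = floorR z + k%:~R.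
Proof. by rewrite /floorR floorDrz ?intr_int// intrKfloor intrD. Qed.

Lemma floorR_lt x y : floorR x != floorR y -> x <= y -> floorR x + 1 <= floorR y.
Proof.
move=> xy /floorR_nd; rewrite le_eqVlt (negbTE xy) /= /floorR ltr_int => lt.
by rewrite -[1]/(1%:~R) -intrD ler_int lezD1.
Qed.

(* A continuous minorant of [floorR], at distance [e] to its right. *)
Definition ramp (e z : R) : R := floorR z - 1 + Num.min 1 ((z - floorR z) / e).

Lemma ramp_shift e (k : int) z : ramp e (z + k%:~R) = ramp e z + k%:~R.
Proof.
rewrite /ramp floorR_shift (_ : z + k%:~R - _ = z - floorR z); ring.
Qed.

Section Ramp.
Variable e : R.
Hypothesis e01 : 0 < e <= 1.

Let e0 : 0 < e. Proof. by case/andP: e01. Qed.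
Let frac_ge0 z : 0 <= (z - floorR z) / e.
Proof. by rewrite divr_ge0 ?(ltW e0)// subr_ge0 floorR_le. Qed.

Lemma ramp_le z : ramp e z <= floorR z.
Proof.
have : Num.min 1 ((z - floorR z) / e) <= 1 by rewrite ge_min lexx.
by rewrite /ramp; lra.
Qed.

Let ramp_ge1 z : floorR z - 1 <= ramp e z.
Proof. by rewrite /ramp lerDl le_min ler01 frac_ge0. Qed.

Lemma ramp_ge z : floorR (z - e) <= ramp e z.
Proof.
have [h|h] := leP e (z - floorR z).
  rewrite /ramp min_l; last by rewrite ler_pdivlMr// mul1r.
  by rewrite subrK; apply: floorR_nd; rewrite gerBl ltW.
apply: le_trans (ramp_ge1 z).
have : floorR (z - e) != floorR z.
  by apply/eqP => fE; have := floorR_le (z - e); rewrite fE; lra.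
move=> /floorR_lt; have : z - e <= z by rewrite gerBl ltW.
by move=> ze /(_ ze); lra.
Qed.

Lemma ramp_lipschitz x y : x <= y -> 0 <= ramp e y - ramp e x <= (y - x) / e.
Proof.
move=> xy; have le_e r : 0 <= r -> r <= r / e.
  move=> r0; rewrite ler_pdivlMr// ler_piMr//; by case/andP: e01.
have [fE|/floorR_lt/(_ xy) flt] := eqVneq (floorR x) (floorR y).
  rewrite /ramp fE; set n := floorR y.
  have u : (x - n) / e <= (y - n) / e by rewrite ler_pM2r ?invr_gt0// lerD2r.
  have E : (y - x) / e = (y - n) / e - (x - n) / e by ring.
  have yx0 : 0 <= (y - x) / e by rewrite divr_ge0 ?(ltW e0)// subr_ge0.
  by case: (leP 1 ((x - n) / e)); case: (leP 1 ((y - n) / e)); lra.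
have h1 := ramp_le x; have h2 := ramp_ge1 y.
apply/andP; split; first lra.
have xf := floorR_gt x; have yf := floorR_le y.
have my : Num.min 1 ((y - floorR y) / e) <= (y - floorR y) / e.
  by rewrite ge_min lexx orbT.
have E : (y - x) / e = (y - floorR y) / e - (x - floorR x) / e + (floorR y - floorR x) / e by ring.
have d1 : floorR y - floorR x <= (floorR y - floorR x) / e by apply: le_e; lra.
rewrite {1}/ramp; have [h|h] := leP 1 ((x - floorR x) / e); last first.
  by rewrite /ramp (min_r (ltW h)); lra.
rewrite /ramp (min_l h).
have d2 : floorR y - floorR x - 1 <= (floorR y - floorR x - 1) / e by apply: le_e; lra.
have d3 : (x - floorR x) / e <= 1 / e by rewrite ler_pM2r ?invr_gt0//; lra.
have E2 : (floorR y - floorR x - 1) / e = (floorR y - floorR x) / e - 1 / e by ring.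
lra.
Qed.

Lemma ramp_nd : {homo ramp e : x y / x <= y}.
Proof. by move=> x y /ramp_lipschitz/andP[]; rewrite subr_ge0. Qed.

Lemma ramp_continuous : continuous (ramp e).
Proof.
move=> x; apply/cvgrPdist_le => r r0; near=> y.
have yx : `|x - y| <= r * e.
  near: y; apply/nbhs_ballP; exists (r * e) => /=; first by rewrite mulr_gt0.
  by move=> y /= /ltW.
have [xy|yx'] := leP x y.
  have /andP[h1 h2] := ramp_lipschitz xy.
  rewrite distrC ger0_norm//; apply: (le_trans h2); rewrite ler_pdivrMr//.
  by rewrite distrC ger0_norm in yx; rewrite ?subr_ge0.
have /andP[h1 h2] := ramp_lipschitz (ltW yx').
rewrite ger0_norm//; apply: (le_trans h2); rewrite ler_pdivrMr//.
by move: yx; rewrite ger0_norm ?subr_ge0 ?(ltW yx').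
Unshelve. all: end_near. Qed.

End Ramp.

(* [arc q - arc p] counts the representatives of a point in [(p, q]]. *)
Definition arc (q : R) (x : circle R) : R := floorR (q - repr x) + repr x.

(** The shift by [e] puts this continuous function between [arc q] and [arc (q + e)], so that
    invariance, known for continuous functions only, reaches half-open arcs. *)
Definition soft_arc (e q : R) (x : circle R) : R :=
  ramp e (q + e - repr x) + repr x.

Let arc_periodic q (k : int) y : floorR (q - (y + k%:~R)) + (y + k%:~R) = floorR (q - y) + y.
Proof.
have -> : q - (y + k%:~R) = (q - y) + (- k)%:~R by rewrite mulrNz; ring.
by rewrite floorR_shift mulrNz; ring.
Qed.

Lemma arc_pi q y : arc q (circle_pi y) = floorR (q - y) + y.
Proof. exact: (@repr_pi _ _ (fun y => floorR (q - y) + y) y (arc_periodic q)). Qed.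

Let soft_arc_periodic e q (k : int) y :
  ramp e (q + e - (y + k%:~R)) + (y + k%:~R) = ramp e (q + e - y) + y.
Proof.
have -> : q + e - (y + k%:~R) = (q + e - y) + (- k)%:~R by rewrite mulrNz; ring.
by rewrite ramp_shift mulrNz; ring.
Qed.

Lemma soft_arc_continuous e q : 0 < e <= 1 -> continuous (soft_arc e q).
Proof.
move=> e01.
apply: (periodic_circle_continuous (g := fun y => ramp e (q + e - y) + y)); last first.
  exact: soft_arc_periodic.
move=> y; apply: cvgD; last exact: cvg_id.
apply: (@continuous_comp _ _ _ (fun y => q + e - y) (ramp e)); last exact: ramp_continuous.
by apply: cvgB; [exact: cvg_cst | exact: cvg_id].
Qed.

Lemma arc_nd x : {homo arc ^~ x : p q / p <= q}.
Proof. by move=> p q pq; rewrite lerD2r floorR_nd// lerD2r. Qed.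

Lemma arc_bounds q x : q - 1 <= arc q x <= q.
Proof. by have := floorR_le (q - repr x); have := floorR_gt (q - repr x); rewrite /arc; lra. Qed.

Lemma soft_arc_bounds e q x : 0 < e <= 1 -> arc q x <= soft_arc e q x <= arc (q + e) x.
Proof.
move=> e01; rewrite !lerD2r ramp_le// andbT; apply: le_trans (ramp_ge e01 _).
by apply: floorR_nd; lra.
Qed.

Lemma arc_right_cvg (q : R) (x : circle R) (u : nat -> R) :
  (forall n, q <= u n <= q + n.+1%:R^-1) -> arc (u n) x @[n --> \oo] --> arc q x.
Proof.
move=> qu; apply: cvg_near_cst.
have d0 : 0 < floorR (q - repr x) + 1 - (q - repr x) by rewrite subr_gt0 floorR_gt.
have := @cvg_harmonic R => /cvgrPdist_lt/(_ _ d0); apply: filterS => n /=.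
rewrite sub0r normrN gtr0_norm ?invr_gt0// => nd.
have /andP[u1 u2] := qu n.
congr (_ + _); apply/eqP; rewrite /floorR eqr_int.
by rewrite floor_eq intrD; have := floorR_le (q - repr x); rewrite /floorR in nd *;
  move: (n.+1%:R^-1) u2 nd => r u2 nd; lra.
Qed.

Lemma arc_measurable q : measurable_fun setT (arc q : borel_circle R -> R).
Proof.
have h n : 0 < (n.+1%:R^-1 : R) <= 1 by rewrite invr_gt0 ltr0n /= invf_le1// ler1n.
apply: (@measurable_fun_cvg _ (borel_circle R) R setT
  (fun n => soft_arc n.+1%:R^-1 q) (arc q)).
  by move=> n; apply: circle_continuous_measurable; exact: soft_arc_continuous.
move=> x _; apply: (@squeeze_cvgr _ _ _ _ (fun=> arc q x) (fun n => arc (q + n.+1%:R^-1) x)).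
- by apply: nearW => n; exact: soft_arc_bounds.
- exact: cvg_cst.
- by apply: arc_right_cvg => n; rewrite lexx andbT lerDl ltW//; case/andP: (h n).
Qed.

Lemma arc_bm q : bounded_measurable (arc q : borel_circle R -> R).
Proof.
split; first exact: arc_measurable.
exists (`|q| + 1) => x; have := arc_bounds q x.
have := ler_norm q; have := ler_norm (- q); rewrite normrN ler_norml; lra.
Qed.

End CircleMeasurable.

Lemma powR_continuous (R : realType) (dF : R -> R) (t : R) : 0 < t ->
  continuous dF -> (forall x, 0 <= dF x) -> continuous (fun x => dF x `^ t).
Proof.
move=> t0 dFc dF0 z; have := dF0 z; rewrite le_eqVlt => /predU1P[z0|z0].
  rewrite /continuous_at -z0 powR0 ?gt_eqF//; apply/cvgrPdist_lt => e e0; near=> y.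
  rewrite sub0r normrN ger0_norm ?powR_ge0//.
  have -> : e = (e `^ t^-1) `^ t by rewrite -powRrM mulVf ?gt_eqF// powRr1// ltW.
  apply: gt0_ltr_powR; rewrite ?nnegrE ?powR_ge0//.
  near: y; have /cvgrPdist_lt/(_ (e `^ t^-1)) := dFc z.
  rewrite powR_gt0// => /(_ isT); apply: filterS => y.
  by rewrite -z0 sub0r normrN ger0_norm.
apply: (@continuous_comp _ _ _ dF (fun y => y `^ t)); first exact: dFc.
apply: differentiable_continuous; apply/derivable1_diffP.
by have [] := is_derive1_powR t z0.
Unshelve. all: end_near. Qed.

Section ArcDynamics.
Variable R : realType.
Variable f : circle R -> circle R.
Hypothesis hf : multicritical f.
Let F := lift f.
Let g := pinv setT f.

Lemma homeo_inverse : [/\ cancel f g, cancel g f & continuous g].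
Proof.
have [[[g' [fK g'K _ g'c]] _] _ _ _ _] := hf.
have inj : {in setT &, injective f} by move=> x y _ _; exact: (can_inj fK).
have fg : cancel f g by move=> x; apply: pinvKV => //; rewrite inE.
have gE : g = g' by apply/funext => x; rewrite -{1}(g'K x) fg.
by split => //; rewrite gE.
Qed.

Lemma floorR_lift u v : floorR (F u - F v) = floorR (u - v).
Proof.
have F_nd := ltW_homo (lift_increasing hf); have Fk := degree_oneD (lift_degree_one hf).
rewrite /floorR; congr (_%:~R); apply/eqP; rewrite floor_eq intrD.
have h1 := floorR_le (u - v); have h2 := floorR_gt (u - v).
rewrite /floorR in h1 h2; set n := Num.floor _ in h1 h2 *.
have a1 : v + n%:~R <= u by lra.
have a2 : u < v + (n + 1)%:~R by rewrite intrD; lra.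
have := F_nd _ _ a1; have := lift_increasing hf a2.
by rewrite /F !Fk !mulr1 intrD; lra.
Qed.

(** The lift maps the representatives of [g x] in [(p, q]] onto those of [x] in [(F p, F q]]. Hence
    [mass nu \o F] is a distribution function of the image of [nu] under [g]. *)
Lemma arc_lift p q x : arc (F q) x - arc (F p) x = arc q (g x) - arc p (g x).
Proof.
have [_ gK _] := homeo_inverse.
have -> : x = circle_pi (F (repr (g x))) by rewrite /F pi_lift// circle_reprK gK.
rewrite !arc_pi !floorR_lift /F pi_lift// circle_reprK gK /arc; ring.
Qed.

Lemma arc_hit p q (x : circle R) : arc p x < arc q x ->
  exists2 y, p < y <= q & circle_pi y = x.
Proof.
(* [arc q x] is itself a representative of [x], the largest one that is at most [q]. *)
move=> h; exists (arc q x); last first.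
  by rewrite /arc addrC /floorR circle_pi_shift circle_reprK.
have /andP[_ ->] := arc_bounds q x; rewrite andbT.
have ne : floorR (p - repr x) != floorR (q - repr x).
  by apply/eqP => e; move: h; rewrite /arc e ltxx.
have pq : p - repr x <= q - repr x.
  by rewrite leNgt; apply/negP => /ltW/floorR_nd; move: h; rewrite /arc; lra.
have := floorR_lt ne pq; have := floorR_gt (p - repr x); rewrite /arc; lra.
Qed.

End ArcDynamics.

Section Mass.
Variable R : realType.
Variable nu : probability (borel_circle R) R.

(** Up to a constant, the distribution function of the periodic lift of [nu] to the line. *)
Definition mass (q : R) : R := \int[nu]_x arc q x.

Lemma massB p q : mass q - mass p = \int[nu]_x (arc q x - arc p x).
Proof. by rewrite Rintegral_sub//; exact: arc_bm. Qed.

Lemma mass_nd : {homo mass : x y / x <= y}.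
Proof.
by move=> p q pq; apply: Rintegral_le => [||x]; [exact: arc_bm..|exact: arc_nd].
Qed.

Lemma mass_degree_one : degree_one 1 mass.
Proof.
move=> q; suff : mass (q + 1) - mass q = 1 by lra.
rewrite massB -[RHS](Rintegral_const nu 1); congr (fine _).
apply: eq_integral => x _; congr EFin; rewrite /arc.
have -> : q + 1 - repr x = q - repr x + 1%:~R by ring.
by rewrite floorR_shift; ring.
Qed.

Lemma mass_right_cont : right_cont mass.
Proof.
move=> q e e0.
have h : mass (q + n.+1%:R^-1) @[n --> \oo] --> mass q.
  apply: (@Rintegral_cvg _ _ _ nu (fun n => arc (q + n.+1%:R^-1)) _ (`|q| + 2)).
  - by move=> n; exact: arc_measurable.
  - exact: arc_measurable.
  - move=> n x; have := arc_bounds (q + n.+1%:R^-1) x.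
    have : 0 < (n.+1%:R^-1 : R) <= 1 by rewrite invr_gt0 ltr0n /= invf_le1// ler1n.
    have := ler_norm q; have := ler_norm (- q); rewrite normrN ler_norml.
    move: (n.+1%:R^-1) => r; lra.
  - by move=> x; apply: arc_right_cvg => n; rewrite lexx lerDl invr_ge0 ler0n.
have /cvgrPdist_lt/(_ _ e0)[n _ /(_ n (leqnn n))] := h.
rewrite /= ltr_norml => /andP[h1 _]; exists n.+1%:R^-1; first by rewrite invr_gt0.
by lra.
Qed.

End Mass.

(** * From [s]-measures to conformal distribution functions *)

Section SMeasureMass.
Variable R : realType.
Variable f : circle R -> circle R.
Hypothesis hf : multicritical f.
Variable s : R.
Hypothesis hs : s < 0.
Let F := lift f.
Let g := pinv setT f.
Let w x := dlift f x `^ (- s).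
Let W (x : circle R) := circle_derive f x `^ (- s).

Let t0 : 0 < - s. Proof. by rewrite oppr_gt0. Qed.

Let dF_ge0' x : 0 <= dlift f x.
Proof. exact: dF_ge0 (lift_increasing hf) (lift_is_derive hf) x. Qed.

Lemma weight_continuous : continuous (fun x => dlift f x `^ (- s)).
Proof. by apply: powR_continuous => //; exact: dlift_continuous. Qed.

Lemma circle_weight_continuous : continuous (fun x => circle_derive f x `^ (- s)).
Proof.
apply: (@periodic_circle_continuous R w); first exact: weight_continuous.
by move=> k y; rewrite /w dlift_shift.
Qed.

Lemma circle_weight_pi x :
  circle_derive f (circle_pi x) `^ (- s) = dlift f x `^ (- s).
Proof. by rewrite circle_derive_pi. Qed.

Lemma transfer_bm (phi : circle R -> R) : continuous phi ->
  bounded_measurable ((fun x => circle_derive f (pinv setT f x) `^ (- s) *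
    phi (pinv setT f x)) : borel_circle R -> R).
Proof.
have [_ _ gc] := homeo_inverse hf.
move=> phic; apply: bounded_measurableM; apply: circle_continuous_bm.
  by move=> x; apply: (@continuous_comp _ _ _ g W); [exact: gc|exact: circle_weight_continuous].
by move=> x; apply: (@continuous_comp _ _ _ g phi); [exact: gc|exact: phic].
Qed.

Section Invariant.
Variable nu : probability (borel_circle R) R.

Lemma mass_lift p q : mass nu (lift f q) - mass nu (lift f p) =
  \int[nu]_x (arc q (pinv setT f x) - arc p (pinv setT f x)).
Proof.
by rewrite massB; congr fine; apply: eq_integral => x _; congr EFin; exact: arc_lift.
Qed.

Lemma arcB_pinv_bm p q :
  bounded_measurable ((fun x => arc q (pinv setT f x) - arc p (pinv setT f x)) :
    borel_circle R -> R).
Proof.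
rewrite (_ : (fun x => _) = fun x => arc (F q) x - arc (F p) x); last first.
  by apply/funext => x; rewrite /F arc_lift.
by apply: bounded_measurableB; exact: arc_bm.
Qed.

Hypothesis nu_s : s_measure f s nu.

Let transfer (phi : circle R -> R) : continuous phi ->
  \int[nu]_x phi x = \int[nu]_x (W (g x) * phi (g x)).
Proof. by move=> phic; congr fine; exact: nu_s. Qed.

(** Invariance is tested on a difference of two soft arcs, which lies between the counts of a
    smaller and a larger arc with endpoints moved by [eta]; on the larger one the weight is between
    [c] and [C]. *)
Let local_bounds (p q eta c C : R) : 0 < eta <= 1 -> p + eta < q -> 0 <= c ->
  (forall y, p < y <= q + eta -> c <= w y <= C) ->
  mass nu q - mass nu (p + eta) <= C * (mass nu (F (q + eta)) - mass nu (F p)) /\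
  c * (mass nu (F q) - mass nu (F (p + eta))) <= mass nu (q + eta) - mass nu p.
Proof.
move=> eta1 pq c0 cC.
pose Phi x := soft_arc eta q x - soft_arc eta p x.
have Phi_c : continuous Phi.
  move=> x; exact: (cvgB (@soft_arc_continuous R eta q eta1 x) (@soft_arc_continuous R eta p eta1 x)).
have Phi_ge0 x : 0 <= Phi x.
  rewrite subr_ge0 lerD2r; apply: ramp_nd => //; lra.
have Phi_le x : Phi x <= arc (q + eta) x - arc p x.
  have := soft_arc_bounds q x eta1; have := soft_arc_bounds p x eta1; rewrite /Phi; lra.
have Phi_ge x : arc q x - arc (p + eta) x <= Phi x.
  have := soft_arc_bounds q x eta1; have := soft_arc_bounds p x eta1; rewrite /Phi; lra.
have WPhi x : c * Phi x <= W x * Phi x <= C * Phi x.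
  have := Phi_ge0 x; rewrite le_eqVlt => /predU1P[<-|Phi0]; first by rewrite !mulr0 lexx.
  have [|y yI <-] := @arc_hit R p (q + eta) x.
    by have := Phi_le x; rewrite -subr_gt0; exact: lt_le_trans.
  have /andP[h1 h2] := cC y yI.
  by rewrite /W circle_weight_pi -/(w y) !ler_wpM2r.
have [_ _ gc] := homeo_inverse hf.
have Phib : bounded_measurable (Phi : borel_circle R -> R) by exact: circle_continuous_bm.
have Phigb : bounded_measurable ((Phi \o g) : borel_circle R -> R).
  apply: circle_continuous_bm => x.
  by apply: (@continuous_comp _ _ _ g Phi); [exact: gc|exact: Phi_c].
have WPhib := transfer_bm Phi_c.
have scaled (r : R) h : bounded_measurable (h : borel_circle R -> R) ->
    bounded_measurable ((fun x => r * h x) : borel_circle R -> R).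
  by apply: bounded_measurableM; exact: bounded_measurable_cst.
have C0 : 0 <= C.
  have /andP[h1 h2] : c <= w q <= C by apply: cC; apply/andP; lra.
  exact: le_trans (le_trans c0 h1) h2.
have arcsg := arcB_pinv_bm.
have arcsb p' q' : bounded_measurable ((fun x => arc q' x - arc p' x) : borel_circle R -> R).
  by apply: bounded_measurableB; exact: arc_bm.
split.
  rewrite massB mass_lift -Rintegral_scale//.
  apply: (@le_trans _ _ (\int[nu]_x Phi x)); first exact: Rintegral_le.
  rewrite transfer//; apply: Rintegral_le => //; first exact: scaled.
  move=> x; have /andP[_ h] := WPhi (g x); apply: (le_trans h); exact: ler_wpM2l.
rewrite mass_lift massB -Rintegral_scale//.
apply: (@le_trans _ _ (\int[nu]_x Phi x)); last exact: Rintegral_le.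
rewrite [leRHS]transfer//; apply: Rintegral_le => //; first exact: scaled.
move=> x; have /andP[h _] := WPhi (g x); apply: le_trans h; exact: ler_wpM2l.
Qed.

Let perturb_upper (C r a b b' x x' y : R) : 0 <= C -> a - b' <= C * (x' - y) ->
  b' <= b + r -> x' <= x + r -> a - b <= C * (x - y) + (C + 1) * r.
Proof. by move=> C0 h1 h2 /(ler_wpM2l C0); lra. Qed.

Let perturb_lower (c r a a' b x y y' : R) : 0 <= c -> c * (x - y') <= a' - b ->
  a' <= a + r -> y' <= y + r -> c * (x - y) <= a - b + (c + 1) * r.
Proof. by move=> c0 h1 h2 /(ler_wpM2l c0); lra. Qed.

Let H := mass nu.
Let mass_small x e : 0 < e -> exists2 d : R, 0 < d &
  forall eta, 0 < eta <= d -> H (x + eta) <= H x + e.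
Proof.
move=> e0; have [d d0 h] := mass_right_cont nu x e0; exists d => // eta /andP[_ ed].
by apply: le_trans (ltW h); apply: mass_nd; rewrite lerD2l.
Qed.

Let mass_lift_small x e : 0 < e -> exists2 d : R, 0 < d &
  forall eta, 0 < eta <= d -> H (F (x + eta)) <= H (F x) + e.
Proof.
move=> e0; have [d d0 h] := mass_right_cont nu (F x) e0.
have := lift_continuous hf (x := x); move=> /cvgrPdist_lt/(_ _ d0)/nbhs_ballP[r /= r0 hr].
exists (r / 2) => [|eta /andP[eta0 er]]; first by rewrite divr_gt0.
apply: le_trans (ltW h); apply: mass_nd.
have := hr (x + eta); rewrite /ball /= opprD addrA subrr sub0r normrN.
rewrite gtr0_norm// ltr_norml => hx.
have /andP[h1 _] : - d < F x - F (x + eta) < d by apply: hx; lra.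
lra.
Qed.

Lemma mass_has_density :
  has_density (fun x => dlift f x `^ (- s)) (mass nu) (mass nu \o lift f).
Proof.
have F_nd := ltW_homo (lift_increasing hf).
exists (H \o F) => [x y xy /=|z e e0]; first by apply/mass_nd/F_nd.
have /cvgrPdist_lt/(_ _ e0)/nbhs_ballP[d /= d0 hd] := @weight_continuous z.
exists d => // p q /andP[pz zq] dp dq.
rewrite -/(w z) /= -/H -/F; have w0 y : 0 <= w y by exact: powR_ge0.
have := le_trans pz zq; rewrite le_eqVlt => /predU1P[->|pq].
  by rewrite !subrr !mulr0 subrr normr0.
have dHF0 : 0 <= H (F q) - H (F p) by rewrite subr_ge0; apply/mass_nd/F_nd/ltW.
(* Truncation at 0 allows inequalities to be multiplied by [c]; it stays below the weight, which is
   nonnegative. *)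
pose c := Num.max 0 (w z - e); pose C := w z + e.
have c0 : 0 <= c by rewrite le_max lexx.
have C0 : 0 <= C by rewrite /C addr_ge0// ltW.
(* [r] is the cost of moving the endpoints by [eta]; right continuity of the mass, at the endpoints
   and at their images, makes it arbitrarily small. *)
suff bounds r : 0 < r ->
    H q - H p <= C * (H (F q) - H (F p)) + (C + 1) * r /\
    c * (H (F q) - H (F p)) <= H q - H p + (c + 1) * r.
  have up : H q - H p <= C * (H (F q) - H (F p)).
    apply/ler_addgt0Pr => r r0; have r1 : 0 < r / (C + 1) by rewrite divr_gt0// ltr_wpDl.
    by have [+ _] := bounds _ r1; rewrite [(C + 1) * _]mulrC divfK// gt_eqF// ltr_wpDl.
  have lo : c * (H (F q) - H (F p)) <= H q - H p.
    apply/ler_addgt0Pr => r r0; have r1 : 0 < r / (c + 1) by rewrite divr_gt0// ltr_wpDl.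
    by have [_ +] := bounds _ r1; rewrite [(c + 1) * _]mulrC divfK// gt_eqF// ltr_wpDl.
  have lo' : (w z - e) * (H (F q) - H (F p)) <= c * (H (F q) - H (F p)).
    by rewrite ler_wpM2r// le_max lexx orbT.
  by rewrite ler_norml /=; apply/andP; move: up lo lo'; rewrite /C; lra.
move=> r0.
have [d1 d10 h1] := mass_small p r0; have [d2 d20 h2] := mass_small q r0.
have [d3 d30 h3] := mass_lift_small p r0; have [d4 d40 h4] := mass_lift_small q r0.
pose eta := Num.min (Num.min (Num.min d1 d2) (Num.min d3 d4))
  (Num.min 1 (Num.min ((q - p) / 2) ((z + d - q) / 2))).
have : 0 < eta by rewrite !lt_min d10 d20 d30 d40 ltr01 !divr_gt0// subr_gt0.
have : eta <= eta by [].
rewrite {2}/eta !le_min => /andP[/andP[/andP[e1 e2] /andP[e3 e4]] /andP[e5 /andP[e6 e7]]] eta0.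
clearbody eta.
have wy y : p < y <= q + eta -> c <= w y <= C.
  move=> /andP[y1 y2].
  have : `|w z - w y| < e.
    by apply: hd; rewrite /ball /= ltr_norml; apply/andP; lra.
  rewrite ltr_norml /C /c ge_max w0 /= => /andP[l1 l2].
  have l3 : w z - e <= w y by rewrite lerBlDr -lerBlDl ltW.
  have l4 : w y <= w z + e by rewrite -lerBlDl -opprB lerNl ltW.
  by rewrite l3 l4.
have eta1 : 0 < eta <= 1 by rewrite eta0.
have pq' : p + eta < q by lra.
have [b1 b2] := local_bounds eta1 pq' c0 wy.
have i1 := h1 eta; have i2 := h2 eta; have i3 := h3 eta; have i4 := h4 eta.
rewrite eta0 e1 in i1; rewrite eta0 e2 in i2; rewrite eta0 e3 in i3; rewrite eta0 e4 in i4.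
have {}i1 := i1 isT; have {}i2 := i2 isT; have {}i3 := i3 isT; have {}i4 := i4 isT.
rewrite -/H in b1 b2; clearbody c C.
split; [exact: perturb_upper C0 b1 i1 i4|exact: perturb_lower c0 b2 i2 i3].
Qed.

Lemma mass_conformal : conformal (lift f) (dlift f) (- s) 1 (mass nu).
Proof.
split; [exact: mass_nd|exact: mass_degree_one|exact: mass_right_cont|].
exact: mass_has_density.
Qed.

End Invariant.
End SMeasureMass.

(** With density 0 the reference function can be replaced by 0, which is nondecreasing, so that
    [has_density_le] applies both to [H] and to its opposite. *)
Lemma has_density0 (R : realType) (H G : R -> R) : has_density (fun=> 0) H G ->
  forall u v, u <= v -> H u = H v.
Proof.
move=> [D D_nd dens] u v uv.
have dens0 : has_density (fun=> 0) H (fun=> 0).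
  exists D => // z e e0; have [d d0 h] := dens z e e0; exists d => // p q pz dp dq.
  by have := h p q pz dp dq; rewrite !mul0r.
have densN : has_density (fun=> 0) (fun x => - H x) (fun=> 0).
  exists D => // z e e0; have [d d0 h] := dens z e e0; exists d => // p q pz dp dq.
  by have := h p q pz dp dq; rewrite !mul0r !subr0 -normrN opprB opprK addrC.
have zero_nd : {homo (fun _ : R => 0 : R) : x y / x <= y} by [].
have := has_density_le dens0 zero_nd uv (M := 0) (fun z _ => lexx 0).
have := has_density_le densN zero_nd uv (M := 0) (fun z _ => lexx 0).
lra.
Qed.

(** * From conformal distribution functions to [s]-measures *)

Section SMeasureOfMass.
Variable R : realType.
Variable f : circle R -> circle R.
Hypothesis hf : multicritical f.
Variable s : R.
Hypothesis hs : s < 0.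
Let F := lift f.
Let g := pinv setT f.
Let w x := dlift f x `^ (- s).
Let W (x : circle R) := circle_derive f x `^ (- s).

Variable nu : probability (borel_circle R) R.
Hypothesis nu_dens : has_density w (mass nu) (mass nu \o F).

Section Test.
Variable phi : circle R -> R.
Hypothesis phi_c : continuous phi.
Let psi x := W (g x) * phi (g x).
Let X v := \int[nu]_x (arc v x * phi x).
Let Y v := \int[nu]_x (arc (F v) x * psi x).

Let phib : bounded_measurable (phi : borel_circle R -> R).
Proof. exact: circle_continuous_bm. Qed.

Let psib : bounded_measurable (psi : borel_circle R -> R).
Proof. exact: transfer_bm. Qed.

Let XB p q : X q - X p = \int[nu]_x ((arc q x - arc p x) * phi x).
Proof.
rewrite /X -Rintegral_sub; [|by apply: bounded_measurableM => //; exact: arc_bm..].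
by congr fine; apply: eq_integral => x _; rewrite mulrBl.
Qed.

Let YB p q : Y q - Y p = \int[nu]_x ((arc q (g x) - arc p (g x)) * psi x).
Proof.
rewrite /Y -Rintegral_sub; [|by apply: bounded_measurableM => //; exact: arc_bm..].
by congr fine; apply: eq_integral => x _; rewrite -mulrBl /F (arc_lift hf).
Qed.

Let arcB_hit p q (x : circle R) : 0 < arc q x - arc p x -> exists2 y, p < y <= q & circle_pi y = x.
Proof. by rewrite subr_gt0; exact: arc_hit. Qed.

Let X_dens (c e : R) p q : p <= q ->
  (forall y, p < y <= q -> `|phi (circle_pi y) - c| <= e) ->
  `|X q - X p - c * (mass nu q - mass nu p)| <= e * (mass nu q - mass nu p).
Proof.
move=> pq pc; rewrite XB massB.
apply: weighted_mean => //; first by apply: bounded_measurableB; exact: arc_bm.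
  by move=> x; rewrite subr_ge0 arc_nd.
by move=> x /arcB_hit[y /pc + <-].
Qed.

Let Y_dens (c e : R) p q : p <= q ->
  (forall y, p < y <= q -> `|w y * phi (circle_pi y) - c| <= e) ->
  `|Y q - Y p - c * (mass nu (F q) - mass nu (F p))| <=
    e * (mass nu (F q) - mass nu (F p)).
Proof.
move=> pq pc; rewrite YB mass_lift//.
apply: weighted_mean => //; first exact: arcB_pinv_bm.
  by move=> x; rewrite subr_ge0 arc_nd.
move=> x /arcB_hit[y /pc + yx].
by rewrite /psi -yx /W circle_weight_pi.
Qed.

(** [X] has density [phi] with respect to the mass, and [Y] has density [w phi] with respect to the
    mass composed with [F]. By conformality both increments near [z] are, to first order, [phi] at
    [z] times the increment of the mass. *)
Let XY_dens : has_density (fun=> 0) (fun v => X v - Y v) (fun=> 0).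
Proof.
have [D D_nd dens] := nu_dens.
have F_nd := ltW_homo (lift_increasing hf).
pose c z := phi (circle_pi z).
have c_cont : continuous c by apply/circle_continuous.
have wc_cont : continuous (fun z => w z * c z).
  by move=> z; apply: cvgM; [exact: weight_continuous | exact: c_cont].
exists (fun v => mass nu v + mass nu (F v) + D v).
  by move=> x y xy; rewrite !lerD ?mass_nd ?D_nd// F_nd.
move=> z e e0; set k := c z.
have e1 : 0 < e / (`|k| + 1) by rewrite divr_gt0// ltr_wpDl.
have [d1 d10 h1] := dens z _ e1.
have /cvgrPdist_lt/(_ _ e0)/nbhs_ballP[d2 /= d20 h2] := c_cont z.
have /cvgrPdist_lt/(_ _ e0)/nbhs_ballP[d3 /= d30 h3] := wc_cont z.
exists (Num.min d1 (Num.min d2 d3)); first by rewrite !lt_min d10 d20.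
move=> p q pzq; have /andP[pz zq] := pzq.
rewrite !ltrBlDr -!ltrBlDl !lt_min.
move=> /andP[zp1 /andP[zp2 zp3]] /andP[qz1 /andP[qz2 qz3]].
have pq := le_trans pz zq.
have [dp1 dq1] : z - d1 < p /\ q < z + d1 by split; lra.
have i1 := h1 p q pzq dp1 dq1.
have near_z d y : z - p < d -> q - z < d -> p < y <= q -> `|z - y| < d.
  by move=> ? ? ?; rewrite ltr_norml; apply/andP; lra.
have i2 : `|X q - X p - k * (mass nu q - mass nu p)| <= e * (mass nu q - mass nu p).
  apply: X_dens => // y yI; rewrite distrC ltW//; apply: h2.
  exact: near_z.
have i3 : `|Y q - Y p - w z * k * (mass nu (F q) - mass nu (F p))| <=
    e * (mass nu (F q) - mass nu (F p)).
  apply: Y_dens => // y yI; rewrite distrC ltW//; apply: h3.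
  exact: near_z.
move: i1 i2 i3; rewrite /= -/F -/(w z).
move: (X q) (X p) (Y q) (Y p) (w z) => xq xp yq yp wz.
move: (mass nu q) (mass nu p) (mass nu (F q)) (mass nu (F p)) => mq mp mq' mp' i1 i2 i3.
have i4 := ler_wpM2l (normr_ge0 k) i1.
have k1 : `|k| * (e / (`|k| + 1)) <= e.
  by rewrite mulrCA ler_piMr ?(ltW e0)// ler_pdivrMr ?ltr_wpDl// mul1r lerDl.
have D0 : 0 <= D q - D p by rewrite subr_ge0 D_nd.
have i5 := ler_wpM2r D0 k1.
rewrite -normrM in i4; rewrite mulrA in i4.
rewrite mul0r subr0.
have -> : xq - yq - (xp - yp) = (xq - xp - k * (mq - mp)) +
    (k * (mq - mp - wz * (mq' - mp'))) - (yq - yp - wz * k * (mq' - mp')) by ring.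
apply: (le_trans (ler_normB _ _)).
have i6 := ler_normD (xq - xp - k * (mq - mp)) (k * (mq - mp - wz * (mq' - mp'))).
move: i2 i3 i4 i5 i6; move: (Num.norm _) (Num.norm _) (Num.norm _) (Num.norm _) => a1 a2 a3 a4.
lra.
Qed.

Let arc01 (x : circle R) : arc 1 x - arc 0 x = 1.
Proof.
rewrite /arc (_ : 1 - repr x = 0 - repr x + 1%:~R); last by ring.
by rewrite floorR_shift; ring.
Qed.

Lemma s_measure_test : \int[nu]_x phi x = \int[nu]_x psi x.
Proof.
(* Over a period, [X] and [Y] increase by the two integrals. *)
have h : X 0 - Y 0 = X 1 - Y 1 by apply: (has_density0 XY_dens).
have hX : X 1 - X 0 = \int[nu]_x phi x.
  rewrite XB; congr fine; apply: eq_integral => x _; by rewrite arc01 mul1r.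
have hY : Y 1 - Y 0 = \int[nu]_x psi x.
  rewrite YB; congr fine; apply: eq_integral => x _; by rewrite arc01 mul1r.
by rewrite -hX -hY; lra.
Qed.

End Test.

Lemma s_measure_of_density : s_measure f s nu.
Proof.
move=> phi phi_c; have E := congr1 EFin (s_measure_test phi_c); rewrite /Rintegral in E.
have b1 : bounded_measurable (phi : borel_circle R -> R) by exact: circle_continuous_bm.
have b2 := transfer_bm hf hs phi_c.
have i1 := bounded_measurable_integrable nu b1.
have i2 := bounded_measurable_integrable nu b2.
by rewrite !fineK in E; [exact: E|exact: integrable_fin_num..].
Qed.

End SMeasureOfMass.

(** * Construction of a measure from its distribution function *)

Section UpperRepr.
Variable R : realType.

Definition clip (x : R) : R := Num.max 0 (Num.min x 1).

Lemma clip_nd : {homo clip : x y / x <= y}.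
Proof.
move=> x y xy; rewrite /clip ge_max !le_max lexx /=; apply/orP; right.
by rewrite le_min !ge_min xy lexx orbT.
Qed.

(* The representative in [(0, 1]]. *)
Definition upper_repr (x : circle R) : R := arc 0 x + 1.

Lemma upper_repr_bounds x : 0 < upper_repr x <= 1.
Proof.
have := floorR_gt (0 - repr x); have := floorR_le (0 - repr x); rewrite /upper_repr /arc; lra.
Qed.

Lemma circle_pi_upper_repr x : circle_pi (upper_repr x) = x.
Proof.
rewrite /upper_repr /arc (_ : _ + 1 = repr x + (Num.floor (0 - repr x) + 1)%:~R).
  by rewrite circle_pi_shift circle_reprK.
by rewrite intrD /floorR; ring.
Qed.

Lemma upper_repr_pi y : 0 < y <= 1 -> upper_repr (circle_pi y) = y.
Proof.
move=> y01; rewrite /upper_repr arc_pi.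
suff -> : floorR (0 - y) = -1 by ring.
by rewrite /floorR (_ : Num.floor _ = -1) ?mulrNz//; apply: floor_def; rewrite mulrNz; lra.
Qed.

Lemma arc_clip v x : arc (clip v) x = (upper_repr x <= v)%R%:R + upper_repr x - 1.
Proof.
rewrite -{1}(circle_pi_upper_repr x) arc_pi.
have u01 := upper_repr_bounds x; set u := upper_repr x in u01 *.
suff -> : floorR (clip v - u) = (u <= v)%R%:R - 1 by ring.
rewrite /floorR; case: (leP u v) => uv.
  rewrite (_ : Num.floor _ = 0) ?subrr//; apply: floor_def.
  by rewrite /clip; case: (leP v 1) => v1; rewrite max_r; lra.
rewrite (_ : Num.floor _ = -1) ?mulrNz ?sub0r//; apply: floor_def; rewrite mulrNz.
by rewrite /clip min_l; [case: (leP 0 v)|]; lra.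
Qed.

Definition measurable_upper_repr : borel_circle R -> measurableTypeR R := upper_repr.

Lemma upper_repr_measurable : measurable_fun setT measurable_upper_repr.
Proof. by apply: measurable_funD => //; exact: arc_measurable. Qed.

HB.instance Definition _ := isMeasurableFun.Build _ _ _ _
  measurable_upper_repr upper_repr_measurable.

Definition measurable_circle_pi : measurableTypeR R -> borel_circle R := @circle_pi R.

Lemma circle_pi_measurable : measurable_fun setT measurable_circle_pi.
Proof.
apply: (@measurability _ _ (measurableTypeR R) (borel_circle R) setT measurable_circle_pi (@open (circle R)) erefl) => // _ [U Uo <-]; rewrite setTI.
apply: open_measurable; move/continuousP : (@circle_pi_continuous R); exact.
Qed.

HB.instance Definition _ := isMeasurableFun.Build _ _ _ _
  measurable_circle_pi circle_pi_measurable.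

(** Representatives in [(0, 1]] make arcs correspond to the right-closed intervals on which
    Lebesgue-Stieltjes measures are defined. *)
Lemma mass_clip (nu : probability (borel_circle R) R) a b : a <= b ->
  (mass nu (clip b) - mass nu (clip a))%:E =
  distribution nu measurable_upper_repr `]a, b]%classic.
Proof.
move=> ab; pose S : set (borel_circle R) := measurable_upper_repr @^-1` `]a, b]%classic.
have mS : measurable S.
  rewrite -[S]setTI; apply: (@upper_repr_measurable measurableT).
  exact: (measurable_itv `]a, b]).
have -> : distribution nu measurable_upper_repr `]a, b]%classic = nu S by [].
rewrite massB /Rintegral -[nu S]fineK ?fin_num_measure//; congr (fine _)%:E.
rewrite -[S in RHS]setIT -integral_indic//; apply: eq_integral => x _; congr EFin.
have xS : (x \in S) = (a < upper_repr x <= b).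
  by apply/idP/idP; rewrite inE /S /= in_itv.
rewrite !arc_clip indicE xS.
have -> (i j k : R) : i + k - 1 - (j + k - 1) = i - j by ring.
have [ux|ux] := leP (upper_repr x) a; first by rewrite (le_trans ux ab) subrr.
by rewrite subr0.
Qed.

End UpperRepr.

Section Distribution.
Variable R : realType.
Variable H : R -> R.
Hypothesis H_nd : {homo H : x y / x <= y}.
Hypothesis H1 : degree_one 1 H.
Hypothesis H_rc : right_cont H.

(** One period of [H], continued by constants: the cumulative function of a probability on [(0, 1]],
    to be projected to the circle. *)
Definition cdf_of x := H (clip x) - H 0.

Let cdf_nd : {homo cdf_of : x y / x <= y}.
Proof. by move=> x y xy; rewrite lerD2r; apply/H_nd/clip_nd. Qed.

Let cdf_rc : forall x, cdf_of y @[y --> x^'+] --> cdf_of x.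
Proof.
move=> x; apply/cvgrPdist_lt => e e0; have [d d0 h] := H_rc (clip x) e0.
near=> y.
have xy : x < y by near: y; exact: nbhs_right_gt.
have yd : y < x + d by near: y; apply: nbhs_right_lt; rewrite ltrDl.
rewrite ler0_norm ?subr_le0 ?cdf_nd ?(ltW xy)// /cdf_of.
suff : H (clip y) <= H (clip x + d) by lra.
apply: H_nd; rewrite /clip.
by case: (leP x 1); case: (leP y 1) => ? ?; rewrite /Num.max; do 2?case: ifP; lra.
Unshelve. all: end_near. Qed.

HB.instance Definition _ := isCumulative.Build R _ R cdf_of cdf_nd cdf_rc.

Let cdfNy : cdf_of @ -oo --> (0 : R).
Proof.
apply: cvg_near_cst; near=> x.
rewrite /cdf_of /clip (_ : Num.max _ _ = 0) ?subrr//.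
have x0 : x <= 0 by near: x; exact: nbhs_ninfty_le.
by rewrite min_l ?max_l//; lra.
Unshelve. all: end_near. Qed.

Let cdfy : cdf_of @ +oo --> (1 : R).
Proof.
apply: cvg_near_cst; near=> x.
have x1 : 1 <= x by near: x; exact: nbhs_pinfty_ge.
rewrite /cdf_of /clip min_r// max_r ?ler01//.
by have := H1 0; rewrite add0r => ->; ring.
Unshelve. all: end_near. Qed.

HB.instance Definition _ := isCumulativeBounded.Build R 0 1 cdf_of cdfNy cdfy.

Let LS : probability (measurableTypeR R) R := lebesgue_stieltjes_measure cdf_of.

Let LS_itv a b : a <= b -> LS `]a, b]%classic = (H (clip b) - H (clip a))%:E.
Proof.
move=> ab; rewrite /LS /= /lebesgue_stieltjes_measure /measure_extension.
rewrite measurable_mu_extE/=; last exact: is_ocitv.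
by rewrite wlength_itv_bnd//; congr EFin; rewrite /cdf_of; ring.
Qed.

Definition circle_measure : probability (borel_circle R) R :=
  distribution LS (@measurable_circle_pi R).

Let clip_id (x : R) : 0 <= x <= 1 -> clip x = x.
Proof. by move=> /andP[x0 x1]; rewrite /clip min_l// max_r. Qed.

(** Degree one reduces the claim to [[0, 1]]. There [LS] is carried by [J], on which [upper_repr]
    inverts [circle_pi], so the preimage [S] and the interval [I] differ by a null set. *)
Lemma mass_circle_measure u v :
  mass circle_measure v - mass circle_measure u = H v - H u.
Proof.
suff h (x : R) : mass circle_measure x - H x = mass circle_measure 0 - H 0.
  by have := h u; have := h v; lra.
wlog x01 : x / 0 <= x <= 1.
  move=> h; rewrite -(h (x - floorR x)); last first.
    by have := floorR_le x; have := floorR_gt x; lra.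
  rewrite -mulrNz !(degree_oneD H1) (degree_oneD (mass_degree_one _)); ring.
have x0 : 0 <= x by case/andP: x01.
suff E : (mass circle_measure x - mass circle_measure 0)%:E = (H x - H 0)%:E.
  by case: E; lra.
have c0 : clip 0 = 0 :> R by rewrite clip_id// lexx ler01.
rewrite -[in LHS](clip_id x01) -[in LHS]c0 mass_clip//.
rewrite -[in RHS](clip_id x01) -[in RHS]c0 -LS_itv//.
pose I : set (measurableTypeR R) := `]0, x]%classic.
pose J : set (measurableTypeR R) := `]0, 1]%classic.
have mI : measurable I by exact: (measurable_itv `]0, x]).
have mJ : measurable J by exact: (measurable_itv `]0, 1]).
pose S : set (measurableTypeR R) :=
  @measurable_circle_pi R @^-1` (@measurable_upper_repr R @^-1` I).
have mS : measurable S.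
  rewrite -[S]setTI; apply: (@circle_pi_measurable R measurableT).
  by rewrite -[X in measurable X]setTI; exact: (@upper_repr_measurable R measurableT).
suff : LS S = LS I by [].
have IJ (y : R) : I y -> J y.
  by rewrite /I /J /= !in_itv /= => /andP[-> /le_trans]; apply; case/andP: x01.
have SJ (y : R) : J y -> S y <-> I y.
  rewrite /J /S /I /= !in_itv /= => y01.
  by rewrite /measurable_upper_repr /measurable_circle_pi upper_repr_pi.
apply/eqP; rewrite eq_le; apply/andP; split; last first.
  apply: le_measure; rewrite ?inE// => y Iy.
  by apply/SJ => //; exact: IJ.
have J0 : LS (~` J) = 0%E.
  rewrite probability_setC// LS_itv// c0 clip_id ?ler01 ?lexx//.
  by have -> : H 1 - H 0 = 1; [have := H1 0; rewrite add0r => ->; ring|rewrite subee].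
apply: (@le_trans _ _ (LS (I `|` ~` J))).
  apply: le_measure; rewrite ?inE//; first exact/measurableU/measurableC.
  move=> y Sy; have [Jy|nJy] := pselect (J y); last by right.
  by left; apply/SJ.
have mJC : measurable (~` J) by exact: measurableC.
have le : (LS (I `|` ~` J) <= LS I + LS (~` J))%E by exact: measureU2.
by rewrite J0 adde0 in le.
Qed.

(** [mass nu] determines the law of [upper_repr] under [nu] on half-open intervals, hence
    altogether; projecting this law to the circle returns [nu], as [circle_pi] undoes
    [upper_repr]. *)
Lemma circle_measure_unique (nu : probability (borel_circle R) R) :
  (forall u v, u <= v -> mass nu v - mass nu u = H v - H u) ->
  forall A, measurable A -> nu A = circle_measure A.
Proof.
move=> nuH A mA.
have h X : ocitv X ->
    lebesgue_stieltjes_measure cdf_of X = distribution nu (@measurable_upper_repr R) X.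
  move=> [[a b] _ <-] /=; have [ab|ab] := leP a b.
    by rewrite -[LHS]/(LS _) LS_itv// -mass_clip// nuH// clip_nd.
  by rewrite set_itv_ge ?bnd_simp -?leNgt 1?ltW// !measure0.
have mB : measurable (@measurable_circle_pi R @^-1` A).
  by rewrite -[X in measurable X]setTI; exact: (@circle_pi_measurable R measurableT).
rewrite -[RHS]/(lebesgue_stieltjes_measure cdf_of (@measurable_circle_pi R @^-1` A)).
rewrite (lebesgue_stieltjes_measure_unique h mB).
congr (nu _); apply/seteqP; split=> x /=;
  by rewrite /measurable_circle_pi /measurable_upper_repr circle_pi_upper_repr.
Qed.

End Distribution.

Unset Implicit Arguments.

Theorem theorem2 (R : realType) (f : circle R -> circle R) (s : R)
    (hf : multicritical f) (hrot : irrational_rotation_number f)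
    (hs : s < 0) :
  exists mu : probability (borel_circle R) R,
    s_measure f s mu /\
    forall nu : probability (borel_circle R) R, s_measure f s nu ->
      forall A : set (borel_circle R), measurable A -> nu A = mu A.
Proof.
have t0 : 0 < - s by rewrite oppr_gt0.
have F1 := lift_degree_one hf; have F_inc := lift_increasing hf.
have F_der := lift_is_derive hf.
have [hX [Xi [Xi1 Xi_nd F_cr]]] := lift_distortion hf.
have [rho F_rho rho_irr] := lift_rotation hrot.
have scales (d : R) n : 0 < d -> exists a p b q,
    [/\ good_pair (lift f) a p b q, (n < a)%N & forall x, ret (lift f) a p x - x < d].
  exact: small_scales F1 F_inc F_der Xi1 Xi_nd F_cr F_rho rho_irr d n.
have surj y : exists x, lift f x = y by exact: lift_surj F1 (lift_continuous hf) y.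
pose G y := projT1 (cid (surj y)).
have GK : cancel G (lift f) by move=> y; exact: projT2 (cid (surj y)).
have w_cont := weight_continuous hf hs.
have [H cf] : exists H, conformal (lift f) (dlift f) (- s) 1 H.
  apply: (conformal_exists F_inc (lift_continuous hf) w_cont).
  move=> e e0.
  exact: (almost_conformal_exists F1 F_inc F_der (dlift_continuous hf) Xi1 Xi_nd
    F_cr scales t0 GK e0).
exists (circle_measure (cf_nd cf) (cf_per cf) (cf_rc cf)); split.
  apply: s_measure_of_density => //.
  have [D D_nd dens] := cf_dens cf; exists D => // z e e0.
  have [d d0 h] := dens z e e0; exists d => // p q pzq zp qz.
  by rewrite /= !mass_circle_measure; exact: h.
move=> nu nu_s; apply: circle_measure_unique => u v uv.
apply: (conformal_unique F1 F_inc F_der Xi1 Xi_nd F_cr (ltW t0) scales) uv => //.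
exact: mass_conformal.
Qed.
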